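(* Let $\theta,\sigma>0$, $\mu_0\in\mathbb{R}$, $\sigma_0^2>0$ (with $\sigma_0>0$), and let $A:[0,\infty)\to\mathbb{R}$ be continuous with $A(t)\to 0$ as $t\to\infty$ and $\int_0^\infty |A(t)|\,dt<\infty$. Put $\alpha:=e^{-\int_0^\infty A(s)\,ds}>0$. For each $\epsilon>0$ let $X^{(\epsilon)}=(X^{(\epsilon)}_t;t\ge 0)$ be the unique strong solution of $$dX^{(\epsilon)}_t=-(\theta-A(t))X^{(\epsilon)}_t\,dt+\epsilon\sigma\,dB_t,\qquad X^{(\epsilon)}_0=\xi,$$ where $B$ is a standard one-dimensional Brownian motion and $\xi$ is a Gaussian random variable with mean $\mu_0$ and variance $\sigma_0^2$, independent of $B$. Let $\mathcal{L}^{(\epsilon)}_t$ be the law of $(X^{(\epsilon)}_0,X^{(\epsilon)}_t)$ and let $\mathcal{I}^{(\epsilon)}_t:=\mathcal{L}(X^{(\epsilon)}_0)\otimes\mathcal{L}(X^{(\epsilon)}_t)$ be the product of the marginal laws. Set, for $\epsilon\in(0,1)$, $$t_\epsilon:=\frac{|\ln\epsilon|}{\theta},$$ and let $(\omega_\epsilon)_{\epsilon>0}$ be any family of window sizes with $\omega_\epsilon\to\omega$ as $\epsilon\to0$, for some constant $\omega>0$. Then the family $(X^{(\epsilon)};\epsilon>0)$ has decorrelation profile at $\{(t_\epsilon,\omega_\epsilon);\epsilon>0\}$ under each of the following: (i) the Kullback-Leibler divergence $d^{(\epsilon)}(t)=D_{KL}(\mathcal{L}^{(\epsilon)}_t|\mathcal{I}^{(\epsilon)}_t)$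 (with $M=\infty$), with profile function $$G_{KL}(r)=\lim_{\epsilon\to0}D_{KL}\big(\mathcal{L}^{(\epsilon)}_{t_\epsilon+r\omega_\epsilon}\big|\mathcal{I}^{(\epsilon)}_{t_\epsilon+r\omega_\epsilon}\big)=\frac12\ln\left(1+\frac{2\theta\sigma_0^2}{\sigma^2\alpha^2e^{2\theta r\omega}}\right),\qquad r\in\mathbb{R};$$ (ii) the normalised Wasserstein distance of order 2, $d^{(\epsilon)}(t)=\mathcal{W}_2(\mathcal{L}^{(\epsilon)}_t,\mathcal{I}^{(\epsilon)}_t)/\epsilon$ (with $M=\infty$), with profile function $$G_{\mathcal{W}_2}(r)=\lim_{\epsilon\to0}\frac{\mathcal{W}_2\big(\mathcal{L}^{(\epsilon)}_{t_\epsilon+r\omega_\epsilon},\mathcal{I}^{(\epsilon)}_{t_\epsilon+r\omega_\epsilon}\big)}{\epsilon}=\sqrt{2\sigma_0^2\left(\frac{\sigma^2}{2\theta\sigma_0^2}+\frac{e^{-2\theta r\omega}}{\alpha^2}-\sqrt{\frac{\sigma^4}{4\theta^2\sigma_0^4}+\frac{\sigma^2e^{-2r\theta\omega}}{2\theta\sigma_0^2\alpha^2}}\right)},\qquad r\in\mathbb{R};$$ (iii) the total variation distance $d^{(\epsilon)}(t)=\|\mathcal{L}^{(\epsilon)}_t-\mathcal{I}^{(\epsilon)}_t\|_{TV}$ (with $M=1$), with profile function $$G_{TV}(r)=\lim_{\epsilon\to0}\big\|\mathcal{L}^{(\epsilon)}_{t_\epsilon+r\omega_\epsilon}-\mathcal{I}^{(\epsilon)}_{t_\epsilon+r\omega_\epsilon}\big\|_{TV}=\|\mathcal{N}(0,M(r))-\mathcal{N}(0,\mathbf{I}_2)\|_{TV},\qquad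 r\in\mathbb{R},$$ where $$M(r)=\begin{pmatrix}1&\phi(r)\\ \phi(r)&1\end{pmatrix},\qquad \mathbf{I}_2=\begin{pmatrix}1&0\\0&1\end{pmatrix},\qquad \phi(r)=\sigma_0\sqrt{\frac{2\theta}{\sigma^2\alpha^2e^{2\theta r\omega}+2\theta\sigma_0^2}}.$$
   Context: Decorrelation profile. Let $d^{(\epsilon)}(t)$ be a statistical distance (possibly depending on $\epsilon$) between the joint law $\mathcal{L}^{(\epsilon)}_t$ of $(X_0^{(\epsilon)},X_t^{(\epsilon)})$ and the product law $\mathcal{I}^{(\epsilon)}_t=\mathcal{L}(X_0^{(\epsilon)})\otimes\mathcal{L}(X_t^{(\epsilon)})$, and let $M\in(0,\infty]$ be the diameter (maximal value) of that distance. The family $(X^{(\epsilon)};\epsilon>0)$ has decorrelation profile at $\{(t_\epsilon,\omega_\epsilon);\epsilon>0\}$ with profile $G$ if $t_\epsilon\to+\infty$ as $\epsilon\to0$, $\omega_\epsilon=o(t_\epsilon)$, the limit $G(r):=\lim_{\epsilon\to0}d^{(\epsilon)}(t_\epsilon+r\omega_\epsilon)$ exists for all $r\in\mathbb{R}$, and $\lim_{r\to-\infty}G(r)=M$, $\lim_{r\to+\infty}G(r)=0$. Distances, for probability measures $\mathbb{P},\mathbb{Q}$ on the same measurable space $(\Omega,\mathcal{F})$: $\|\mathbb{P}-\mathbb{Q}\|_{TV}:=\sup_{E\in\mathcal{F}}|\mathbb{P}(E)-\mathbb{Q}(E)|$; $D_{KL}(\mathbb{P}|\mathbb{Q}):=\int\ln\left(\frac{d\mathbb{P}}{d\mathbb{Q}}\right)d\mathbb{P}$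 if $\mathbb{P}\ll\mathbb{Q}$, and $+\infty$ otherwise; $\mathcal{W}_2(\mathbb{P},\mathbb{Q}):=\inf_\Pi\left(\int|u-v|^2\,\Pi(du,dv)\right)^{1/2}$, the infimum being over all couplings $\Pi$ of $\mathbb{P}$ and $\mathbb{Q}$ (here on $\mathbb{R}^2$ with the Euclidean norm). $\mathcal{N}(0,\Sigma)$ denotes the centred Gaussian law with covariance matrix $\Sigma$. The matrix $M(r)$ is unrelated to the diameter $M$. *)

(* Defs.v *)
From HB Require Import structures.
From mathcomp Require Import all_boot all_order all_algebra ring.
From mathcomp Require Import all_classical all_reals all_analysis.
From mathcomp Require Import measurable_realfun.

Set Implicit Arguments.
Unset Strict Implicit.
Unset Printing Implicit Defensive.

Import Order.TTheory GRing.Theory Num.Theory.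
Import numFieldNormedType.Exports.

Local Open Scope classical_set_scope.
Local Open Scope ring_scope.
Local Open Scope charge_scope.

Section distances.
Context {d : measure_display} {T : measurableType d} {R : realType}.
Local Open Scope ereal_scope.

(* Stated for measures so that it applies to [centred_gaussian2], which is a
   probability only for positive definite matrices. *)
Definition tv_dist (P Q : {measure set T -> \bar R}) : \bar R :=
  ereal_sup [set `|P E - Q E| | E in [set E : set T | measurable E]].

(* The Radon-Nikodym derivative is finite and, P-almost surely, positive, so
   the value [lne 0 = -oo] plays no role. *)
Definition kl_div (P Q : probability T R) : \bar R :=
  if pselect (P `<< Q) is left _
  then \int[P]_x lne ('d (charge_of_finite_measure P) '/d Q x)
  else +oo.

Definition diameter (dist : probability T R -> probability T R -> \bar R) :=
  ereal_sup [set dist P Q | P in [set: probability T R]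
                          & Q in [set: probability T R]].

End distances.

Section wasserstein.
Context {R : realType}.
Local Open Scope ereal_scope.

(* Marginals are compared on measurable sets only: the values of measures on
   other sets are unspecified. *)
Definition is_coupling (P Q : probability (R * R)%type R)
    (Pi : probability ((R * R) * (R * R))%type R) :=
  forall E : set (R * R), measurable E ->
    Pi (E `*` setT) = P E /\ Pi (setT `*` E) = Q E.

(* The norm that the library puts on R * R is the max norm. *)
Definition euclid_norm (u : R * R) : R :=
  (Num.sqrt (u.1 ^+ 2 + u.2 ^+ 2))%R.

Definition wasserstein2 (P Q : probability (R * R)%type R) : \bar R :=
  ereal_inf [set (\int[Pi]_p (euclid_norm (p.1 - p.2) ^+ 2)%:E) `^ 2^-1
            | Pi in is_coupling P Q].

End wasserstein.

Section gaussian.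
Context {R : realType}.

Definition vec2 (z : R * R) : 'rV[R]_2 :=
  \row_(i < 2) (if i == 0 then z.1 else z.2).

Definition centred_gaussian2_pdf (S : 'M[R]_2) (z : R * R) : R :=
  (2 * pi * Num.sqrt (\det S))^-1 *
  expR (- (vec2 z *m invmx S *m (vec2 z)^T) 0 0 / 2).

(* N(0, S), for S symmetric positive definite. *)
Definition centred_gaussian2 (S : 'M[R]_2) : set (R * R) -> \bar R :=
  fun E => (\int[lebesgue_measure \x lebesgue_measure]_(z in E)
              (centred_gaussian2_pdf S z)%:E)%E.

Lemma centred_gaussian2_pdf_ge0 S z : 0 <= centred_gaussian2_pdf S z.
Proof. by rewrite mulr_ge0 ?expR_ge0// invr_ge0 !mulr_ge0 ?pi_ge0 ?sqrtr_ge0. Qed.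

Lemma measurable_centred_gaussian2_pdf S :
  measurable_fun setT (centred_gaussian2_pdf S).
Proof.
apply: measurable_funM => //; apply: measurableT_comp => //.
apply: measurable_funM => //; apply: measurableT_comp => //.
have mv i : measurable_fun setT (fun z : R * R => vec2 z 0 i).
  apply: (eq_measurable_fun (fun z : R * R => if i == 0 then z.1 else z.2)).
    by move=> z _; rewrite mxE.
  by case: (i == 0); [exact: measurable_fst|exact: measurable_snd].
apply: (eq_measurable_fun (fun z : R * R => \sum_j
    (\sum_i vec2 z 0 i * invmx S i j) * vec2 z 0 j)).
  move=> z _; rewrite [RHS]mxE; apply: eq_bigr => j _; rewrite [X in _ = X * _]mxE.
  by rewrite [X in _ = _ * X]mxE.
apply: measurable_sum => j; apply: measurable_funM => //.
by apply: measurable_sum => i; apply: measurable_funM.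
Qed.

Section measure.
Variable S : 'M[R]_2.
Local Open Scope ereal_scope.

Let gaussian0 : centred_gaussian2 S set0 = 0.
Proof. exact: integral_set0. Qed.

Let gaussian_ge0 E : 0 <= centred_gaussian2 S E.
Proof.
by apply: integral_ge0 => z _; rewrite lee_fin centred_gaussian2_pdf_ge0.
Qed.

Let gaussian_sigma_additive : semi_sigma_additive (centred_gaussian2 S).
Proof.
apply: (@semi_sigma_additive_nng_induced _ _ _ (lebesgue_measure \x lebesgue_measure)
    (fun z => (centred_gaussian2_pdf S z)%:E)) => [|z].
  by apply/measurable_EFinP; exact: measurable_centred_gaussian2_pdf.
by rewrite lee_fin centred_gaussian2_pdf_ge0.
Qed.

HB.instance Definition _ := isMeasure.Build _ _ _ (centred_gaussian2 S)
  gaussian0 gaussian_ge0 gaussian_sigma_additive.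

End measure.

Lemma det2 (S : 'M[R]_2) : \det S = S 0 0 * S 1 1 - S 0 1 * S 1 0.
Proof.
rewrite (expand_det_row _ 0) 2!big_ord_recl big_ord0 /cofactor !det_mx11 !mxE/=.
rewrite expr0 expr1 mul1r mulN1r addr0 mulrN.
have -> : lift 0 0 = 1 :> 'I_2 by apply/val_inj.
by have -> : lift 1 0 = 0 :> 'I_2 by apply/val_inj.
Qed.

Lemma centred_gaussian2_pdfE (S : 'M[R]_2) z : S^T = S -> 0 < S 0 0 ->
  0 < \det S ->
  centred_gaussian2_pdf S z = normal_pdf 0 (Num.sqrt (S 0 0)) z.1 *
    normal_pdf (S 0 1 / S 0 0 * z.1) (Num.sqrt (\det S / S 0 0)) z.2.
Proof.
move=> ST a0 D0; have S10 : S 1 0 = S 0 1 by rewrite -[in LHS]ST mxE.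
have DE := det2 S; rewrite S10 in DE.
have S01 (i : 'I_2) : i = 0 \/ i = 1.
  by case: i => [[|[|//]] ?]; [left|right]; apply/val_inj.
pose N : 'M[R]_2 := \matrix_(i < 2, j < 2)
    (if i == j then if i == 0 then S 1 1 / \det S else S 0 0 / \det S
     else - S 0 1 / \det S).
have DN0 : \det S != 0 by rewrite gt_eqF.
have SU : S \in unitmx by rewrite unitmxE unitfE.
have l0 : lift ord0 ord0 = 1 :> 'I_2 by apply/val_inj.
have o0 : ord0 = 0 :> 'I_2 by apply/val_inj.
have SN : S *m N = 1%:M.
  apply/matrixP => i j; rewrite !mxE 2!big_ord_recl big_ord0 l0 o0 !mxE/=.
  by case: (S01 i) => ->; case: (S01 j) => ->; rewrite /= ?S10 ?DE; field;
     rewrite -DE.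
have -> : centred_gaussian2_pdf S z = (2 * pi * Num.sqrt (\det S))^-1 *
   expR (- ((S 1 1 * z.1 ^+ 2 - 2 * S 0 1 * z.1 * z.2 + S 0 0 * z.2 ^+ 2)
     / \det S) / 2).
  congr (_ * expR (- _ / 2)).
  rewrite -[invmx S]mulmx1 -SN mulKmx// !mxE 2!big_ord_recl big_ord0 l0 o0 !mxE.
  rewrite !(big_ord_recl, big_ord0) l0 o0 !mxE /=.
  by field.
rewrite /normal_pdf !gt_eqF ?sqrtr_gt0 ?divr_gt0// /normal_peak /normal_fun.
rewrite !sqr_sqrtr ?divr_ge0 ?ltW//.
rewrite mulrACA -expRD; congr (_ * expR _); last first.
  by rewrite DE; field; rewrite -DE DN0 gt_eqF.
rewrite -invfM -sqrtrM ?mulrn_wge0 ?mulr_ge0 ?pi_ge0 ?ltW//; congr (_^-1).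
rewrite -[LHS]ger0_norm -?sqrtr_sqr ?mulr_ge0 ?pi_ge0 ?sqrtr_ge0//; congr Num.sqrt.
rewrite !exprMn sqr_sqrtr ?ltW//; field; by rewrite gt_eqF.
Qed.

Lemma centred_gaussian2_setT (S : 'M[R]_2) : S^T = S -> 0 < S 0 0 ->
  0 < \det S -> centred_gaussian2 S setT = 1%E.
Proof.
move=> ST a0 D0; rewrite /centred_gaussian2 fubini_tonelli1; last 2 first.
- by apply/measurable_EFinP; exact: measurable_centred_gaussian2_pdf.
- by move=> z; rewrite lee_fin centred_gaussian2_pdf_ge0.
rewrite -(integral_normal_pdf 0 (Num.sqrt (S 0 0))).
apply: eq_integral => x _; rewrite /fubini_F.
under eq_integral do rewrite centred_gaussian2_pdfE//= EFinM.
rewrite ge0_integralZl_EFin ?normal_pdf_ge0//.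
- by rewrite integral_normal_pdf mule1.
- by move=> y _; rewrite lee_fin normal_pdf_ge0.
- by apply/measurable_EFinP; exact: measurable_normal_pdf.
Qed.

End gaussian.

Section process.
Context {d : measure_display} {T : measurableType d} {R : realType}.
Variable P : probability T R.

(* s is the standard deviation. *)
Definition is_normal (Y : {RV P >-> R}) (m s : R) :=
  forall E : set R, measurable E -> distribution P Y E = normal_prob m s E.

Definition mutually_independent (n : nat) (Y : 'I_n -> T -> R) :=
  forall E : 'I_n -> set R, (forall i, measurable (E i)) ->
    P (\bigcap_i (Y i @^-1` E i)) = (\prod_(i < n) P (Y i @^-1` E i))%E.

(* Processes are indexed by R; only times t >= 0 are constrained. *)
Definition standard_brownian_motion (B : R -> {RV P >-> R}) :=
  [/\ {ae P, forall w, B 0 w = 0},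
      {ae P, forall w, {within `[0, +oo[, continuous (fun t => B t w)}},
      forall s t, 0 <= s < t -> is_normal (B t \- B s) 0 (Num.sqrt (t - s)) &
      forall (n : nat) (t : nat -> R), 0 <= t 0%N ->
          {homo t : i j / (i < j)%N >-> i < j} ->
        mutually_independent (fun i : 'I_n => B (t i.+1) \- B (t i))].

Definition sigma_algebra_of (I : set R) (Y : R -> {RV P >-> R}) : set (set T) :=
  <<s \bigcup_(t in I) preimage_set_system setT (Y t) measurable >>.

Definition independent_of_process (xi : {RV P >-> R}) (B : R -> {RV P >-> R}) :=
  forall (E : set R) (F : set T), measurable E -> sigma_algebra_of `[0, +oo[ B F ->
    P (xi @^-1` E `&` F) = (P (xi @^-1` E) * P F)%E.

(* The filtration generated by xi and B, augmented by the negligible sets. *)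
Definition augmented_filtration (xi : {RV P >-> R}) (B : R -> {RV P >-> R})
    (t : R) : set (set T) :=
  <<s preimage_set_system setT xi measurable `|`
      sigma_algebra_of `[0, t] B `|` P.-negligible >>.

(* Strong solution of dX_t = b(t, X_t) dt + c dB_t, X_0 = xi. As the diffusion
   coefficient c is constant, the stochastic integral of c over [0, t] is
   c (B_t - B_0). *)
Definition strong_solution (b : R -> R -> R) (c : R) (xi : {RV P >-> R})
    (B X : R -> {RV P >-> R}) :=
  [/\ forall t, 0 <= t -> forall E : set R, measurable E ->
        augmented_filtration xi B t (X t @^-1` E),
      {ae P, forall w, {within `[0, +oo[, continuous (fun t => X t w)}},
      {ae P, forall w, X 0 w = xi w} &
      {ae P, forall w, forall t, 0 <= t ->
        lebesgue_measure.-integrable `[0, t] (fun s => (b s (X s w))%:E) /\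
        X t w = xi w + \int[lebesgue_measure]_(s in `[0, t]) b s (X s w)
                + c * (B t w - B 0 w)}].

Definition rv_pair (Y Z : {RV P >-> R}) : T -> R * R := fun w => (Y w, Z w).

Lemma measurable_rv_pair Y Z : measurable_fun setT (rv_pair Y Z).
Proof. exact: measurable_fun_pair. Qed.

HB.instance Definition _ Y Z :=
  isMeasurableFun.Build _ _ _ _ (rv_pair Y Z) (measurable_rv_pair Y Z).

Definition joint_law (Y Z : {RV P >-> R}) : probability (R * R)%type R :=
  distribution P (rv_pair Y Z).

Definition product_law (Y Z : {RV P >-> R}) : probability (R * R)%type R :=
  (distribution P Y \x distribution P Z)%E.

(* Decorrelation profile of the family (X e)_{e > 0}, when the laws of interest
   are compared, at parameter e, by the distance [dist e] of diameter M. *)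
Definition decorrelation_profile (X : R -> R -> {RV P >-> R})
    (dist : R -> probability (R * R)%type R -> probability (R * R)%type R -> \bar R)
    (M : \bar R) (t_ w_ : R -> R) (G : R -> \bar R) :=
  let D e t := dist e (joint_law (X e 0) (X e t)) (product_law (X e 0) (X e t)) in
  [/\ (0 < M)%E /\ (forall e, 0 < e -> diameter (dist e) = M),
      t_ e @[e --> 0^'+] --> +oo,
      w_ =o_ (0^'+) t_,
      forall r, D e (t_ e + r * w_ e) @[e --> 0^'+] --> G r &
      (G r @[r --> -oo] --> M) /\ (G r @[r --> +oo] --> 0%E)].

End process.

(* Main.v *)
Require Import Defs.
From HB Require Import structures.
From mathcomp Require Import all_boot all_order all_algebra ring lra.
From mathcomp Require Import all_classical all_reals all_analysis.
From mathcomp Require Import measurable_realfun.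
Set Implicit Arguments.
Unset Strict Implicit.
Unset Printing Implicit Defensive.
Import Order.TTheory GRing.Theory Num.Theory.
Import numFieldNormedType.Exports.
Local Open Scope classical_set_scope.
Local Open Scope ring_scope.

(** For each time t > 0 the strong solution satisfies, almost surely,
    f(t) X_t = xi + e sigma int_0^t f dB with f(t) = exp(theta t - int_0^t A).
    The Wiener integral never has to be constructed: summation by parts along a
    path shows that the sums of f(t_i) (B(t_(i+1)) - B(t_i)) converge, and their
    normalised versions are standard Gaussian and independent of xi for every
    grid. Hence (X_0, X_t) has the law of (U, m U + s G), where U = xi and G is an
    independent standard Gaussian, with m = 1 / f(t) and
    s = e sigma sqrt(int_0^t f^2) / f(t).
    For such a pair the Kullback-Leibler divergence is explicit, the total
    variation distance depends continuously on the correlation, and W_2 lies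
    between two bounds which differ by the term m^2 Var(X_t) under the square
    root. At t_e + r w_e both m / e and s / e converge, since f(t) e^(-theta t)
    tends to alpha and int_0^t f^2 / f(t)^2 to 1 / (2 theta), so the gap between
    the two bounds disappears in the limit. *)

(** * Gaussian laws on the line and in the plane *)

(** Write b for sigma0, tau = sqrt (m^2 b^2 + s^2) for the standard deviation of X_t and rho = m b /
    tau for its correlation with X_0. Total variation and Kullback-Leibler are invariant under
    affine changes of each coordinate, so they depend on rho alone. At the times considered m and s
    are both of order e: e cancels in rho but remains a factor of W_2, whence the normalisation. The
    exact W_2 distance of two Gaussian laws is avoided: the upper bound drives both pairs by the
    same two standard Gaussians, the lower one uses quadratic potentials, and the gap m^2 tau^2
    under the root is of order e^4 against e^2. Total variation is 1 minus the integral of the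
    minimum of two densities, which the standard Gaussian density dominates for every rho. This also
    covers r -> -oo, where rho -> 1 and the correlated density vanishes in the limit off the
    diagonal. The Gaussian sums converge almost surely, and the limit is taken on laws restricted to
    an event on xi; that event carries the independence. *)

(* [lebesgue_measure] and [normal_prob] live on a copy of R with another measure
   display; [leb2] and [normal_law] are the same measures on R * R and R. *)
Definition leb2 {R : realType} : set (R * R) -> \bar R :=
  (@lebesgue_measure R \x @lebesgue_measure R)%E.

Section leb2_measure.
Context {R : realType}.
Notation mu := (@lebesgue_measure R).

Let leb2_0 : @leb2 R set0 = 0%E.
Proof. exact: (measure0 (mu \x mu)%E). Qed.

Let leb2_ge0 E : (0 <= @leb2 R E)%E.
Proof. exact: (measure_ge0 (mu \x mu)%E). Qed.

Let leb2_sigma_additive : semi_sigma_additive (@leb2 R).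
Proof. exact: (@measure_semi_sigma_additive _ _ _ (mu \x mu)%E). Qed.

HB.instance Definition _ := isMeasure.Build _ _ _ (@leb2 R)
  leb2_0 leb2_ge0 leb2_sigma_additive.

End leb2_measure.

(** Open rays are stable under intersection and generate the Borel sets, and those with integer
    endpoints exhaust the line, so the uniqueness theorem for measures applies. *)
Lemma eq_finite_measure_rays {R : realType} (m1 m2 : {measure set R -> \bar R}) :
  (m1 setT < +oo)%E ->
  (forall x, m1 `]-oo, x[%classic = m2 `]-oo, x[%classic) ->
  forall E, measurable E -> m1 E = m2 E.
Proof.
move=> m1oo m12 E mE.
apply: (@measure_unique _ R R (@RGenInftyO.G R)
  (fun n : nat => `]-oo, (n%:R : R)[%classic)) => //.
- exact: RGenInftyO.measurableE.
- move=> _ _ [x ->] [y ->]; exists (Num.min x y).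
  by apply/seteqP; split => z /=; rewrite !in_itv/= lt_min => /andP.
- by move=> n; exists n%:R.
- rewrite -subTset => x _; exists (Num.truncn `|x|).+1 => //=.
  by rewrite in_itv/=; apply: (le_lt_trans (ler_norm x)); exact: truncnS_gt.
- by move=> _ [x ->].
- by move=> n; apply: le_lt_trans m1oo; apply: le_measure; rewrite ?inE.
Qed.

(** [m2] is only assumed to agree with the image of [m1] on measurable sets, so the rule applies to
    laws known through their values, such as the marginals of a coupling. *)
Lemma ge0_integral_image {d1 d2} {T1 : measurableType d1} {T2 : measurableType d2}
    {R : realType} (m1 : {measure set T1 -> \bar R}) (m2 : {measure set T2 -> \bar R})
    (phi : T1 -> T2) (f : T2 -> R) :
  measurable_fun setT phi ->
  (forall A, measurable A -> m2 A = m1 (phi @^-1` A)) ->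
  measurable_fun setT f -> (forall y, 0 <= f y) ->
  (\int[m2]_y (f y)%:E = \int[m1]_x (f (phi x))%:E)%E.
Proof.
move=> mphi m2E mf f0.
transitivity (\int[pushforward m1 phi]_y (f y)%:E)%E.
  by apply: eq_measure_integral => A mA _; exact: m2E.
have mEf : measurable_fun setT (EFin \o f) by exact/measurable_EFinP.
have f0' : {in setT, forall y, 0 <= (EFin \o f) y}%E by move=> y _; rewrite /= lee_fin.
exact: (ge0_integral_pushforward mphi m1 measurableT mEf f0').
Qed.

Section density.
Context {d : measure_display} {T : measurableType d} {R : realType}.
Variables (nu : {finite_measure set T -> \bar R})
          (mu : {sigma_finite_measure set T -> \bar R}) (g : T -> R).
Hypothesis mg : measurable_fun setT g.
Hypothesis g0 : forall x, 0 <= g x.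
Hypothesis nuE : forall A, measurable A -> nu A = (\int[mu]_(x in A) (g x)%:E)%E.

Lemma density_dominates : nu `<< mu.
Proof.
apply/null_content_dominatesP => A mA muA0; rewrite nuE//.
by rewrite null_set_integral//; exact/measurable_EFinP/measurable_funTS.
Qed.

(** [g] and the Radon-Nikodym derivative of [nu] have the same integral over every measurable set,
    hence agree [mu]-almost everywhere, and the change of variables known for the derivative passes
    to [g]. *)
Lemma ge0_integral_density (f : T -> \bar R) :
  measurable_fun setT f -> (forall x, (0 <= f x)%E) ->
  (\int[nu]_x f x = \int[mu]_x (f x * (g x)%:E))%E.
Proof.
move=> mf f0; have numu := density_dominates.
rewrite -(@Radon_Nikodym_SigmaFinite.change_of_variables _ _ _ nu mu)//.
have iRN := Radon_Nikodym_SigmaFinite.f_integrable numu.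
have mRN := measurable_int _ iRN.
apply: ae_eq_integral => //.
- exact: emeasurable_funM.
- by apply: emeasurable_funM => //; exact/measurable_EFinP.
apply: ae_eqe_mul2l; apply: integral_ae_eq => //; first exact/measurable_EFinP.
move=> E _ mE; rewrite -nuE//.
by rewrite -Radon_Nikodym_SigmaFinite.f_integral.
Qed.

End density.

Definition normal_law {R : realType} (m s : R) : set R -> \bar R := normal_prob m s.

Section normal_law_measure.
Context {R : realType} (m s : R).

Let normal_law0 : normal_law m s set0 = 0%E.
Proof. exact: (measure0 (normal_prob m s)). Qed.

Let normal_law_ge0 E : (0 <= normal_law m s E)%E.
Proof. exact: (measure_ge0 (normal_prob m s)). Qed.

Let normal_law_sigma_additive : semi_sigma_additive (normal_law m s).
Proof. exact: (@measure_semi_sigma_additive _ _ _ (normal_prob m s)). Qed.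

HB.instance Definition _ := isMeasure.Build _ _ _ (normal_law m s)
  normal_law0 normal_law_ge0 normal_law_sigma_additive.

Let normal_law_setT : normal_law m s setT = 1%E.
Proof. exact: (@probability_setT _ _ _ (normal_prob m s)). Qed.

HB.instance Definition _ := @Measure_isProbability.Build _ _ R (normal_law m s)
  normal_law_setT.

Lemma normal_lawE E :
  normal_law m s E = (\int[lebesgue_measure]_(x in E) (normal_pdf m s x)%:E)%E.
Proof. by []. Qed.

End normal_law_measure.

Section standard_normal.
Context {R : realType}.
Notation mu := (@lebesgue_measure R).
Notation gamma := (@normal_law R 0 1).

Lemma ge0_integral_normal_law (m s : R) (f : R -> \bar R) :
  measurable_fun setT f -> (forall x, (0 <= f x)%E) ->
  (\int[normal_law m s]_x f x = \int[mu]_x (f x * (normal_pdf m s x)%:E))%E.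
Proof.
move=> mf f0.
(* The identity map transports the integral between the two displays of the line. *)
transitivity (\int[normal_prob m s]_x f x)%E.
  have mid : @measurable_fun _ _ (measurableTypeR R) R setT id.
    by move=> _ A mA; rewrite setTI.
  have := @ge0_integral_pushforward _ _ (measurableTypeR R) R R id mid (normal_prob m s) setT f.
  rewrite preimage_setT => <-//.
apply: (@ge0_integral_density _ _ _ (normal_prob m s) mu (normal_pdf m s)) => //.
exact: measurable_normal_pdf.
Qed.

(** On rays this is the substitution of m + s y in the integral of the density, and rays determine a
    finite measure. *)
Lemma normal_law_affine (m s : R) (E : set R) : 0 < s -> measurable E ->
  normal_law m s E = gamma ((fun x => m + s * x) @^-1` E).
Proof.
move=> s0 mE.
have mf : measurable_fun [set: R] (fun x : R => m + s * x).
  by apply: measurable_funD => //; exact: measurable_funM.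
pose f : {mfun R >-> R} := HB.pack (fun x : R => m + s * x)
  (isMeasurableFun.Build _ _ _ _ _ mf).
apply: (@eq_finite_measure_rays R (normal_law m s) (pushforward gamma f)); last 2 first.
- move=> x; rewrite /pushforward /=.
have -> : pushforward gamma f `]-oo, x[ = gamma `]-oo, (x - m) / s[%classic.
  congr (gamma _).
  by apply/seteqP; split => y /=; rewrite !in_itv/= ltr_pdivlMr// mulrC ltrBrDl.
rewrite /normal_law /normal_prob.
have mpdf m' s' : measurable_fun setT (EFin \o @normal_pdf R m' s').
  by apply/measurable_EFinP; exact: measurable_normal_pdf.
(* The substitution rule concerns closed rays; adding the endpoint does not change the integral. *)
rewrite (integral_itv_bndo_bndc (f := EFin \o normal_pdf m s)); last first.
  exact: measurable_funTS.
rewrite (integral_itv_bndo_bndc (f := EFin \o normal_pdf 0 1)); last first.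
  exact: measurable_funTS.
set a := (x - m) / s.
pose F := fun y : R => m + s * y.
have -> : x = F a by rewrite /F /a; field; rewrite gt_eqF.
have df (y : R) : is_derive y (1:R) F s.
  rewrite /F; apply: is_derive_eq.
  by rewrite add0r mul1r /GRing.scale/= mulr1.
have dFE : (F^`())%classic = cst s.
  by apply/funext => y; rewrite derive1E; exact: derive_val.
rewrite increasing_ge0_integration_by_substitutionNy.
- apply: eq_integral => y _; rewrite fctE/= dFE /=; congr EFin.
  rewrite /normal_pdf gt_eqF// oner_eq0 /normal_peak /normal_fun.
  rewrite mulrAC; congr (_ * expR _); last by rewrite /F; field; rewrite gt_eqF.
  rewrite -mulrnAr sqrtrM ?sqr_ge0// sqrtr_sqr gtr0_norm// invfM mulrAC mulVf ?gt_eqF//.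
  by rewrite expr1n !mul1r.
- by move=> y z _ _ yz; rewrite /F ltrD2l ltr_pM2l.
- by move=> y _; rewrite dFE; exact: cvg_cst.
- by rewrite dFE; exact: is_cvg_cst.
- by rewrite dFE; exact: cvg_cst.
- split; first by move=> y _; apply: (@ex_derive _ _ _ _ _ _ _ (df y)).
  apply: cvg_at_left_filter.
  apply: differentiable_continuous; apply/derivable1_diffP.
  exact: (@ex_derive _ _ _ _ _ _ _ (df a)).
- apply/cvgrNyPle => A; near=> y.
  by rewrite /F -lerBrDl mulrC -ler_pdivlMr.
- by apply: continuous_subspaceT; exact: continuous_normal_pdf (lt0r_neq0 s0).
- by move=> y _; exact: normal_pdf_ge0.
- exact: mE.
- by rewrite -ge0_fin_numE// fin_num_measure.
Unshelve. all: end_near. Qed.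
#[local] Opaque normal_law.

(** With t = sqrt (1 - s^2) this is the Cholesky factor of the correlation matrix: it sends a
    standard Gaussian vector to one with correlation s. *)
Definition shear {R : realType} (s t : R) (p : R * R) : R * R :=
  (p.1, s * p.1 + t * p.2).

Lemma measurable_shear (s t : R) : measurable_fun setT (shear s t).
Proof.
apply: measurable_fun_pair => //.
by apply: measurable_funD; apply: measurable_funM.
Qed.

Definition corr_mx (r : R) : 'M[R]_2 := \matrix_(i, j) (if i == j then 1 else r).

Lemma trmx_corr r : (corr_mx r)^T = corr_mx r.
Proof. by apply/matrixP => i j; rewrite !mxE eq_sym. Qed.

Lemma det_corr r : \det (corr_mx r) = 1 - r ^+ 2.
Proof. by rewrite det2 !mxE/= mulr1 expr2. Qed.

(** Density of the first coordinate times the conditional density of the second given the first: the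
    form suited to iterated integrals. *)
Lemma corr_pdfE (r : R) z : r ^+ 2 < 1 ->
  centred_gaussian2_pdf (corr_mx r) z =
  normal_pdf 0 1 z.1 * normal_pdf (r * z.1) (Num.sqrt (1 - r ^+ 2)) z.2.
Proof.
move=> r1; rewrite centred_gaussian2_pdfE ?trmx_corr ?det_corr ?subr_gt0//.
  by rewrite !mxE/= sqrtr1 !divr1.
by rewrite mxE.
Qed.

(** The form symmetric in the two coordinates, from which their exchange and the pointwise limits in
    [r] are read off. *)
Lemma corr_pdfEexp (r : R) z : r ^+ 2 < 1 ->
  centred_gaussian2_pdf (corr_mx r) z =
  (2 * pi * Num.sqrt (1 - r ^+ 2))^-1 *
  expR (- ((z.1 ^+ 2 - 2 * r * z.1 * z.2 + z.2 ^+ 2) / (1 - r ^+ 2)) / 2).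
Proof.
move=> r1; rewrite corr_pdfE// /normal_pdf oner_eq0.
have r0 : 0 < 1 - r ^+ 2 by rewrite subr_gt0.
rewrite gt_eqF ?sqrtr_gt0// /normal_peak /normal_fun.
rewrite !sqr_sqrtr ?ltW// mulrACA -expRD; congr (_ * expR _); last first.
  by field; rewrite gt_eqF.
rewrite -invfM -sqrtrM ?mulrn_wge0 ?mulr_ge0 ?pi_ge0 ?ltW//; congr (_^-1).
rewrite -[RHS]ger0_norm -?sqrtr_sqr ?mulr_ge0 ?pi_ge0 ?sqrtr_ge0//; congr Num.sqrt.
rewrite !exprMn sqr_sqrtr ?ltW//; ring.
Qed.

Lemma corr_pdf_sym (r : R) x y : r ^+ 2 < 1 ->
  centred_gaussian2_pdf (corr_mx r) (x, y) = centred_gaussian2_pdf (corr_mx r) (y, x).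
Proof.
move=> r1; rewrite !corr_pdfEexp//=.
suff -> : y ^+ 2 - 2 * r * y * x + x ^+ 2 = x ^+ 2 - 2 * r * x * y + y ^+ 2 by [].
ring.
Qed.

Definition gauss2 : probability (R * R)%type R := (gamma \x gamma)%E.

(** Given a first coordinate x, the second one is N(r x, 1 - r^2), an affine image of [gamma];
    Tonelli integrates this over x. *)
Lemma shear_law (r : R) (E : set (R * R)) : r ^+ 2 < 1 -> measurable E ->
  gauss2 (shear r (Num.sqrt (1 - r ^+ 2)) @^-1` E) =
  centred_gaussian2 (corr_mx r) E.
Proof.
move=> r1 mE; set t := Num.sqrt _.
have t0 : 0 < t by rewrite sqrtr_gt0 subr_gt0.
have mpre : measurable (shear r t @^-1` E).
  by rewrite -[X in measurable X]setTI; exact: measurable_shear.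
have mpdf := measurable_centred_gaussian2_pdf (corr_mx r).
rewrite /centred_gaussian2 integral_mkcond fubini_tonelli1; last 2 first.
- apply/(measurable_restrictT _ _).1 => //.
  exact/measurable_EFinP/measurable_funTS.
- by move=> z; rewrite erestrict_ge0// => ? _; rewrite lee_fin centred_gaussian2_pdf_ge0.
transitivity (\int[gamma]_x gamma (xsection (shear r t @^-1` E) x))%E => //.
rewrite ge0_integral_normal_law//; last exact: measurable_fun_xsection.
apply: eq_integral => x _.
transitivity (normal_law (r * x) t (xsection E x) * (normal_pdf 0 1 x)%:E)%E.
  congr (_ * _)%E; rewrite [RHS]normal_law_affine//; last exact: measurable_xsection.
rewrite /fubini_F/=.
rewrite normal_lawE muleC -ge0_integralZl//; last 4 first.
- exact: measurable_xsection.
- by apply/measurable_funTS/measurable_EFinP; exact: measurable_normal_pdf.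
- by move=> y _; rewrite lee_fin normal_pdf_ge0.
- by rewrite lee_fin normal_pdf_ge0.
rewrite integral_mkcond; apply: eq_integral => y _.
rewrite !patchE mem_xsection; case: ifPn => // _.
by rewrite corr_pdfE.
Qed.

(** By symmetry of the density the first coordinate can be integrated out as the conditional one,
    and the inner integral is that of a normal density. *)
Lemma corr_marginal2 (r : R) (E : set R) : r ^+ 2 < 1 -> measurable E ->
  gauss2 ((fun p => r * p.1 + Num.sqrt (1 - r ^+ 2) * p.2) @^-1` E) =
  gamma E.
Proof.
move=> r1 mE.
have r0 : 0 < 1 - r ^+ 2 by rewrite subr_gt0.
have mTE : measurable ([set: R] `*` E) by exact: measurableX.
have mpdf := measurable_centred_gaussian2_pdf (corr_mx r).
transitivity (centred_gaussian2 (corr_mx r) (setT `*` E)).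
  rewrite -(shear_law r1 mTE).
  set A := _ @^-1` _; set B := _ @^-1` _; suff -> : A = B by [].
  by apply/seteqP; split => p /=; [split|case].
rewrite /centred_gaussian2 integral_mkcond fubini_tonelli2; last 2 first.
- apply/(measurable_restrictT _ _).1 => //.
  exact/measurable_EFinP/measurable_funTS.
- by move=> z; rewrite erestrict_ge0// => ? _; rewrite lee_fin centred_gaussian2_pdf_ge0.
rewrite [RHS]normal_lawE [RHS]integral_mkcond; apply: eq_integral => y _.
rewrite /fubini_G patchE; case: ifPn => yE; last first.
  apply: integral0_eq => x _; rewrite patchE ifF//.
  by apply/negbTE; apply: contra yE; rewrite !inE => -[].
transitivity (\int[mu]_x ((normal_pdf 0 1 y)%:E *
   (normal_pdf (r * y) (Num.sqrt (1 - r ^+ 2)) x)%:E))%E.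
  apply: eq_integral => x _; rewrite patchE ifT; last first.
    by move: yE; rewrite !inE.
  by rewrite corr_pdf_sym// corr_pdfE.
rewrite ge0_integralZl//; last 3 first.
- by apply/measurable_EFinP; exact: measurable_normal_pdf.
- by move=> x _; rewrite lee_fin normal_pdf_ge0.
- by rewrite lee_fin normal_pdf_ge0.
by rewrite integral_normal_pdf mule1.
Qed.

(** Divided by h = sqrt (a^2 + b^2), the coefficients become r = a / h and sqrt (1 - r^2) = b / h:
    the combination is h times the second coordinate of a correlated pair. The condition b > 0 gives
    r^2 < 1. *)
Lemma normal_comb_law (a b : R) (E : set R) : 0 < b -> measurable E ->
  gauss2 ((fun p => a * p.1 + b * p.2) @^-1` E) =
  gamma ((fun y => Num.sqrt (a ^+ 2 + b ^+ 2) * y) @^-1` E).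
Proof.
move=> b0 mE; set h := Num.sqrt _.
have h20 : 0 < a ^+ 2 + b ^+ 2 by rewrite ltr_wpDl ?sqr_ge0// exprn_gt0.
have h0 : 0 < h by rewrite sqrtr_gt0.
have hE : h ^+ 2 = a ^+ 2 + b ^+ 2 by rewrite sqr_sqrtr// ltW.
have bE : 1 - (a / h) ^+ 2 = (b / h) ^+ 2.
  by rewrite !exprMn !exprVn hE; field; rewrite gt_eqF.
have mE' : measurable ((fun y => h * y) @^-1` E).
  rewrite -[X in measurable X]setTI.
  have mh : measurable_fun [set: R] (fun y : R => h * y) by exact: measurable_funM.
  exact: mh.
have r1 : (a / h) ^+ 2 < 1 by rewrite -subr_gt0 bE exprn_gt0// divr_gt0.
rewrite -(corr_marginal2 r1 mE').
have -> : Num.sqrt (1 - (a / h) ^+ 2) = b / h.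
  by rewrite bE sqrtr_sqr gtr0_norm// divr_gt0.
set A := _ @^-1` _; set B := _ @^-1` _; suff -> : A = B by [].
rewrite /A /B; apply/funext => p /=; congr E.
by field; rewrite gt_eqF.
Qed.

(** Integration by parts on [-n, n]: with g the density, - x g(x) has derivative (x^2 - 1) g(x), and
    the boundary term 2 n g(n) vanishes in the limit. *)
Lemma integral_gamma_sqr : (\int[gamma]_x (x ^+ 2)%:E = 1)%E.
Proof.
have mpdf := @measurable_normal_pdf R 0 1.
rewrite ge0_integral_normal_law//; last 2 first.
- exact/measurable_EFinP.
- by move=> x; rewrite lee_fin sqr_ge0.
have cpdf : continuous (@normal_pdf R 0 1) by apply: continuous_normal_pdf; exact: oner_neq0.
have dpdf (x : R) : is_derive x (1:R) (normal_pdf 0 1) (- x * normal_pdf 0 1 x).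
  rewrite /normal_pdf oner_eq0 /normal_fun; apply: is_derive_eq.
  rewrite /GRing.scale/=; by field.
pose F (x : R) := - (x * normal_pdf 0 1 x).
have dF (x : R) : is_derive x (1:R) F (x ^+ 2 * normal_pdf 0 1 x - normal_pdf 0 1 x).
  rewrite /F; apply: is_derive_eq.
  rewrite /GRing.scale/=; ring.
have FE : (F^`())%classic = fun x => x ^+ 2 * normal_pdf 0 1 x - normal_pdf 0 1 x.
  by apply/funext => x; rewrite derive1E; exact: derive_val.
pose I n := `[- (n%:R : R), n%:R]%classic.
have cx2 : continuous (fun x : R => x ^+ 2 * normal_pdf 0 1 x).
  by move=> x; apply: cvgM; [exact: exprn_continuous|exact: cpdf].
have intI (g : R -> R) : continuous g -> forall n, mu.-integrable (I n) (EFin \o g).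
  move=> cg n; apply: continuous_compact_integrable; first exact: segment_compact.
  exact: continuous_subspaceT.
have partial n : (\int[mu]_(x in I n.+1) (x ^+ 2 * normal_pdf 0 1 x)%:E =
   \int[mu]_(x in I n.+1) (normal_pdf 0 1 x)%:E
    - (2 * n.+1%:R * normal_pdf 0 1 n.+1%:R)%:E)%E.
  have c0 : 0 < n.+1%:R :> R by [].
  rewrite /I; set c : R := n.+1%:R.
  have cFI : {within `[- c, c], continuous
      (fun x => x ^+ 2 * normal_pdf 0 1 x - normal_pdf 0 1 x)}.
    apply: continuous_subspaceT => x; apply: cvgB; [exact: cx2|exact: cpdf].
  have := @continuous_FTC2 R (fun x => x ^+ 2 * normal_pdf 0 1 x - normal_pdf 0 1 x)
    F (- c) c _ cFI.
  rewrite FE => H.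
  have {}H : (\int[mu]_(x in `[(- c)%R, c])
      (x ^+ 2 * normal_pdf 0 1 x - normal_pdf 0 1 x)%:E = (F c)%:E - (F (- c))%:E)%E.
    apply: H; last by [].
      by rewrite gtrN.
    split; first by move=> x _; apply: (@ex_derive _ _ _ _ _ _ _ (dF x)).
    - apply: cvg_at_right_filter; apply: differentiable_continuous.
      by apply/derivable1_diffP; apply: (@ex_derive _ _ _ _ _ _ _ (dF _)).
    - apply: cvg_at_left_filter; apply: differentiable_continuous.
      by apply/derivable1_diffP; apply: (@ex_derive _ _ _ _ _ _ _ (dF _)).
  have i1 := intI _ cx2 n.+1; have i2 := intI _ cpdf n.+1.
  rewrite integralB_EFin// in H.
  have mI : @measurable _ (measurableTypeR R) (I n.+1) by exact: measurable_itv.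
  have f1 := integrable_fin_num mI i1.
  have f2 := integrable_fin_num mI i2.
  move: H f1 f2; rewrite /I -/c /=.
  case: (integral _ _ _) => // u; case: (integral _ _ _) => // v.
  rewrite -!EFinB => -[H] _ _; congr EFin.
  have FE' : F (- c) = - F c.
    rewrite /F /normal_pdf oner_eq0 /normal_fun !subr0 sqrrN; ring.
  by rewrite -[u](subrK v) H FE' /F; ring.
have lim1 (g : R -> R) : continuous g -> (forall x, 0 <= g x) ->
   (\int[mu]_(x in I n.+1) (g x)%:E)%E @[n --> \oo] --> (\int[mu]_x (g x)%:E)%E.
  move=> cg g0.
  have mg : measurable_fun setT (EFin \o g).
    by apply/measurable_EFinP; exact: continuous_measurable_fun.
  have -> : [set: R] = \bigcup_n I n.+1.
    apply/esym; rewrite -subTset => x _; exists (Num.truncn `|x|) => //=.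
    by rewrite /I/= in_itv/= -ler_norml; apply/ltW; exact: truncnS_gt.
  apply: ge0_nondecreasing_set_cvg_integral => //.
  - apply/nondecreasing_seqP => n; apply/subsetPset; rewrite /I.
    by apply: subset_itv; rewrite bnd_simp ?lerN2 ler_nat.
  - by move=> n; exact: measurable_itv.
  - by move=> n; exact: measurable_funTS.
  - by move=> n x _; rewrite lee_fin.
have l1 := lim1 _ cpdf (@normal_pdf_ge0 R 0 1).
rewrite integral_normal_pdf in l1.
have l2 := lim1 _ cx2 (fun x => mulr_ge0 (sqr_ge0 x) (@normal_pdf_ge0 R 0 1 x)).
have l3 : (fun n : nat => 2 * n.+1%:R * normal_pdf 0 1 n.+1%:R) @ \oo --> (0 : R).
  (* The bound exp (- c^2 / 2) <= 2 / c^2 makes the boundary term 2 c g(c) at most 4 / c times the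
     peak of g. *)
  apply: (@squeeze_cvgr _ _ _ _ (cst 0) (fun n => 4 * normal_peak 1 * n.+1%:R^-1)).
  - near=> n.
    rewrite mulr_ge0 ?normal_pdf_ge0//=.
    rewrite /normal_pdf oner_eq0 /normal_fun subr0 expr1n.
    set c : R := n.+1%:R; have c0 : 0 < c by [].
    have c20 : 0 < c ^+ 2 by rewrite exprn_gt0.
    have : expR (- c ^+ 2 / (1 *+ 2)) <= 2 / c ^+ 2.
      rewrite mulNr expRN -[leRHS]invrK lef_pV2 ?posrE ?expR_gt0 ?invr_gt0 ?divr_gt0//.
      apply: le_trans (expR_ge1Dx _); rewrite invf_div; lra.
    move=> /(ler_wpM2l (mulr_ge0 (ler0n R 2) (mulr_ge0 (ltW c0) (normal_peak_ge0 1)))) H.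
    have -> : 2 * c * (normal_peak 1 * expR (- c ^+ 2 / (1 *+ 2))) =
      2 * (c * normal_peak 1) * expR (- c ^+ 2 / (1 *+ 2)) by ring.
    apply: (le_trans H); rewrite le_eqVlt; apply/orP; left; apply/eqP.
    by field; rewrite gt_eqF.
  - exact: cvg_cst.
  - rewrite -[X in _ --> X](mulr0 (4 * normal_peak 1)).
    by apply: cvgM; [exact: cvg_cst|exact: cvg_harmonic].
have l4 : (\int[mu]_(x in I n.+1) (x ^+ 2 * normal_pdf 0 1 x)%:E)%E
    @[n --> \oo] --> (1 - 0%:E)%E.
  rewrite (funext partial); apply: cvgeB => //.
  by apply/cvg_EFin => //; apply: nearW.
rewrite sube0 in l4; exact: (cvg_unique (@ereal_hausdorff R) l2 l4).
Unshelve. all: end_near. Qed.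

(** * Distances between the joint law and the product law *)

Section tv_density.
Context {d : measure_display} {T : measurableType d}.
Variables (nu : {measure set T -> \bar R}) (P Q : {measure set T -> \bar R}).
Variables p q : T -> R.
Hypotheses (mp : measurable_fun setT p) (mq : measurable_fun setT q).
Hypotheses (p0 : forall x, 0 <= p x) (q0 : forall x, 0 <= q x).
Hypothesis PE : forall A, measurable A -> P A = (\int[nu]_(x in A) (p x)%:E)%E.
Hypothesis QE : forall A, measurable A -> Q A = (\int[nu]_(x in A) (q x)%:E)%E.
Hypotheses (P1 : P setT = 1%E) (Q1 : Q setT = 1%E).

(** Let m have density min(p, q). As P - m is nonnegative and m <= Q, P A - Q A <= P A - m A <= 1 -
    m T for every A, and likewise with P and Q exchanged. The set where q < p gives equality, m
    being Q on it and P on its complement. *)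
Lemma tv_dist_density :
  tv_dist P Q = (1 - \int[nu]_x (Num.min (p x) (q x))%:E)%E.
Proof.
pose m A := (\int[nu]_(x in A) (Num.min (p x) (q x))%:E)%E.
have mmin : measurable_fun setT (fun x => Num.min (p x) (q x)).
  exact: measurable_minr.
have m0 A : (0 <= m A)%E.
  by apply: integral_ge0 => x _; rewrite lee_fin le_min p0 q0.
have mP A : measurable A -> (m A <= P A)%E.
  move=> mA; rewrite PE//; apply: ge0_le_integral => //.
  - by move=> x _; rewrite lee_fin le_min p0 q0.
  - exact/measurable_EFinP/measurable_funTS.
  - exact/measurable_EFinP/measurable_funTS.
  - by move=> x _; rewrite lee_fin ge_min lexx.
have mQ A : measurable A -> (m A <= Q A)%E.
  move=> mA; rewrite QE//; apply: ge0_le_integral => //.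
  - by move=> x _; rewrite lee_fin le_min p0 q0.
  - exact/measurable_EFinP/measurable_funTS.
  - exact/measurable_EFinP/measurable_funTS.
  - by move=> x _; rewrite lee_fin ge_min lexx orbT.
have Ple A : measurable A -> (P A <= 1)%E.
  by move=> mA; rewrite -P1; apply: le_measure; rewrite ?inE.
have Qle A : measurable A -> (Q A <= 1)%E.
  by move=> mA; rewrite -Q1; apply: le_measure; rewrite ?inE.
have Pf A : measurable A -> P A \is a fin_num.
  by move=> mA; rewrite ge0_fin_numE ?measure_ge0// (le_lt_trans (Ple A mA)) ?ltry.
have Qf A : measurable A -> Q A \is a fin_num.
  by move=> mA; rewrite ge0_fin_numE ?measure_ge0// (le_lt_trans (Qle A mA)) ?ltry.
have mf A : measurable A -> m A \is a fin_num.
  move=> mA; rewrite ge0_fin_numE//.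
  by rewrite (le_lt_trans (le_trans (mP A mA) (Ple A mA))) ?ltry.
have PC A : measurable A -> (P A + P (~` A) = 1)%E.
  move=> mA; rewrite -P1 -measureU//; [|exact: measurableC|by rewrite setICr].
  by rewrite setUv.
have QC A : measurable A -> (Q A + Q (~` A) = 1)%E.
  move=> mA; rewrite -Q1 -measureU//; [|exact: measurableC|by rewrite setICr].
  by rewrite setUv.
have mC A : measurable A -> (m A + m (~` A) = m setT)%E.
  move=> mA; rewrite -(setUv A) /m ge0_integral_setU//.
  - exact: measurableC.
  - by rewrite setUv; exact/measurable_EFinP.
  - by move=> x _; rewrite lee_fin le_min p0 q0.
  - by apply/disj_set2P; rewrite setICr.
apply/eqP; rewrite eq_le; apply/andP; split.
  apply: ub_ereal_sup => _ [A /= mA <-].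
  have mA' := measurableC mA.
  move: (PC A mA) (QC A mA) (mC A mA) (mP _ mA) (mQ _ mA) (mP _ mA') (mQ _ mA').
  rewrite -/(m setT) -(fineK (Pf _ mA)) -(fineK (Qf _ mA)) -(fineK (mf _ mA)).
  rewrite -(fineK (Pf _ mA')) -(fineK (Qf _ mA')) -(fineK (mf _ mA')).
  rewrite -(fineK (mf _ measurableT)) -!EFinD !lee_fin => -[h1] [h2] [h3].
  move=> h4 h5 h6 h7; rewrite ler_norml; apply/andP; split; lra.
have mE : measurable [set x | q x < p x].
  have -> : [set x | q x < p x] = setT `&` (p \- q) @^-1` `]0, +oo[.
    by apply/seteqP; split => x /=; rewrite in_itv/= andbT subr_gt0 => // -[].
  by apply: measurable_funB.
set E := [set x | q x < p x] in mE.
have mEC := measurableC mE.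
apply: ereal_sup_ubound; exists E => //.
have e1 : m E = Q E.
  rewrite QE//; apply: eq_integral => x; rewrite inE /E/= => /ltW qp.
  by rewrite min_r.
have e2 : m (~` E) = P (~` E).
  rewrite PE//; apply: eq_integral => x; rewrite inE /E/= => /negP; rewrite -leNgt => pq.
  by rewrite min_l.
rewrite -/(m setT) -(mC _ mE) e1 e2.
move: (PC E mE) (mQ _ mE) (mP _ mE).
rewrite e1 -(fineK (Pf _ mE)) -(fineK (Qf _ mE)) -(fineK (Pf _ mEC)).
rewrite -!EFinD !lee_fin => -[h1] h2 h3; congr EFin.
rewrite ger0_norm; lra.
Qed.

End tv_density.

Lemma leb2_integral (A : set (R * R)) (f : R * R -> R) : measurable A ->
  measurable_fun setT f -> (forall z, 0 <= f z) ->
  (\int[leb2]_(z in A) (f z)%:E)%E = (\int[mu \x mu]_(z in A) (f z)%:E)%E.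
Proof.
move=> mA mf f0.
have mid : @measurable_fun _ _ (measurableTypeR R * measurableTypeR R)%type
    (R * R)%type setT id by move=> _ B mB; rewrite setTI.
have := @ge0_integral_pushforward _ _ (measurableTypeR R * measurableTypeR R)%type
  (R * R)%type R id mid (mu \x mu)%E A (EFin \o f) mA.
rewrite preimage_id => <-//; first exact/measurable_EFinP/measurable_funTS.
by move=> z _; rewrite /= lee_fin.
Qed.

Lemma corr_mx0 : corr_mx 0 = 1%:M.
Proof. by apply/matrixP => i j; rewrite !mxE; case: eqVneq. Qed.

(** The mass shared by the two laws. The second density has mass 1, so the value lies in [0, 1] for
    every [r], even when r^2 >= 1; limits in [r] can thus be taken on its real part. *)
Definition corr_overlap (r : R) : \bar R :=
  (\int[leb2]_z (Num.min (centred_gaussian2_pdf (corr_mx r) z)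
     (centred_gaussian2_pdf 1%:M z))%:E)%E.

Lemma corr_gaussian_setT r : r ^+ 2 < 1 -> centred_gaussian2 (corr_mx r) setT = 1%E.
Proof.
move=> r1; apply: centred_gaussian2_setT; rewrite ?trmx_corr ?det_corr ?subr_gt0//.
by rewrite mxE.
Qed.

Lemma gaussian_id_setT : centred_gaussian2 (1%:M : 'M[R]_2) setT = 1%E.
Proof. by rewrite -corr_mx0 corr_gaussian_setT// expr0n/= ltr01. Qed.

Lemma tv_corr (r : R) : r ^+ 2 < 1 ->
  tv_dist (centred_gaussian2 (corr_mx r)) (centred_gaussian2 1%:M) =
  (1 - corr_overlap r)%E.
Proof.
move=> r1; apply: (@tv_dist_density _ _ leb2 _ _ (centred_gaussian2_pdf (corr_mx r))
  (centred_gaussian2_pdf 1%:M)).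
- exact: measurable_centred_gaussian2_pdf.
- exact: measurable_centred_gaussian2_pdf.
- by move=> z; exact: centred_gaussian2_pdf_ge0.
- by move=> z; exact: centred_gaussian2_pdf_ge0.
- move=> A mA; rewrite leb2_integral//; last by move=> z; exact: centred_gaussian2_pdf_ge0.
  exact: measurable_centred_gaussian2_pdf.
- move=> A mA; rewrite leb2_integral//; last by move=> z; exact: centred_gaussian2_pdf_ge0.
  exact: measurable_centred_gaussian2_pdf.
- exact: corr_gaussian_setT.
- exact: gaussian_id_setT.
Qed.

(** Dominated convergence: the minimum stays below the standard Gaussian density whatever the
    sequence [u] does, in particular when it tends to 1. *)
Lemma corr_overlap_cvg (u : nat -> R) (g : R * R -> R) :
  measurable_fun setT g ->
  {ae leb2, forall z, Num.min (centred_gaussian2_pdf (corr_mx (u n)) z)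
    (centred_gaussian2_pdf 1%:M z) @[n --> \oo] --> g z} ->
  corr_overlap (u n) @[n --> \oo] --> (\int[leb2]_z (g z)%:E)%E.
Proof.
move=> mg ug.
have mpdf S := @measurable_centred_gaussian2_pdf R S.
have [] := @dominated_convergence _ _ R leb2 setT measurableT
  (fun n z => (Num.min (centred_gaussian2_pdf (corr_mx (u n)) z)
    (centred_gaussian2_pdf 1%:M z))%:E) (EFin \o g)
  (EFin \o centred_gaussian2_pdf 1%:M).
- by move=> n; apply/measurable_EFinP; exact: measurable_minr.
- exact/measurable_EFinP.
- by apply: filterS ug => z ugz _; apply/cvg_EFin => //; exact: nearW.
- apply/integrableP; split; first exact/measurable_EFinP.
  under eq_integral do rewrite /= ger0_norm ?centred_gaussian2_pdf_ge0//.
  rewrite leb2_integral//; last exact: centred_gaussian2_pdf_ge0.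
  rewrite -[X in (X < _)%E]/(centred_gaussian2 1%:M setT).
  by rewrite gaussian_id_setT ltry.
- apply: nearW => z n _; rewrite /= lee_fin ger0_norm.
    by rewrite ge_min lexx orbT.
  by rewrite le_min !centred_gaussian2_pdf_ge0.
by [].
Qed.

Lemma cvg_corr_pdf (u : nat -> R) (r : R) z : r ^+ 2 < 1 -> u n @[n --> \oo] --> r ->
  centred_gaussian2_pdf (corr_mx (u n)) z @[n --> \oo] -->
  centred_gaussian2_pdf (corr_mx r) z.
Proof.
move=> r1 ur.
have ur2 : (u n) ^+ 2 @[n --> \oo] --> r ^+ 2.
  by rewrite expr2; under eq_fun do rewrite expr2; exact: cvgM.
have ud : 1 - (u n) ^+ 2 @[n --> \oo] --> 1 - r ^+ 2 by apply: cvgB => //; exact: cvg_cst.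
have r0 : 1 - r ^+ 2 != 0 by rewrite gt_eqF// subr_gt0.
rewrite corr_pdfEexp//.
have H : (2 * pi * Num.sqrt (1 - u n ^+ 2))^-1 *
  expR (- ((z.1 ^+ 2 - 2 * u n * z.1 * z.2 + z.2 ^+ 2) / (1 - u n ^+ 2)) / 2)
  @[n --> \oo] --> (2 * pi * Num.sqrt (1 - r ^+ 2))^-1 *
  expR (- ((z.1 ^+ 2 - 2 * r * z.1 * z.2 + z.2 ^+ 2) / (1 - r ^+ 2)) / 2).
  apply: cvgM.
    apply: cvgV; first by rewrite gt_eqF// !mulr_gt0 ?pi_gt0// sqrtr_gt0 subr_gt0.
    apply: cvgM; first exact: cvg_cst.
    by apply: (cvg_comp _ _ ud); exact: sqrt_continuous.
  apply: (@cvg_comp _ _ _ _ expR); last exact: continuous_expR.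
  apply: cvgM; last exact: cvg_cst.
  apply: cvgN; apply: cvgM; last exact: cvgV.
  apply: cvgD; last exact: cvg_cst.
  apply: cvgB; first exact: cvg_cst.
  apply: cvgM; last exact: cvg_cst.
  apply: cvgM; last exact: cvg_cst.
  by apply: cvgM; first exact: cvg_cst.
apply: cvg_trans H; apply: near_eq_cvg.
near=> n; rewrite corr_pdfEexp//.
near: n; exact: (cvgr_lt _ ur2).
Unshelve. all: end_near. Qed.

Lemma cvg_minr_cst (u : nat -> R) (a c : R) : u n @[n --> \oo] --> a ->
  Num.min (u n) c @[n --> \oo] --> Num.min a c.
Proof.
move=> ua; rewrite minr_absE; under eq_fun do rewrite minr_absE.
apply: cvgM; last exact: cvg_cst.
apply: cvgB; first by apply: cvgD => //; exact: cvg_cst.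
by apply: cvg_norm; apply: cvgB => //; exact: cvg_cst.
Qed.

Lemma cvg_corr_overlap (u : nat -> R) (r : R) : r ^+ 2 < 1 -> u n @[n --> \oo] --> r ->
  corr_overlap (u n) @[n --> \oo] --> corr_overlap r.
Proof.
move=> r1 ur; apply: corr_overlap_cvg.
  by apply: measurable_minr; exact: measurable_centred_gaussian2_pdf.
by apply: nearW => z; apply: cvg_minr_cst; exact: cvg_corr_pdf.
Qed.

Lemma corr_overlap_bounds r : (0 <= corr_overlap r <= 1)%E.
Proof.
have mpdf S := @measurable_centred_gaussian2_pdf R S.
rewrite integral_ge0/=; last first.
  by move=> z _; rewrite lee_fin le_min !centred_gaussian2_pdf_ge0.
rewrite -gaussian_id_setT -[leRHS]leb2_integral//; last exact: centred_gaussian2_pdf_ge0.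
apply: ge0_le_integral => //.
- by move=> z _; rewrite lee_fin le_min !centred_gaussian2_pdf_ge0.
- by apply/measurable_EFinP; exact: measurable_minr.
- exact/measurable_EFinP.
- by move=> z _; rewrite lee_fin ge_min lexx orbT.
Qed.

Lemma corr_overlap_fin r : corr_overlap r \is a fin_num.
Proof.
have /andP[h0 h1] := corr_overlap_bounds r.
by rewrite ge0_fin_numE// (le_lt_trans h1) ?ltry.
Qed.

Lemma corr_overlap_continuous (r : R) : r ^+ 2 < 1 ->
  corr_overlap x @[x --> r] --> corr_overlap r.
Proof.
move=> r1; rewrite -(fineK (corr_overlap_fin r)).
apply: cvg_EFin; first by apply: nearW => x; exact: corr_overlap_fin.
pose h x := fine (corr_overlap x); rewrite -[fine _]/(h r).
(* Dominated convergence concerns sequences, so continuity is checked along sequences in the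
   punctured neighbourhood. *)
apply/continuous_withinNx/cvgr_dnbhsP => u [_ ur].
apply: fine_cvg; rewrite fineK ?corr_overlap_fin//.
exact: cvg_corr_overlap.
Qed.

Lemma corr_overlap0 : corr_overlap 0 = 1%E.
Proof.
rewrite /corr_overlap -gaussian_id_setT -[RHS]leb2_integral//.
- by apply: eq_integral => z _; rewrite corr_mx0 minxx.
- exact: measurable_centred_gaussian2_pdf.
- exact: centred_gaussian2_pdf_ge0.
Qed.

(** Vertical sections are single points. The diagonal is where the correlated density blows up as
    the correlation tends to 1. *)
Lemma leb2_diagonal : leb2.-negligible [set z : R * R | z.1 = z.2].
Proof.
have mD : measurable [set z : R * R | z.1 = z.2].
  have -> : [set z : R * R | z.1 = z.2] = setT `&` (fst \- snd) @^-1` [set 0].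
    apply/seteqP; split => z /= => [->|[_ /eqP]]; first by rewrite subrr.
    by rewrite subr_eq0 => /eqP.
  have mf : measurable_fun [set: R * R] (fst \- snd : R * R -> R) by exact: measurable_funB.
  exact: mf.
exists [set z : R * R | z.1 = z.2]; split => //.
rewrite -[LHS]/(\int[mu]_x mu (xsection [set z : R * R | z.1 = z.2] x))%E.
apply: integral0_eq => x _.
rewrite (_ : xsection _ x = [set x]) ?lebesgue_measure_set1//.
by apply/seteqP; split => y; rewrite /xsection/= inE/= => ->.
Qed.

(** Off the diagonal the exponent behaves like - (z1 - z2)^2 / (2 (1 - r^2)), and this beats the
    prefactor of order 1 / sqrt (1 - r^2). *)
Lemma corr_overlap_at_left1 : corr_overlap x @[x --> 1^'-] --> 0%E.
Proof.
have aux (q b c : R) : 0 < q -> 0 < b -> 0 < c ->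
    q * (2 / (c * b)) = (2 * c * q)^-1 * (4 * q ^+ 2 / b).
  by move=> q0 b0 c0; field; rewrite !gt_eqF.
apply: cvg_EFin; first by apply: nearW => x; exact: corr_overlap_fin.
apply/cvg_at_leftP => u [u1 ur].
apply: fine_cvg.
have -> : (0 : R)%:E = (\int[leb2]_z ((cst 0 : R * R -> R) z)%:E)%E.
  by rewrite integral0.
apply: corr_overlap_cvg; first exact: measurable_cst.
have [N [mN N0 DN]] := leb2_diagonal.
exists N; split => // z /= nz; apply: DN => /=; apply: contrapT => zne; apply: nz.
have -> : 0 = Num.min 0 (centred_gaussian2_pdf 1%:M z).
  by rewrite min_l// centred_gaussian2_pdf_ge0.
apply: cvg_minr_cst.
pose A n := z.1 ^+ 2 - 2 * u n * z.1 * z.2 + z.2 ^+ 2.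
pose a := (z.1 - z.2) ^+ 2.
have a0 : 0 < a by rewrite exprn_even_gt0//= subr_eq0; exact/eqP.
have Aa : A n @[n --> \oo] --> a.
  have -> : a = z.1 ^+ 2 - 2 * 1 * z.1 * z.2 + z.2 ^+ 2 by rewrite /a; ring.
  apply: cvgD; last exact: cvg_cst.
  apply: cvgB; first exact: cvg_cst.
  apply: cvgM; last exact: cvg_cst.
  apply: cvgM; last exact: cvg_cst.
  by apply: cvgM; first exact: cvg_cst.
have ud : Num.sqrt (1 - u n ^+ 2) @[n --> \oo] --> 0.
  have ud : 1 - u n ^+ 2 @[n --> \oo] --> (1 - 1 * 1 : R).
    apply: cvgB; first exact: cvg_cst.
    by under eq_fun do rewrite expr2; exact: cvgM.
  rewrite mulr1 subrr in ud; rewrite -[X in _ --> X](@sqrtr0 R).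
  by apply: (cvg_comp _ _ ud); exact: sqrt_continuous.
apply: (@squeeze_cvgr _ _ _ _ (cst 0) (fun n => Num.sqrt (1 - u n ^+ 2) * (2 / (pi * a)))).
- near=> n; rewrite centred_gaussian2_pdf_ge0/=.
  have un0 : -1 < u n by near: n; apply: (cvgr_gt _ ur); lra.
  have u21 : u n ^+ 2 < 1.
    by have := u1 n; nra.
  have An : a / 2 < A n by near: n; apply: (cvgr_gt _ Aa); lra.
  rewrite corr_pdfEexp// -/(A n).
  set D := 1 - u n ^+ 2 in u21 *.
  have D0 : 0 < D by rewrite subr_gt0.
  have s0 : 0 < Num.sqrt D by rewrite sqrtr_gt0.
  have p0 : 0 < (pi : R) by exact: pi_gt0.
  (* From exp x >= 1 + x at x = A n / (2 D) >= a / (4 D); with the prefactor, a multiple of sqrt D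
     remains. *)
  have H : expR (- (A n / D) / 2) <= 4 * D / a.
    have c0 : 0 < 4 * D / a by rewrite divr_gt0// mulr_gt0.
    rewrite mulNr expRN -[leRHS]invrK lef_pV2 ?posrE ?expR_gt0 ?invr_gt0//.
    apply: le_trans (expR_ge1Dx _); rewrite invf_div.
    have : a / (4 * D) <= A n / D / 2.
      have -> : a / (4 * D) = a / 2 / (2 * D) by field; rewrite gt_eqF.
      have -> : A n / D / 2 = A n / (2 * D) by field; rewrite gt_eqF.
      by rewrite ler_wpM2r ?invr_ge0 ?mulr_ge0 ?ltW.
    by move/le_trans; apply; rewrite lerDr.
  have -> : Num.sqrt D * (2 / (pi * a)) =
      (2 * pi * Num.sqrt D)^-1 * (4 * (Num.sqrt D ^+ 2) / a).
    exact: aux.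
  rewrite (sqr_sqrtr (ltW D0)); apply: ler_wpM2l => //.
  by rewrite invr_ge0 !mulr_ge0 ?ltW.
- exact: cvg_cst.
- by rewrite -[X in _ --> X](mul0r (2 / (pi * a))); apply: cvgM => //; exact: cvg_cst.
Unshelve. all: end_near. Qed.

Lemma gauss2_law (E : set (R * R)) : measurable E ->
  gauss2 E = centred_gaussian2 1%:M E.
Proof.
move=> mE; have r0 : (0 : R) ^+ 2 < 1 by rewrite expr0n/= ltr01.
rewrite -corr_mx0 -(shear_law r0 mE).
suff -> : shear 0 (Num.sqrt (1 - 0 ^+ 2)) @^-1` E = E by [].
apply/funext => -[x z]; rewrite /shear/=.
by rewrite expr0n/= subr0 sqrtr1 mul0r add0r mul1r.
Qed.

(** The combination is distributed as sqrt (a^2 + b^2) times a standard Gaussian, which spares the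
    integral of the cross term. *)
Lemma integral_gauss2_comb_sqr (a b : R) : 0 < b ->
  (\int[gauss2]_p ((a * p.1 + b * p.2) ^+ 2)%:E = (a ^+ 2 + b ^+ 2)%:E)%E.
Proof.
move=> b0.
pose l := fun p : R * R => a * p.1 + b * p.2.
have ml : measurable_fun setT l by apply: measurable_funD; apply: measurable_funM.
pose h := Num.sqrt (a ^+ 2 + b ^+ 2).
have mh : measurable_fun [set: R] (fun y : R => h * y) by exact: measurable_funM.
have msq : measurable_fun [set: R] (fun y : R => y ^+ 2) by exact: measurable_funX.
pose lR : {mfun (R * R)%type >-> R} := HB.pack l (isMeasurableFun.Build _ _ _ _ _ ml).
transitivity (\int[distribution gauss2 lR]_y (y ^+ 2)%:E)%E.
  by apply/esym/ge0_integral_image => // y; exact: sqr_ge0.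
rewrite (@ge0_integral_image _ _ _ _ _ gamma _ (fun y : R => h * y) (fun y => y ^+ 2) mh)//;
  last 2 first.
- by move=> A mA; exact: normal_comb_law.
- by move=> y; exact: sqr_ge0.
under eq_integral do rewrite /= exprMn EFinM.
rewrite ge0_integralZl_EFin ?sqr_ge0//.
- by rewrite integral_gamma_sqr mule1 /h sqr_sqrtr// addr_ge0 ?sqr_ge0.
- by move=> y _; rewrite lee_fin sqr_ge0.
- exact/measurable_EFinP.
Qed.

(** The case of a vanishing second coefficient, which [integral_gauss2_comb_sqr] excludes. *)
Lemma integral_gauss2_fst_sqr (a : R) :
  (\int[gauss2]_p ((a * p.1) ^+ 2)%:E = (a ^+ 2)%:E)%E.
Proof.
rewrite fubini_tonelli1; last 2 first.
- by apply/measurable_EFinP; apply: measurable_funX; exact: measurable_funM.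
- by move=> p; rewrite lee_fin sqr_ge0.
rewrite /fubini_F; transitivity (\int[gamma]_x ((a * x) ^+ 2)%:E)%E.
  apply: eq_integral => x _.
  transitivity (((a * x) ^+ 2)%:E * gamma setT)%E.
    by rewrite -(integral_cst gamma measurableT).
  by rewrite [X in (_ * X)%E](@probability_setT _ _ _ gamma) mule1.
under eq_integral do rewrite /= exprMn EFinM.
rewrite ge0_integralZl_EFin ?sqr_ge0//.
- by rewrite integral_gamma_sqr mule1.
- by move=> x _; rewrite lee_fin sqr_ge0.
- exact/measurable_EFinP.
Qed.

(** For r^2 < 1, the density of the law with correlation [r] with respect to [gauss2]: the
    conditional density N(r z1, 1 - r^2) divided by N(0, 1), both at z2. *)
Definition corr_ratio (r : R) (z : R * R) : R :=
  (Num.sqrt (1 - r ^+ 2))^-1 *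
  expR ((z.2 ^+ 2 - (z.2 - r * z.1) ^+ 2 / (1 - r ^+ 2)) / 2).

Lemma measurable_corr_ratio r : measurable_fun setT (corr_ratio r).
Proof.
apply: measurable_funM => //; apply: measurableT_comp => //.
apply: measurable_funM => //; apply: measurable_funB; first exact: measurable_funX.
apply: measurable_funM => //; apply: measurable_funX; apply: measurable_funB => //.
exact: measurable_funM.
Qed.

Lemma corr_ratio_gt0 r z : r ^+ 2 < 1 -> 0 < corr_ratio r z.
Proof. by move=> r1; rewrite mulr_gt0 ?expR_gt0// invr_gt0 sqrtr_gt0 subr_gt0. Qed.

Lemma corr_ratio_pdf (r : R) z : r ^+ 2 < 1 ->
  corr_ratio r z * normal_pdf 0 1 z.2 =
  normal_pdf (r * z.1) (Num.sqrt (1 - r ^+ 2)) z.2.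
Proof.
move=> r1; have r0 : 0 < 1 - r ^+ 2 by rewrite subr_gt0.
rewrite /corr_ratio /normal_pdf oner_eq0 gt_eqF ?sqrtr_gt0//.
rewrite /normal_peak /normal_fun mulrACA -expRD sqr_sqrtr ?ltW//; congr (_ * expR _).
  by rewrite expr1n mul1r -invfM -sqrtrM ?ltW// mulrnAr.
by field; rewrite gt_eqF.
Qed.

Lemma shear_density (r : R) (E : set (R * R)) : r ^+ 2 < 1 -> measurable E ->
  gauss2 (shear r (Num.sqrt (1 - r ^+ 2)) @^-1` E) =
  (\int[gauss2]_(z in E) (corr_ratio r z)%:E)%E.
Proof.
move=> r1 mE; set t := Num.sqrt _.
have t0 : 0 < t by rewrite sqrtr_gt0 subr_gt0.
have mr := measurable_corr_ratio r.
have mrE : measurable_fun setT ((fun z : R * R => (corr_ratio r z)%:E) \_ E).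
  apply/(measurable_restrictT _ _).1 => //.
  exact/measurable_EFinP/measurable_funTS.
have rE0 z : (0 <= ((fun z : R * R => (corr_ratio r z)%:E) \_ E) z)%E.
  by rewrite erestrict_ge0// => ? _; rewrite lee_fin ltW// corr_ratio_gt0.
rewrite integral_mkcond fubini_tonelli1//.
transitivity (\int[gamma]_x gamma (xsection (shear r t @^-1` E) x))%E => //.
apply: eq_integral => x _.
have mEx : measurable (xsection E x) by exact: measurable_xsection.
transitivity (normal_law (r * x) t (xsection E x)).
  rewrite (normal_law_affine _ t0 mEx).
  suff -> : xsection (shear r t @^-1` E) x = (fun y => r * x + t * y) @^-1` xsection E x by [].
  by apply/seteqP; split => y; rewrite /xsection/= !inE.
rewrite normal_lawE integral_mkcond /fubini_F ge0_integral_normal_law//; last first.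
  exact: measurableT_comp mrE (measurable_pair1 x).
apply: eq_integral => y _; rewrite !patchE mem_xsection.
case: ifPn => _; last by rewrite mul0e.
by rewrite -EFinM corr_ratio_pdf.
Qed.

Section kl_density.
Context {d : measure_display} {T : measurableType d}.
Variables (P Q : probability T R) (f : T -> R).
Hypotheses (mf : measurable_fun setT f) (f0 : forall x, 0 < f x).
Hypothesis PE : forall A, measurable A -> P A = (\int[Q]_(x in A) (f x)%:E)%E.

(** [f] agrees with the Radon-Nikodym derivative [Q]-almost everywhere, hence [P]-almost everywhere
    by domination, and its positivity turns [lne] into [ln]. *)
Lemma kl_div_density : kl_div P Q = (\int[P]_x (ln (f x))%:E)%E.
Proof.
have f0' x : 0 <= f x by exact: ltW.
have PQ : P `<< Q by exact: (@density_dominates _ _ _ P Q f mf PE).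
rewrite /kl_div; case: pselect => [PQ'|/(_ PQ)//].
have iRN := Radon_Nikodym_integrable (nu := charge_of_finite_measure P) PQ.
have mRN := measurable_int _ iRN.
have RNf : ae_eq P setT (Radon_Nikodym (charge_of_finite_measure P) Q) (EFin \o f).
  apply: (null_dominates_ae_eq _ PQ) => //; apply: integral_ae_eq => //.
    exact/measurable_EFinP.
  by move=> E _ mE; rewrite -Radon_Nikodym_integral// -PE.
apply: ae_eq_integral => //.
- set h := Radon_Nikodym _ _.
  have -> : (fun x => lne (h x)) =
      (fun x => if fine (h x) <= 0 then -oo%E else (ln (fine (h x)))%:E).
    have hf x : h x \is a fin_num.
      by apply: Radon_Nikodym_fin_num; exact: PQ.
    by apply/funext => x; rewrite -[in LHS](fineK (hf x)).
  have mh : measurable_fun setT (fun x => fine (h x)) by exact: measurableT_comp.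
  apply: measurable_fun_ifT => //; first exact: measurable_fun_ler.
  by apply/measurable_EFinP; exact: measurableT_comp.
- by apply/measurable_EFinP; apply: measurableT_comp => //; exact: measurable_ln.
by apply: filterS RNf => x xE _; rewrite xE//= leNgt f0.
Qed.

End kl_density.

Lemma gauss2_rect (A C : set R) : measurable A -> measurable C ->
  gauss2 (A `*` C) = (gamma A * gamma C)%E.
Proof. by move=> mA mC; exact: product_measure1E. Qed.

#[local] Opaque gauss2.

Lemma measurable_sqr_dist : measurable_fun setT
  (fun q : (R * R) * (R * R) => euclid_norm (q.1 - q.2) ^+ 2).
Proof.
have -> : (fun q : (R * R) * (R * R) => euclid_norm (q.1 - q.2) ^+ 2) =
    (fun q => (q.1.1 - q.2.1) ^+ 2 + (q.1.2 - q.2.2) ^+ 2).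
  by apply/funext => q; rewrite /euclid_norm sqr_sqrtr// addr_ge0 ?sqr_ge0.
by apply: measurable_funD; apply: measurable_funX; apply: measurable_funB;
  apply: measurableT_comp.
Qed.

Section gaussian_pair.
Variables (J I : probability (R * R)%type R) (a b m s : R).
Hypotheses (b0 : 0 < b) (m0 : 0 < m) (s0 : 0 < s).
Let tau := Num.sqrt (m ^+ 2 * b ^+ 2 + s ^+ 2).
(* J is the law of (U, m U + s G), where U ~ N(a, b^2) and G ~ N(0, 1) are
   independent, and I is the product of its marginals. *)
Hypothesis JE : forall E, measurable E -> J E = gauss2
  ((fun p => (a + b * p.1, m * (a + b * p.1) + s * p.2)) @^-1` E).
Hypothesis IE : forall E, measurable E -> I E = gauss2
  ((fun p => (a + b * p.1, m * a + tau * p.2)) @^-1` E).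

Let r := m * b / tau.

Let tau2 : tau ^+ 2 = m ^+ 2 * b ^+ 2 + s ^+ 2.
Proof. by rewrite sqr_sqrtr// (addr_ge0 (mulr_ge0 (sqr_ge0 m) (sqr_ge0 b)) (sqr_ge0 s)). Qed.

Let tau_gt0 : 0 < tau.
Proof. by rewrite sqrtr_gt0 ltr_wpDl ?exprn_gt0// mulr_ge0 ?sqr_ge0. Qed.

Lemma pair_corrE : 1 - r ^+ 2 = s ^+ 2 / tau ^+ 2.
Proof.
rewrite /r !exprMn !exprVn [X in 1 - _ / X = _]tau2 [X in _ = _ / X]tau2.
have h : m ^+ 2 * b ^+ 2 + s ^+ 2 != 0 by rewrite -tau2 sqrf_eq0 gt_eqF.
by rewrite -{1}(divff h) -mulrBl addrC addKr.
Qed.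

Lemma pair_corr_lt1 : r ^+ 2 < 1.
Proof. by rewrite -subr_gt0 pair_corrE divr_gt0 ?exprn_gt0. Qed.

Let sqrt_corr : Num.sqrt (1 - r ^+ 2) = s / tau.
Proof.
by rewrite pair_corrE -exprVn -exprMn sqrtr_sqr gtr0_norm// divr_gt0.
Qed.

(** Undoes the standardisation of both coordinates: pulled back by this bijection, [I] becomes
    [gauss2] and [J] the centred Gaussian law with correlation [r]. *)
Let aff (p : R * R) : R * R := (a + b * p.1, m * a + tau * p.2).
Let affV (q : R * R) : R * R := ((q.1 - a) / b, (q.2 - m * a) / tau).

Let affK : cancel aff affV.
Proof.
by move=> [x y]; rewrite /aff /affV/=; congr pair; field; rewrite gt_eqF.
Qed.

Let measurable_aff : measurable_fun setT aff.
Proof.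
apply: measurable_fun_pair; apply: measurable_funD => //; exact: measurable_funM.
Qed.

Let measurable_affV : measurable_fun setT affV.
Proof.
apply: measurable_fun_pair; apply: measurable_funM => //; exact: measurable_funB.
Qed.

Let measurable_pre_aff (E : set (R * R)) : measurable E -> measurable (aff @^-1` E).
Proof. by move=> mE; rewrite -[X in measurable X]setTI; exact: measurable_aff. Qed.

Let J_aff (E : set (R * R)) : measurable E ->
  J E = centred_gaussian2 (corr_mx r) (aff @^-1` E).
Proof.
move=> mE; rewrite JE// -(shear_law pair_corr_lt1 (measurable_pre_aff mE)).
set A := _ @^-1` _; set B := _ @^-1` _; suff -> : A = B by [].
rewrite /A /B sqrt_corr; apply/funext => p; rewrite /preimage/= /aff/=; congr E.
by congr pair; rewrite /r; field; rewrite gt_eqF.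
Qed.

Let I_aff (E : set (R * R)) : measurable E ->
  I E = centred_gaussian2 1%:M (aff @^-1` E).
Proof. by move=> mE; rewrite IE// -(gauss2_law (measurable_pre_aff mE)). Qed.

(** [aff] and its inverse [affV] are measurable, so taking preimages is a bijection of the events
    over which the two suprema range. *)
Lemma tv_dist_pair : tv_dist J I =
  tv_dist (centred_gaussian2 (corr_mx r)) (centred_gaussian2 (1%:M : 'M[R]_2)).
Proof.
congr ereal_sup; apply/seteqP; split => _ [E /= mE <-].
  exists (aff @^-1` E); first exact: measurable_pre_aff.
  by rewrite (J_aff mE) (I_aff mE).
have mE' : measurable (affV @^-1` E).
  by rewrite -[X in measurable X]setTI; exact: measurable_affV.
exists (affV @^-1` E) => //; rewrite (J_aff mE') (I_aff mE').
have -> // : aff @^-1` (affV @^-1` E) = E.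
by apply/funext => p; rewrite /preimage/= affK.
Qed.

Let density_J (E : set (R * R)) : measurable E ->
  J E = (\int[I]_(q in E) (corr_ratio r (affV q))%:E)%E.
Proof.
move=> mE; have mE' := measurable_pre_aff mE.
have mr := @measurable_corr_ratio r.
have r0 z : (0 <= (corr_ratio r z)%:E)%E.
  by rewrite lee_fin ltW// corr_ratio_gt0// pair_corr_lt1.
transitivity (\int[pushforward gauss2 aff]_(q in E) (corr_ratio r (affV q))%:E)%E.
  rewrite (ge0_integral_pushforward measurable_aff)//; last first.
    by apply/measurable_EFinP/measurable_funTS; exact: measurableT_comp.
  rewrite (J_aff mE) -(shear_law pair_corr_lt1 mE').
  rewrite (shear_density pair_corr_lt1 mE').
  by apply: eq_integral => p _ /=; rewrite affK.
by apply: eq_measure_integral => A mA _; exact/esym/IE.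
Qed.

(** In terms of standard Gaussians x and y, the logarithm of the density is [k] plus (r x + (s /
    tau) y)^2 / 2 - y^2 / 2. Both squares have mean 1, since r^2 + (s / tau)^2 = 1, and only [k]
    survives. *)
Lemma kl_div_pair : kl_div J I = (- (2^-1 * ln (1 - r ^+ 2)))%:E.
Proof.
rewrite (@kl_div_density _ _ J I (fun q => corr_ratio r (affV q))); last 3 first.
- by apply: measurableT_comp => //; exact: measurable_corr_ratio.
- by move=> q; apply: corr_ratio_gt0; exact: pair_corr_lt1.
- exact: density_J.
have r1 := pair_corr_lt1.
have r10 : 0 < 1 - r ^+ 2 by rewrite subr_gt0.
pose g p := aff (shear r (s / tau) p).
have mg : measurable_fun setT g.
  by apply: measurableT_comp => //; exact: measurable_shear.
set k := - (2^-1 * ln (1 - r ^+ 2)).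
pose f1 p := 2^-1 * (r * p.1 + s / tau * p.2) ^+ 2.
(* The coefficients 0 and 1 put this square in the form handled by [i1] and [e1]. *)
pose f2 (p : R * R) := 2^-1 * (0 * p.1 + 1 * p.2) ^+ 2.
have lnE p : ln (corr_ratio r (affV (g p))) = k + (f1 p - f2 p).
  rewrite /g affK /corr_ratio lnM ?posrE ?expR_gt0 ?invr_gt0 ?sqrtr_gt0//.
  rewrite expRK lnV ?posrE ?sqrtr_gt0//.
  have -> : ln (Num.sqrt (1 - r ^+ 2)) = 2^-1 * ln (1 - r ^+ 2).
    have := @lnXn R 2 (Num.sqrt (1 - r ^+ 2)); rewrite sqrtr_gt0 r10 => /(_ isT).
    by rewrite sqr_sqrtr ?(ltW r10)// => ->; rewrite -mulr_natl; field.
  congr (_ + _); rewrite /shear/= /f1 /f2 pair_corrE.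
  by field; rewrite !gt_eqF.
have i1 (c d : R) : 0 < d ->
    gauss2.-integrable setT (fun p => (2^-1 * (c * p.1 + d * p.2) ^+ 2)%:E).
  move=> d0.
  have mcd : measurable_fun setT (fun p : R * R => c * p.1 + d * p.2).
    by apply: measurable_funD; apply: measurable_funM.
  apply/integrableP; split.
    by apply/measurable_EFinP; apply: measurable_funM => //; exact: measurable_funX.
  have absE (p : R * R) : (`|(2^-1 * (c * p.1 + d * p.2) ^+ 2)%:E| =
      2^-1%:E * ((c * p.1 + d * p.2) ^+ 2)%:E)%E.
    by rewrite -EFinM gee0_abs// lee_fin mulr_ge0// sqr_ge0.
  under eq_integral do rewrite absE.
  rewrite ge0_integralZl_EFin//.
  - by rewrite integral_gauss2_comb_sqr// -EFinM ltry.
  - by move=> p _; rewrite lee_fin sqr_ge0.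
  - by apply/measurable_EFinP; exact: measurable_funX.
have e1 (c d : R) : 0 < d ->
    (\int[gauss2]_p (2^-1 * (c * p.1 + d * p.2) ^+ 2)%:E = (2^-1 * (c ^+ 2 + d ^+ 2))%:E)%E.
  move=> d0.
  have mcd : measurable_fun setT (fun p : R * R => c * p.1 + d * p.2).
    by apply: measurable_funD; apply: measurable_funM.
  under eq_integral do rewrite EFinM.
  rewrite ge0_integralZl_EFin//.
  - by rewrite integral_gauss2_comb_sqr.
  - by move=> p _; rewrite lee_fin sqr_ge0.
  - by apply/measurable_EFinP; exact: measurable_funX.
have st0 : 0 < s / tau by exact: divr_gt0.
have fi : gauss2.-integrable setT (fun p => (f1 p - f2 p)%:E).
  exact: (integrableB measurableT (i1 _ _ st0) (i1 _ _ ltr01)).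
have ki : gauss2.-integrable setT (EFin \o cst k).
  by apply: finite_measure_integrable_cst.
transitivity (\int[pushforward gauss2 g]_q (ln (corr_ratio r (affV q)))%:E)%E.
  apply: eq_measure_integral => A mA _.
  rewrite [LHS](JE mA).
  set X := _ @^-1` _; suff -> : X = g @^-1` A by [].
  rewrite /X; apply/funext => p; rewrite /preimage/= /g /aff /shear/=; congr A.
  by congr pair; rewrite /r; field; rewrite gt_eqF.
rewrite (integral_pushforward mg)//; last 2 first.
- apply/measurable_EFinP; apply: measurableT_comp => //.
  by apply: measurableT_comp => //; exact: measurable_corr_ratio.
- have -> : (fun q => (ln (corr_ratio r (affV q)))%:E) \o g =
      (EFin \o cst k) \+ (fun p => (f1 p - f2 p)%:E).
    by apply/funext => p; rewrite /= lnE.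
  by rewrite preimage_setT; exact: (integrableD measurableT ki fi).
rewrite preimage_setT.
transitivity (\int[gauss2]_p (k%:E + (f1 p - f2 p)%:E))%E.
  by apply: eq_integral => p _; rewrite /= lnE.
rewrite (integralD _ ki fi)//.
rewrite (integralB_EFin measurableT (i1 _ _ st0) (i1 _ _ ltr01)).
rewrite (e1 _ _ st0) (e1 _ _ ltr01).
have -> : r ^+ 2 + (s / tau) ^+ 2 = 1.
  have -> : (s / tau) ^+ 2 = 1 - r ^+ 2 by rewrite pair_corrE exprMn exprVn.
  ring.
rewrite expr0n/= expr1n add0r subee// adde0.
rewrite integral_cst// [X in (_ * X)%E](@probability_setT _ _ _ gauss2) mule1//.
Qed.

Let phiJ (p : R * R) : R * R := (a + b * p.1, m * (a + b * p.1) + s * p.2).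

Let measurable_phiJ : measurable_fun setT phiJ.
Proof.
by apply: measurable_fun_pair; apply: measurable_funD => //;
  apply: measurable_funM => //; apply: measurable_funD => //; exact: measurable_funM.
Qed.

Let integral_J (f : R * R -> R) : measurable_fun setT f -> (forall u, 0 <= f u) ->
  (\int[J]_u (f u)%:E = \int[gauss2]_p (f (phiJ p))%:E)%E.
Proof. by move=> mf f0; exact: (ge0_integral_image measurable_phiJ JE mf f0). Qed.

Let integral_I (f : R * R -> R) : measurable_fun setT f -> (forall u, 0 <= f u) ->
  (\int[I]_u (f u)%:E = \int[gauss2]_p (f (aff p))%:E)%E.
Proof. by move=> mf f0; exact: (ge0_integral_image measurable_aff IE mf f0). Qed.

Let s_lt_tau : s < tau.
Proof.
by rewrite -(ltr_pXn2r (n := 2))// ?nnegrE ?ltW// tau2 ltrDr mulr_gt0// exprn_gt0.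
Qed.

(** Couple the laws through the same standard Gaussians x and y: the first coordinates agree and the
    second ones differ by m b x - (tau - s) y, of variance m^2 b^2 + (tau - s)^2 = 2 tau^2 - 2 tau
    s. *)
Lemma wasserstein2_pair_le :
  (wasserstein2 J I <= (Num.sqrt (2 * tau ^+ 2 - 2 * tau * s))%:E)%E.
Proof.
pose c p := (phiJ p, aff p).
have mc : measurable_fun setT c by exact: measurable_fun_pair.
pose cR : {mfun (R * R)%type >-> ((R * R) * (R * R))%type} :=
  HB.pack c (isMeasurableFun.Build _ _ _ _ _ mc).
pose Pi : probability ((R * R) * (R * R))%type R := distribution gauss2 cR.
apply: ereal_inf_lbound; exists Pi.
  move=> E mE; split.
    rewrite [RHS](JE mE) /Pi /= /distribution /pushforward.
    set A := _ @^-1` _; set B := _ @^-1` _; suff -> : A = B by [].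
    by apply/seteqP; split => p /=; [case|split].
  rewrite [RHS](IE mE) /Pi /= /distribution /pushforward.
  set A := _ @^-1` _; set B := _ @^-1` _; suff -> : A = B by [].
  by apply/seteqP; split => p /=; [case|split].
have me : measurable_fun setT
    (fun q : (R * R) * (R * R) => euclid_norm (q.1 - q.2) ^+ 2).
  exact: measurable_sqr_dist.
rewrite (_ : integral _ _ _ = (2 * tau ^+ 2 - 2 * tau * s)%:E).
  rewrite poweR_EFin powR12_sqrt// -mulrA -mulrBr mulr_ge0// expr2 -mulrBr.
  by rewrite mulr_ge0 ?subr_ge0 ?ltW.
transitivity (\int[gauss2]_p (euclid_norm ((c p).1 - (c p).2) ^+ 2)%:E)%E.
  rewrite ge0_integral_distribution//; first exact/measurable_EFinP.
  by move=> q; rewrite lee_fin sqr_ge0.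
transitivity (\int[gauss2]_p ((- (m * b) * p.1 + (tau - s) * p.2) ^+ 2)%:E)%E.
  apply: eq_integral => p _; congr EFin; rewrite /euclid_norm /=.
  rewrite subrr expr0n/= add0r sqr_sqrtr ?sqr_ge0//; ring.
rewrite integral_gauss2_comb_sqr ?subr_gt0//; congr EFin.
rewrite sqrrN exprMn sqrrB.
have -> : s ^+ 2 = tau ^+ 2 - m ^+ 2 * b ^+ 2 by rewrite tau2; ring.
ring.
Qed.

(** A weak duality bound. The loss m^2 tau^2 is the variance of m v2 inside (v1 + m v2)^2, the
    coordinates v1 and v2 being independent under [I]. *)
Lemma wasserstein2_pair_ge :
  ((Num.sqrt (2 * tau ^+ 2 - 2 * tau * s - m ^+ 2 * tau ^+ 2))%:E <= wasserstein2 J I)%E.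
Proof.
apply: le_ereal_inf_tmp => _ [Pi /= PiJI <-].
set W := integral _ _ _; set L := _ - _.
have W0 : (0 <= W)%E by apply: integral_ge0 => q _; rewrite lee_fin sqr_ge0.
suff LW : (L%:E <= W)%E.
  have [L0|L0] := leP L 0; first by rewrite ler0_sqrtr// poweR_ge0.
  rewrite -(powR12_sqrt (ltW L0)) -poweR_EFin; apply: gt0_ler_poweR => //.
  - by rewrite in_itv/= lee_fin (ltW L0) leey.
  - by rewrite in_itv/= W0 leey.
(* Quadratic dual potentials: with u and v centred, for all k > 0,
   |u - v|^2 + k (u2 - m u1)^2 + (v1 + m v2)^2 + v2^2 / k >= u2^2 + v1^2 + v2^2;
   k = tau / s minimises the integral k s^2 + tau^2 / k of the added terms in k. *)
pose k := tau / s.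
have k0 : 0 < k by exact: divr_gt0.
pose f1 (u : R * R) := (u.2 - m * u.1) ^+ 2.
pose f2 (v : R * R) := ((v.1 - a) + m * (v.2 - m * a)) ^+ 2.
pose f3 (v : R * R) := (v.2 - m * a) ^+ 2.
pose f4 (v : R * R) := (v.1 - a) ^+ 2.
have mf1 : measurable_fun setT f1.
  by apply: measurable_funX; apply: measurable_funB => //; exact: measurable_funM.
have mf2 : measurable_fun setT f2.
  apply: measurable_funX; apply: measurable_funD; first exact: measurable_funB.
  by apply: measurable_funM => //; exact: measurable_funB.
have mf3 : measurable_fun setT f3.
  by apply: measurable_funX; exact: measurable_funB.
have mf4 : measurable_fun setT f4.
  by apply: measurable_funX; exact: measurable_funB.
have margJ (f : R * R -> R) : measurable_fun setT f -> (forall u, 0 <= f u) ->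
    (\int[Pi]_q (f q.1)%:E = \int[J]_u (f u)%:E)%E.
  move=> mf f0; apply/esym; apply: ge0_integral_image => // A mA.
  have [H _] := PiJI A mA; rewrite -[LHS]H.
  set B := _ @^-1` _; suff -> : B = A `*` setT by [].
  by apply/seteqP; split => q /=; [split|case].
have margI (f : R * R -> R) : measurable_fun setT f -> (forall u, 0 <= f u) ->
    (\int[Pi]_q (f q.2)%:E = \int[I]_u (f u)%:E)%E.
  move=> mf f0; apply/esym; apply: ge0_integral_image => // A mA.
  have [_ H] := PiJI A mA; rewrite -[LHS]H.
  set B := _ @^-1` _; suff -> : B = setT `*` A by [].
  by apply/seteqP; split => q /=; [split|case].
have I1 : (\int[Pi]_q (f1 q.1)%:E = (s ^+ 2)%:E)%E.
  rewrite margJ// ?integral_J//; try by move=> u; exact: sqr_ge0.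
  transitivity (\int[gauss2]_p ((0 * p.1 + s * p.2) ^+ 2)%:E)%E.
    by apply: eq_integral => p _; congr EFin; rewrite /f1 /phiJ/=; ring.
  by rewrite integral_gauss2_comb_sqr// expr0n/= add0r.
have I2 : (\int[Pi]_q (f2 q.2)%:E = (b ^+ 2 + m ^+ 2 * tau ^+ 2)%:E)%E.
  rewrite margI// ?integral_I//; try by move=> u; exact: sqr_ge0.
  transitivity (\int[gauss2]_p ((b * p.1 + (m * tau) * p.2) ^+ 2)%:E)%E.
    by apply: eq_integral => p _; congr EFin; rewrite /f2 /aff/=; ring.
  by rewrite integral_gauss2_comb_sqr ?mulr_gt0// exprMn.
have I3 : (\int[Pi]_q (f3 q.2)%:E = (tau ^+ 2)%:E)%E.
  rewrite margI// ?integral_I//; try by move=> u; exact: sqr_ge0.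
  transitivity (\int[gauss2]_p ((0 * p.1 + tau * p.2) ^+ 2)%:E)%E.
    by apply: eq_integral => p _; congr EFin; rewrite /f3 /aff/=; ring.
  by rewrite integral_gauss2_comb_sqr// expr0n/= add0r.
have I4 : (\int[Pi]_q (f4 q.2)%:E = (b ^+ 2)%:E)%E.
  rewrite margI// ?integral_I//; try by move=> u; exact: sqr_ge0.
  rewrite -(integral_gauss2_fst_sqr b).
  by apply: eq_integral => p _; congr EFin; rewrite /f4 /aff/=; ring.
have I5 : (\int[Pi]_q (f3 q.1)%:E = (tau ^+ 2)%:E)%E.
  rewrite margJ// ?integral_J//; try by move=> u; exact: sqr_ge0.
  transitivity (\int[gauss2]_p ((m * b * p.1 + s * p.2) ^+ 2)%:E)%E.
    by apply: eq_integral => p _; congr EFin; rewrite /f3 /phiJ/=; ring.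
  by rewrite integral_gauss2_comb_sqr// tau2 exprMn.
(* The right side exceeds the left by exactly [(U1 - (V1 + m * Y)) ^+ 2 + k * (Z - k^-1 * Y) ^+
   2]. *)
have key q : f3 q.1 + f4 q.2 + f3 q.2 <=
    euclid_norm (q.1 - q.2) ^+ 2 + k * f1 q.1 + f2 q.2 + k^-1 * f3 q.2.
  rewrite /euclid_norm sqr_sqrtr ?addr_ge0 ?sqr_ge0//=.
  rewrite /f1 /f2 /f3 /f4.
  set U1 := q.1.1 - a; set V1 := q.2.1 - a.
  set Y := q.2.2 - m * a; set Z := q.1.2 - m * q.1.1.
  have -> : q.1.1 - q.2.1 = U1 - V1 by rewrite /U1 /V1; ring.
  have -> : q.1.2 - q.2.2 = Z + m * U1 - Y by rewrite /Z /U1 /Y; ring.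
  have -> : q.1.2 - m * a = Z + m * U1 by rewrite /Z /U1; ring.
  have H1 := sqr_ge0 (U1 - (V1 + m * Y)).
  have H2 : 0 <= k * (Z - k^-1 * Y) ^+ 2 by rewrite mulr_ge0 ?sqr_ge0 ?ltW.
  have E2 : k * (Z - k^-1 * Y) ^+ 2 = k * Z ^+ 2 - 2 * Z * Y + k^-1 * Y ^+ 2.
    by field; rewrite gt_eqF.
  rewrite E2 in H2; move: (k * Z ^+ 2) (k^-1 * Y ^+ 2) H2 => x y H2.
  nra.
have me : measurable_fun setT
    (fun q : (R * R) * (R * R) => euclid_norm (q.1 - q.2) ^+ 2).
  exact: measurable_sqr_dist.
have mfst f : measurable_fun setT f ->
    measurable_fun setT (fun q : (R * R) * (R * R) => (f q.1 : R)%:E).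
  by move=> mf; apply/measurable_EFinP; exact: measurableT_comp.
have msnd f : measurable_fun setT f ->
    measurable_fun setT (fun q : (R * R) * (R * R) => (f q.2 : R)%:E).
  by move=> mf; apply/measurable_EFinP; exact: measurableT_comp.
have pos (c x : R) : 0 <= c -> (0 <= (c * x ^+ 2)%:E)%E.
  by move=> c0; rewrite lee_fin mulr_ge0 ?sqr_ge0.
have k0' := ltW k0; have kV0 : 0 <= k^-1 by rewrite invr_ge0.
have IL : (\int[Pi]_q (f3 q.1 + f4 q.2 + f3 q.2)%:E =
    (tau ^+ 2 + b ^+ 2 + tau ^+ 2)%:E)%E.
  under eq_integral do rewrite !EFinD.
  rewrite ge0_integralD//=; last 4 first.
  - by move=> q _; rewrite -EFinD lee_fin addr_ge0 ?sqr_ge0.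
  - by apply: emeasurable_funD; [exact: mfst|exact: msnd].
  - by move=> q _; rewrite lee_fin sqr_ge0.
  - exact: msnd.
  rewrite ge0_integralD//=; last 4 first.
  - by move=> q _; rewrite lee_fin sqr_ge0.
  - exact: mfst.
  - by move=> q _; rewrite lee_fin sqr_ge0.
  - exact: msnd.
  by rewrite I5 I4 I3 -!EFinD.
have IR : (\int[Pi]_q (euclid_norm (q.1 - q.2) ^+ 2 + k * f1 q.1 + f2 q.2 + k^-1 * f3 q.2)%:E =
    W + (k * s ^+ 2 + (b ^+ 2 + m ^+ 2 * tau ^+ 2) + k^-1 * tau ^+ 2)%:E)%E.
  under eq_integral do rewrite !EFinD.
  have mk1 : measurable_fun setT (fun q : (R * R) * (R * R) => (k * f1 q.1)%:E).
    by apply: (mfst (fun u => k * f1 u)); exact: measurable_funM.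
  have mk3 : measurable_fun setT (fun q : (R * R) * (R * R) => (k^-1 * f3 q.2)%:E).
    by apply: (msnd (fun u => k^-1 * f3 u)); exact: measurable_funM.
  have mE : measurable_fun setT
      (fun q : (R * R) * (R * R) => (euclid_norm (q.1 - q.2) ^+ 2)%:E).
    exact/measurable_EFinP.
  rewrite ge0_integralD//=; last 3 first.
  - by move=> q _; rewrite !adde_ge0// ?pos// lee_fin sqr_ge0.
  - apply: emeasurable_funD; [exact: emeasurable_funD|exact: msnd].
  - by move=> q _; exact: pos.
  rewrite ge0_integralD//=; last 4 first.
  - by move=> q _; rewrite !adde_ge0// ?pos// lee_fin sqr_ge0.
  - exact: emeasurable_funD.
  - by move=> q _; rewrite lee_fin sqr_ge0.
  - exact: msnd.
  rewrite ge0_integralD//=; last 2 first.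
  - by move=> q _; rewrite lee_fin sqr_ge0.
  - by move=> q _; exact: pos.
  have -> : (\int[Pi]_q (k * f1 q.1)%:E = (k * s ^+ 2)%:E)%E.
    under eq_integral do rewrite EFinM.
    rewrite ge0_integralZl_EFin ?I1//; last exact: mfst.
    by move=> q _; rewrite lee_fin sqr_ge0.
  have -> : (\int[Pi]_q (k^-1 * f3 q.2)%:E = (k^-1 * tau ^+ 2)%:E)%E.
    under eq_integral do rewrite EFinM.
    rewrite ge0_integralZl_EFin ?I3//; last exact: msnd.
    by move=> q _; rewrite lee_fin sqr_ge0.
  by rewrite I2 -/W !EFinD !addeA.
have : ((tau ^+ 2 + b ^+ 2 + tau ^+ 2)%:E <=
    W + (k * s ^+ 2 + (b ^+ 2 + m ^+ 2 * tau ^+ 2) + k^-1 * tau ^+ 2)%:E)%E.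
  rewrite -IL -IR; apply: ge0_le_integral => //.
  - by move=> q _; rewrite lee_fin !addr_ge0 ?sqr_ge0.
  - apply/measurable_EFinP; apply: measurable_funD; last exact: measurableT_comp.
    by apply: measurable_funD; exact: measurableT_comp.
  - apply/measurable_EFinP; apply: measurable_funD.
      apply: measurable_funD; last exact: measurableT_comp.
      by apply: measurable_funD => //; apply: measurable_funM => //; exact: measurableT_comp.
    by apply: measurable_funM => //; exact: measurableT_comp.
  - by move=> q _; rewrite lee_fin.
case: (W) W0 => [x _|_ _|//]; last by rewrite leey.
rewrite -EFinD !lee_fin.
have -> : k * s ^+ 2 = tau * s by rewrite /k; field; rewrite gt_eqF.
have -> : k^-1 * tau ^+ 2 = tau * s by rewrite /k; field; rewrite !gt_eqF.
rewrite /L; lra.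
Qed.

End gaussian_pair.

End standard_normal.

(** * Uniqueness of measures on a product, restrictions and images *)

Lemma eq_finite_measure_prod {d1 d2} {T1 : measurableType d1} {T2 : measurableType d2}
    {R : realType} (m1 m2 : {measure set (T1 * T2)%type -> \bar R}) :
  (m1 setT < +oo)%E ->
  (forall A B, measurable A -> measurable B -> m1 (A `*` B) = m2 (A `*` B)) ->
  forall E, measurable E -> m1 E = m2 E.
Proof.
move=> m1oo m12 E mE.
apply: (@measure_unique _ R (T1 * T2)%type
  [set A `*` B | A in measurable & B in measurable] (fun=> setT)) => //.
- exact: measurable_prod_measurableType.
- move=> _ _ [A mA [B mB <-]] [A' mA' [B' mB' <-]].
  exists (A `&` A'); first exact: measurableI.
  by exists (B `&` B'); [exact: measurableI|rewrite setXI].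
- by move=> _; exists setT => //; exists setT => //; rewrite setXTT.
- by rewrite bigcup_const//; exists 0%N.
- by move=> _ [A mA [B mB <-]]; exact: m12.
Qed.

(** Presents the right side as an actual measure in [F], so that the uniqueness lemmas apply to
    it. *)
Lemma restr_image_measure {d1 d2} {T1 : measurableType d1} {T2 : measurableType d2}
    {R : realType} (m : {measure set T1 -> \bar R}) (A : set T1) (phi : T1 -> T2) :
  measurable A -> measurable_fun setT phi ->
  exists m' : {measure set T2 -> \bar R}, forall F, m' F = m (A `&` phi @^-1` F).
Proof.
move=> mA mphi; unshelve eexists (pushforward (mrestr m mA) phi); first exact: mphi.
by move=> F; rewrite /= /pushforward /mrestr setIC.
Qed.

Lemma scale_measure {d} {T : measurableType d} {R : realType}
    (m : {measure set T -> \bar R}) (c : \bar R) : (0 <= c)%E -> c \is a fin_num ->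
  exists m' : {measure set T -> \bar R}, forall F, m' F = (c * m F)%E.
Proof.
move=> c0 cf; have c0' : 0 <= fine c by rewrite fine_ge0.
by exists (mscale (NngNum c0') m) => F; rewrite /= /mscale/= fineK.
Qed.

(** * The Wiener integral as a limit of Gaussian sums *)

Section limit_law.
Context {d : measure_display} {T : measurableType d} {R : realType}.
Variables (P : probability T R) (A : set T) (mA : measurable A).
Variables (nu : probability R R) (Z_ : nat -> {RV P >-> R}) (Z : {RV P >-> R}).
Hypothesis Z_law : forall n E, measurable E ->
  P (A `&` Z_ n @^-1` E) = (P A * nu E)%E.
Hypothesis Z_cvg : {ae P, forall w, Z_ n w @[n --> \oo] --> Z w}.

Let mpre (Y : {RV P >-> R}) (E : set R) : measurable E -> measurable (Y @^-1` E).
Proof. by move=> mE; rewrite -[X in measurable X]setTI; exact: measurable_funP. Qed.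

(** If the limit lies in an open set, so do all late terms: one half of the portmanteau theorem. The
    fixed event [A] is later an event on the initial value, which makes the limit independent of
    it. *)
Lemma open_limit_law (U : set R) : open U ->
  (P (A `&` Z @^-1` U) <= P A * nu U)%E.
Proof.
move=> oU; have mU : measurable U by exact: open_measurable.
(* The event that every term from rank N on lies in U: it increases with N and has probability at
   most P A nu(U). *)
pose B N := \bigcap_(n in [set n | (N <= n)%N]) (A `&` Z_ n @^-1` U).
have mB N : measurable (B N).
  apply: bigcap_measurable; first by exists N => /=.
  by move=> n _; apply: measurableI => //; exact: mpre.
have ndB : nondecreasing_seq B.
  move=> N M NM; apply/subsetPset => w Bw n /= Mn; apply: Bw.
  exact: leq_trans Mn.
have mUB : measurable (\bigcup_N B N) by exact: bigcupT_measurable.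
have BU : (P (\bigcup_N B N) <= P A * nu U)%E.
  have cB := nondecreasing_cvg_mu (mu := P) mB mUB ndB.
  rewrite -(cvg_lim (@ereal_hausdorff R) cB).
  apply: lime_le.
    by apply/cvg_ex; eexists; exact: cB.
  apply: nearW => N; rewrite /= -(Z_law N mU); apply: le_measure.
  - by rewrite inE.
  - by rewrite inE; apply: measurableI => //; exact: mpre.
  - by move=> w Bw; apply: (Bw N); exact: leqnn.
apply: le_trans BU; have [N [mN N0 cvN]] := Z_cvg.
rewrite -[leRHS]adde0 -N0; apply: le_trans (measureU2 _ mUB mN).
apply: le_measure; rewrite ?inE.
- by apply: measurableI => //; exact: mpre.
- exact: measurableU.
move=> w [Aw Uw]; have [nN|/contrapT cw] := pselect (~ (Z_ n w @[n --> \oo] --> Z w)).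
  by right; exact: cvN.
left; have : \forall n \near \oo, U (Z_ n w).
  by apply: cw; move: oU; rewrite openE => /(_ _ Uw).
by move=> [M _ MU]; exists M => // n /= Mn; split => //; exact: MU.
Qed.

(* The bound for open sets, applied to a ray and to the complement of a smaller
   closed ray, gives both inequalities. *)
Lemma limit_law (E : set R) : measurable E ->
  P (A `&` Z @^-1` E) = (P A * nu E)%E.
Proof.
have PAf : P A \is a fin_num by exact: fin_num_measure.
have [m2 m2E] := scale_measure nu (measure_ge0 P A) PAf.
have [m1 m1E] := restr_image_measure P mA (measurable_funP Z).
have m1T : m1 setT = P A by rewrite m1E preimage_setT setIT.
have m2T : m2 setT = P A by rewrite m2E [X in (_ * X)%E](@probability_setT _ _ _ nu) mule1.
have fin1 F : measurable F -> m1 F \is a fin_num.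
  move=> mF; rewrite ge0_fin_numE ?measure_ge0//.
  apply: le_lt_trans (_ : m1 setT < _)%E; first by apply: le_measure; rewrite ?inE.
  by rewrite m1T -ge0_fin_numE.
have fin2 F : measurable F -> m2 F \is a fin_num.
  move=> mF; rewrite ge0_fin_numE ?measure_ge0//.
  apply: le_lt_trans (_ : m2 setT < _)%E; first by apply: le_measure; rewrite ?inE.
  by rewrite m2T -ge0_fin_numE.
move=> mE; rewrite -m1E -m2E; apply: eq_finite_measure_rays => //.
  by rewrite m1T -ge0_fin_numE.
move=> x; apply/eqP; rewrite eq_le; apply/andP; split.
  by rewrite m1E m2E; apply: open_limit_law; exact: interval_open.
have xE : `]-oo, x[%classic = \bigcup_k `]-oo, x - k.+1%:R^-1]%classic.
  apply/seteqP; split => y /=; rewrite in_itv/=.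
    move=> yx; exists (Num.truncn (x - y)^-1) => //=; rewrite in_itv/=.
    rewrite lerBrDr -lerBrDl -[leRHS]invrK lef_pV2 ?posrE ?invr_gt0 ?subr_gt0//.
    exact/ltW/truncnS_gt.
  by move=> [k _] /=; rewrite in_itv/= => /le_lt_trans; apply; rewrite ltrBlDr ltrDl.
pose F k := `]-oo, x - k.+1%:R^-1]%classic.
have mF k : measurable (F k) by exact: measurable_itv.
have ndF : nondecreasing_seq F.
  apply/nondecreasing_seqP => k; apply/subsetPset; apply: subset_itvl.
  by rewrite bnd_simp lerB// lef_pV2 ?posrE// ler_nat.
have mUF : measurable (\bigcup_k F k) by exact: bigcupT_measurable.
rewrite xE; have c1 := nondecreasing_cvg_mu (mu := m1) mF mUF ndF.
have c2 := nondecreasing_cvg_mu (mu := m2) mF mUF ndF.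
rewrite -(cvg_lim (@ereal_hausdorff R) c1) -(cvg_lim (@ereal_hausdorff R) c2).
apply: lee_lim; [by apply/cvg_ex; eexists; exact: c2|by apply/cvg_ex; eexists; exact: c1|].
apply: nearW => k /=.
have CF : ~` F k = `]x - k.+1%:R^-1, +oo[%classic by rewrite /F -setCitvr setCK.
have mCF := measurableC (mF k).
have H1 : (m1 (F k) + m1 (~` F k) = P A)%E.
  by rewrite -measureU ?setICr ?setUv.
have H2 : (m2 (F k) + m2 (~` F k) = P A)%E.
  by rewrite -measureU ?setICr ?setUv.
have H : (m1 (~` F k) <= m2 (~` F k))%E.
  by rewrite m1E m2E; apply: open_limit_law; rewrite CF; exact: interval_open.
move: H1 H2 H; rewrite -(fineK PAf) -(fineK (fin1 _ (mF k))) -(fineK (fin2 _ (mF k))).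
rewrite -(fineK (fin1 _ mCF)) -(fineK (fin2 _ mCF)) -!EFinD !lee_fin => -[h1] [h2] h.
lra.
Qed.

End limit_law.

Section brownian_sums.
Context {d : measure_display} {T : measurableType d} {R : realType}.
Variables (P : probability T R) (B : R -> {RV P >-> R}).
Hypothesis B_bm : standard_brownian_motion B.
Variables (t : nat -> R) (c : nat -> R).
Hypotheses (t0 : 0 <= t 0%N) (t_incr : {homo t : i j / (i < j)%N >-> i < j}).
Hypothesis c0 : forall i, 0 < c i.
Notation gamma := (@normal_law R 0 1).

Definition increment (i : nat) : T -> R := B (t i.+1) \- B (t i).
Definition increment_sum (n : nat) (w : T) : R :=
  \sum_(i < n) c i * increment i w.
Definition increment_sum_var (n : nat) : R :=
  \sum_(i < n) c i ^+ 2 * (t i.+1 - t i).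

Let t_ge0 i : 0 <= t i.
Proof. by case: i => [//|i]; apply: (le_trans t0); apply/ltW/t_incr. Qed.

Lemma measurable_increment i : measurable_fun setT (increment i).
Proof. exact: measurable_funB. Qed.

Lemma measurable_increment_sum n : measurable_fun setT (increment_sum n).
Proof.
by apply: measurable_sum => i; apply: measurable_funM => //; exact: measurable_increment.
Qed.

Let measurable_pre (Y : T -> R) E : measurable_fun setT Y -> measurable E ->
  measurable (Y @^-1` E).
Proof. by move=> mY mE; rewrite -[X in measurable X]setTI; exact: mY. Qed.

Let measurable_pre_R (Y : R -> R) E : measurable_fun setT Y -> measurable E ->
  measurable (Y @^-1` E).
Proof. by move=> mY mE; rewrite -[X in measurable X]setTI; exact: mY. Qed.

Lemma increment_law i E : measurable E ->
  P (increment i @^-1` E) =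
  gamma ((fun y => Num.sqrt (t i.+1 - t i) * y) @^-1` E).
Proof.
move=> mE; have tt : t i < t i.+1 by exact: t_incr.
have [_ _ /(_ (t i) (t i.+1)) H _] := B_bm.
have := H _ E mE; rewrite t_ge0 tt => /(_ isT).
rewrite -[X in X = _]/(P (increment i @^-1` E)) => ->.
rewrite -[LHS]/(normal_law 0 (Num.sqrt (t i.+1 - t i)) E).
rewrite normal_law_affine//; last by rewrite sqrtr_gt0 subr_gt0.
have -> // : (fun x => 0 + Num.sqrt (t i.+1 - t i) * x) =
  (fun y => Num.sqrt (t i.+1 - t i) * y).
by apply/funext => y; rewrite add0r.
Qed.

(* Adding one increment at a time to the sum requires it to be independent of the
   remaining ones jointly, so their values are constrained along the induction. *)
Let later N n (E : nat -> set R) : set T :=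
  \bigcap_(i : 'I_N) (increment i @^-1` (if (i < n)%N then setT else E i)).

Let measurable_later N n E : (forall i, measurable (E i)) -> measurable (later N n E).
Proof.
move=> mE; rewrite /later; apply: fin_bigcap_measurable => // i _.
apply: measurable_pre; first exact: measurable_increment.
by case: ifP.
Qed.

Let laterS N n E : (n < N)%N ->
  later N n E = later N n.+1 E `&` increment n @^-1` E n.
Proof.
move=> nN; apply/seteqP; split => w /=.
  move=> H; split; last by have := H (Ordinal nN) I; rewrite /= ltnn.
  move=> i _ /=; have := H i I; rewrite /= ltnS.
  by case: ltngtP.
move=> [H1 H2] i _ /=; have := H1 i I; rewrite /= ltnS.
by case: ltngtP => // ->.
Qed.

Let P_laterS N n E : (forall i, measurable (E i)) -> (n < N)%N ->
  P (later N n E) = (P (later N n.+1 E) * P (increment n @^-1` E n))%E.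
Proof.
move=> mE nN; have [_ _ _ /(_ N t t0 t_incr) indep] := B_bm.
have pE k : P (later N k E) =
    (\prod_(i < N) P (increment i @^-1` (if (i < k)%N then setT else E i)))%E.
  by apply: (indep (fun i : 'I_N => if (i < k)%N then setT else E i)) => i; case: ifP.
rewrite !pE (bigD1 (Ordinal nN))//= ltnn.
rewrite [in RHS](bigD1 (Ordinal nN))//= ltnS leqnn preimage_setT probability_setT mul1e.
rewrite muleC; congr (_ * _)%E; apply: eq_bigr => i; rewrite -val_eqE/= => iN.
by rewrite ltnS; case: ltngtP iN.
Qed.

(** Induction on [n]; the law is given as a scaled preimage under [gamma], so that the empty sum, of
    variance 0, is included. *)
Let sum_law_later N n E F : (n <= N)%N -> (forall i, measurable (E i)) -> measurable F ->
  P (later N n E `&` increment_sum n @^-1` F) =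
  (P (later N n E) * gamma ((fun y : R => (Num.sqrt (increment_sum_var n) * y)%R) @^-1` F))%E.
Proof.
elim: n E F => [|n IH] E F nN mE mF.
  have -> : increment_sum 0 @^-1` F = [set _ | F 0].
    by apply/funext => w; rewrite /preimage/= /increment_sum big_ord0.
  have -> : (fun y : R => Num.sqrt (increment_sum_var 0) * y) @^-1` F = [set _ | F 0].
    by apply/funext => y; rewrite /preimage/= /increment_sum_var big_ord0 sqrtr0 mul0r.
  have [F0|F0] := pselect (F 0).
    have TE (U : Type) : [set _ : U | F 0] = setT by apply/funext => u; apply/propext.
    by rewrite !TE setIT [X in (_ * X)%E](@probability_setT _ _ _ gamma) mule1.
  have TE (U : Type) : [set _ : U | F 0] = set0 by apply/funext => u; apply/propext.
  by rewrite !TE setI0 !measure0 mule0.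
have mL := measurable_later N n.+1 mE.
pose phi w := (increment_sum n w, increment n w).
have mphi : measurable_fun setT phi.
  by apply: measurable_fun_pair; [exact: measurable_increment_sum|exact: measurable_increment].
pose s := Num.sqrt (increment_sum_var n); pose e := Num.sqrt (t n.+1 - t n).
have e0 : 0 < e by rewrite sqrtr_gt0 subr_gt0; exact: t_incr.
have v0 : 0 <= increment_sum_var n.
  apply: sumr_ge0 => i _; rewrite mulr_ge0 ?sqr_ge0// subr_ge0; apply/ltW; exact: t_incr.
pose psi (p : R * R) := (s * p.1, e * p.2).
have mpsi : measurable_fun setT psi.
  by apply: measurable_fun_pair; exact: measurable_funM.
have Lf : P (later N n.+1 E) \is a fin_num by exact: fin_num_measure.
(* [m1] is the law of the partial sum and the next increment on the event constraining the
   increments beyond [n]; [m2] is the product Gaussian law with the mass of that event. *)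
have [m1 m1E] := restr_image_measure P mL mphi.
have [m0 m0E] := restr_image_measure gauss2 measurableT mpsi.
have [m2 m2E] := scale_measure m0 (measure_ge0 P _) Lf.
have m12 : forall X, measurable X -> m1 X = m2 X.
  apply: eq_finite_measure_prod.
    rewrite m1E preimage_setT setIT -ge0_fin_numE//.
  move=> A C mA mC; rewrite m1E m2E m0E setTI.
  (* The condition on increment [n] is written into the constraints, so the induction hypothesis
     gives [m1] on rectangles. *)
  pose E' i := if i == n then C else E i.
  have mE' i : measurable (E' i) by rewrite /E'; case: eqP.
  have LE : later N n.+1 E' = later N n.+1 E.
    apply: eq_bigcapr => i _; congr (_ @^-1` _); case: ifPn => //.
    by rewrite /E' -leqNgt; case: eqVneq => // ->; rewrite ltnn.
  have -> : later N n.+1 E `&` phi @^-1` (A `*` C) =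
      later N n E' `&` increment_sum n @^-1` A.
    rewrite (laterS _ nN) LE /E' eqxx.
    by apply/seteqP; split => w /=; [move=> [? []]|move=> [[? ?] ?]].
  apply: (etrans (IH _ _ (ltnW nN) mE' mA)).
  rewrite (P_laterS mE' nN) LE /E' eqxx -muleA; congr (_ * _)%E.
  rewrite increment_law// muleC.
  have -> : psi @^-1` (A `*` C) =
    ((fun y => s * y) @^-1` A) `*` ((fun y => e * y) @^-1` C) by [].
  have mAs : measurable ((fun y => s * y) @^-1` A).
    by apply: measurable_pre_R => //; exact: measurable_funM.
  have mCe : measurable ((fun y => e * y) @^-1` C).
    by apply: measurable_pre_R => //; exact: measurable_funM.
  exact/esym/gauss2_rect.
pose X := [set p : R * R | F (p.1 + c n * p.2)].
have mX : measurable X.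
  rewrite -[X in measurable X]setTI.
  have ml : measurable_fun setT (fun p : R * R => p.1 + c n * p.2).
    by apply: measurable_funD => //; exact: measurable_funM.
  exact: ml.
have := m12 X mX; rewrite m1E m2E m0E setTI.
have -> : phi @^-1` X = increment_sum n.+1 @^-1` F.
  by apply/funext => w; rewrite /preimage/= /X/= /increment_sum big_ord_recr.
move=> ->; congr (_ * _)%E.
have -> : psi @^-1` X = (fun p => s * p.1 + (c n * e) * p.2) @^-1` F.
  by apply/funext => p; rewrite /preimage/= /X/= /psi/= mulrA.
have ce0 : 0 < c n * e by rewrite mulr_gt0.
apply: (etrans (normal_comb_law s ce0 mF)).
have -> // : Num.sqrt (s ^+ 2 + (c n * e) ^+ 2) = Num.sqrt (increment_sum_var n.+1).
rewrite /increment_sum_var big_ord_recr/= exprMn !sqr_sqrtr// subr_ge0.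
exact/ltW/t_incr.
Qed.

Lemma increment_sum_law n F : measurable F ->
  P (increment_sum n @^-1` F) =
  gamma ((fun y => Num.sqrt (increment_sum_var n) * y) @^-1` F).
Proof.
move=> mF; have := @sum_law_later n n (fun=> setT) F (leqnn n) (fun=> measurableT) mF.
have -> : later n n (fun=> setT) = setT.
  by apply/seteqP; split => // w _ i _ /=; case: ifP.
by rewrite setTI [X in (X * _)%E]probability_setT mul1e.
Qed.

Lemma increment_sum_sigma n F : measurable F ->
  sigma_algebra_of `[0, +oo[ B (increment_sum n @^-1` F).
Proof.
move=> mF.
pose G := \bigcup_(s in `[0, +oo[) preimage_set_system setT (B s) measurable.
(* Measurability for the sigma-algebra of the Brownian motion is ordinary measurability on T endowed
   with it. *)
pose TG : measurableType _ := g_sigma_algebraType G.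
have mB s : 0 <= s -> @measurable_fun _ _ TG R setT (B s).
  move=> s0 _ E mE; apply: sub_sigma_algebra; exists s; first by rewrite /= in_itv/= s0.
  by exists E.
have mS : @measurable_fun _ _ TG R setT (increment_sum n).
  apply: measurable_sum => i; apply: measurable_funM => //.
  by apply: measurable_funB; apply: mB.
by have := mS measurableT F mF; rewrite setTI.
Qed.

(** Dividing by the standard deviation of the sum itself, rather than by its limit, keeps the law
    constant in [n], as [limit_law] requires. *)
Lemma normalised_increment_sum_law (xi : {RV P >-> R}) n E F :
  independent_of_process xi B -> (0 < n)%N -> measurable E -> measurable F ->
  P (xi @^-1` E `&`
     (fun w => increment_sum n w / Num.sqrt (increment_sum_var n)) @^-1` F) =
  (P (xi @^-1` E) * gamma F)%E.
Proof.
move=> indep n0 mE mF.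
have v0 : 0 < increment_sum_var n.
  rewrite /increment_sum_var; case: n n0 => // n _.
  rewrite big_ord_recr/= ltr_wpDl ?mulr_gt0 ?exprn_gt0 ?subr_gt0 ?t_incr//.
  by apply: sumr_ge0 => i _; rewrite mulr_ge0 ?sqr_ge0// subr_ge0; apply/ltW/t_incr.
set s := Num.sqrt _; have s0 : s != 0 by rewrite gt_eqF// sqrtr_gt0.
pose F' := (fun y => y / s) @^-1` F.
have mF' : measurable F'.
  by apply: measurable_pre_R => //; exact: measurable_funM.
rewrite -[X in _ `&` X]/(increment_sum n @^-1` F').
rewrite (indep _ _ mE (increment_sum_sigma n mF')) increment_sum_law//.
congr (_ * gamma _)%E; apply/funext => y.
by rewrite /preimage/= /F'/= -/s mulrC mulKf.
Qed.

End brownian_sums.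

(** * Variation of constants along a path *)

Section calculus.
Context {R : realType}.
Notation lebesgue := (@lebesgue_measure R).

Lemma is_derive_continuous (f : R -> R) (s df : R) : is_derive s 1 f df -> {for s, continuous f}.
Proof.
by move=> [/derivable1_diffP fs _]; exact: (differentiable_continuous fs).
Qed.

Lemma is_derive_within (f df : R -> R) (p q : R) :
  (forall s : R, p <= s <= q -> is_derive s 1 f (df s)) -> {within `[p, q], continuous f}.
Proof.
by move=> fd; apply: derivable_within_continuous => s; rewrite in_itv/= => /fd [].
Qed.

Lemma mean_value (f df : R -> R) (p q : R) : p < q ->
  (forall s : R, p <= s <= q -> is_derive s 1 f (df s)) ->
  exists2 s, p <= s <= q & f q - f p = df s * (q - p).
Proof.
move=> pq fd; have [||s spq fE] := @MVT R f df p q pq; [|exact: is_derive_within fd|].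
  by move=> s; rewrite in_itv/= => /andP[ps sq]; apply: fd; rewrite !ltW.
by exists s => //; move: spq; rewrite in_itv/= => /andP[ps sq]; rewrite !ltW.
Qed.

Lemma derive_nincr (f df : R -> R) (a : R) :
  (forall s : R, a <= s -> is_derive s 1 f (df s)) -> (forall s, a <= s -> df s <= 0) ->
  forall s, a <= s -> f s <= f a.
Proof.
move=> fd df0 s; rewrite le_eqVlt => /predU1P[->//|as_].
have [|u /andP[au _] /eqP] := @mean_value f df a s as_; first by move=> u /andP[/fd].
rewrite subr_eq => /eqP ->; rewrite gerDr; apply: mulr_le0_ge0; first exact: df0.
by rewrite subr_ge0 ltW.
Qed.

(** The integral starts at [a] < 0 and its value at 0 is subtracted, so that 0 is an interior point
    where the derivative is two-sided. *)
Lemma continuous_primitive (h : R -> R) (a : R) : a < 0 ->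
  (forall s : R, a <= s -> {for s, continuous h}) ->
  exists H : R -> R, [/\ H 0 = 0, (forall s : R, a < s -> is_derive s 1 H (h s)) &
    forall t, 0 <= t -> \int[lebesgue]_(s in `[0, t]) h s = H t].
Proof.
move=> a0 hc.
have hi b : lebesgue.-integrable `[a, b] (EFin \o h).
  apply: continuous_compact_integrable; first exact: segment_compact.
  apply/subspace_continuousP => s /=; rewrite in_itv/= => /andP[/hc hs _].
  exact: cvg_within_filter.
pose K s := \int[lebesgue]_(u in `[a, s]) h u.
have Kd s : a < s -> is_derive s 1 K (h s).
  move=> as_; have ss1 : s < s + 1 by rewrite ltrDl.
  have [] := @continuous_FTC1_closed _ h a s (s + 1) ss1 (hi _) as_ (hc _ (ltW as_)).
  by move=> dK <-; rewrite derive1E; exact: derivableP.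
exists (fun s => K s - K 0); split; first by rewrite subrr.
  move=> s as_; have := is_deriveB (Kd s as_) (is_derive_cst (K 0) s 1).
  by rewrite subr0.
move=> t t0; rewrite /K Rintegral_itvB//.
  rewrite Rintegral_itv_obnd_cbnd//.
  apply: integrableS (hi t) => //; apply: subset_itvr; rewrite bnd_simp; exact: ltW.
by rewrite bnd_simp ltW.
Qed.

(** There are [N.+1] cells, so that every [N] gives a genuine grid. *)
Definition grid_step (t : R) (N : nat) : R := t / N.+1%:R.

Lemma grid_end t N : N.+1%:R * grid_step t N = t.
Proof. by rewrite /grid_step mulrC divfK. Qed.

(** Errors of at most eta times the length of their cell add up to at most eta t. *)
Lemma grid_sum_cvg0 (t : R) (u : R -> R -> R) : 0 < t ->
  (forall eta : R, 0 < eta -> exists2 del : R, 0 < del & forall p q : R, 0 <= p -> p < q ->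
     q <= t -> q - p < del -> `|u p q| <= eta * (q - p)) ->
  \sum_(i < N.+1) u (i%:R * grid_step t N) (i.+1%:R * grid_step t N) @[N --> \oo] --> (0 : R).
Proof.
move=> t0 ub; apply/cvgrPdist_le => eps eps0.
have [del del0 udel] := ub (eps / t) (divr_gt0 eps0 t0).
exists (Num.truncn (t / del)) => // N /= Ndel; rewrite sub0r normrN.
have d0 : 0 < grid_step t N by rewrite divr_gt0.
have ddel : grid_step t N < del.
  rewrite /grid_step ltr_pdivrMr// -ltr_pdivrMl// mulrC.
  by apply: lt_le_trans (truncnS_gt _) _; rewrite ler_nat ltnS.
apply: le_trans (ler_norm_sum _ _ _) _.
have -> : eps = \sum_(i < N.+1) eps / t * grid_step t N.
  by rewrite sumr_const card_ord -mulr_natl mulrCA grid_end divfK// gt_eqF.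
apply: ler_sum => i _.
have E : i.+1%:R * grid_step t N - i%:R * grid_step t N = grid_step t N.
  by rewrite -mulrBl -natrB ?subSnn ?mul1r.
rewrite -[in leRHS]E; apply: udel; rewrite ?E//.
- by rewrite mulr_ge0// ltW.
- by rewrite ltr_pM2r// ltr_nat.
- by rewrite -[leRHS](grid_end t N) ler_pM2r// ler_nat.
Qed.

(** Heine's theorem from the covering form of compactness. Continuity is two-sided at the points of
    the interval, so [q] may lie outside. *)
Lemma uniform_continuity (h : R -> R) (t : R) :
  (forall s : R, 0 <= s <= t -> {for s, continuous h}) -> forall eta : R, 0 < eta ->
  exists2 del : R, 0 < del & forall p q : R, 0 <= p <= t -> `|p - q| < del -> `|h p - h q| <= eta.
Proof.
move=> hc eta eta0.
have /compact_near_coveringP /(_ R (0^'+)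
  (fun del p => forall q, `|p - q| < del -> `|h p - h q| <= eta) _) : compact `[0, t].
  exact: segment_compact.
case.
  move=> s; rewrite /= in_itv/= => /hc /cvgrPdist_le /(_ (eta / 2)).
  rewrite divr_gt0// => /(_ isT) /nbhs_ballP[r /= r0 rh].
  (* With half the radius for each, both [s'] and any [q] within [del] of it stay within r of s. *)
  exists (ball s (r / 2), [set del | 0 < del < r / 2]) => /=.
    split; first by apply: nbhsx_ballx; rewrite divr_gt0.
    exists (r / 2) => /=; first by rewrite divr_gt0.
    move=> del /=; rewrite sub0r normrN => dr d0.
    by rewrite d0 (le_lt_trans (ler_norm _) dr).
  move=> [s' del] /= [ss' /andP[_ dr]] q s'q.
  have hs' : `|h s - h s'| <= eta / 2.
    by apply: rh; rewrite /ball/=; move: ss'; rewrite /ball/= => ss'; lra.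
  have hq : `|h s - h q| <= eta / 2.
    apply: rh; move: ss'; rewrite /ball/= => ss'.
    by have := ler_distD s' s q; lra.
  by rewrite (le_trans (ler_distD (h s) _ _))// [X in X + _]distrC (splitr eta) lerD.
move=> r /= r0 rh; exists (r / 2); first by rewrite divr_gt0.
move=> p q p0t pq; apply: (rh (r / 2)); last exact: pq.
- by rewrite /= sub0r normrN gtr0_norm ?divr_gt0// ltr_pdivrMr// ltr_pMr// ltr1n.
- by rewrite divr_gt0.
- by rewrite /= in_itv.
Qed.

Lemma continuous_bounded (h : R -> R) (t : R) : 0 <= t ->
  (forall s : R, 0 <= s <= t -> {for s, continuous h}) ->
  exists2 K : R, 0 < K & forall s : R, 0 <= s <= t -> `|h s| <= K.
Proof.
move=> t0 hc; have [|c _ hK] := @EVT_max R (fun s => `|h s|) 0 t t0.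
  apply/subspace_continuousP => s /=; rewrite in_itv/= => /hc hs.
  by apply: cvg_within_filter; apply: cvg_norm.
exists (`|h c| + 1); first by rewrite ltr_wpDl.
by move=> s st; apply: le_trans (hK s _) _; rewrite ?in_itv// lerDl.
Qed.

(** By the mean value theorem the error on a cell [p, q] is (h p - h s)(q - p) for some s in the
    cell, small by uniform continuity. *)
Lemma riemann_sum_cvg (h W : R -> R) (t : R) : 0 < t ->
  (forall s : R, 0 <= s <= t -> {for s, continuous h}) ->
  (forall s : R, 0 <= s <= t -> is_derive s 1 W (h s)) ->
  \sum_(i < N.+1) h (i%:R * grid_step t N) *
    (i.+1%:R * grid_step t N - i%:R * grid_step t N) @[N --> \oo] --> W t - W 0.
Proof.
move=> t0 hc Wd.
pose u p q := h p * (q - p) - (W q - W p).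
have u0 : \sum_(i < N.+1) u (i%:R * grid_step t N) (i.+1%:R * grid_step t N)
    @[N --> \oo] --> (0 : R).
  apply: grid_sum_cvg0 => // eta eta0.
  have [del del0 hdel] := uniform_continuity hc eta0.
  exists del => // p q p0 pq qt qpdel.
  have [|s /andP[ps sq] WE] := @mean_value W h p q pq.
    by move=> s /andP[ps sq]; apply: Wd; rewrite (le_trans p0 ps) (le_trans sq qt).
  rewrite /u WE -mulrBl normrM (gtr0_norm (_ : 0 < q - p)) ?subr_gt0//.
  rewrite ler_pM2r ?subr_gt0//; apply: hdel.
    by rewrite p0 (le_trans (ltW pq) qt).
  by rewrite ler0_norm ?subr_le0// opprB; lra.
have -> : (fun N => \sum_(i < N.+1) h (i%:R * grid_step t N) *
    (i.+1%:R * grid_step t N - i%:R * grid_step t N)) =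
  (fun N => \sum_(i < N.+1) u (i%:R * grid_step t N) (i.+1%:R * grid_step t N)
    + (W t - W 0)).
  apply/funext => N.
  have <- : \sum_(i < N.+1) (W (i.+1%:R * grid_step t N) - W (i%:R * grid_step t N))
     = W t - W 0.
    rewrite -(big_mkord xpredT (fun i : nat =>
      W (i.+1%:R * grid_step t N) - W (i%:R * grid_step t N))).
    by rewrite (telescope_sumr (fun i : nat => W (i%:R * grid_step t N)))// grid_end mul0r.
  by rewrite -big_split/=; apply: eq_bigr => i _; rewrite /u subrK.
by rewrite -[X in _ --> X]add0r; apply: cvgD => //; exact: cvg_cst.
Qed.

(* On a cell [p, q] the error is the increment of f(p) Q - x(q) f, whose derivative
   at s is g(s) (f(p) x(s) - x(q) f(s)): small by uniform continuity. *)
Lemma variation_of_constants (g f x Q beta : R -> R) (x0 c t : R) : 0 < t -> f 0 = 1 ->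
  (forall s : R, 0 <= s -> {for s, continuous g}) ->
  (forall s : R, 0 <= s -> {for s, continuous x}) ->
  (forall s : R, 0 <= s -> is_derive s 1 f (g s * f s)) ->
  (forall s : R, 0 <= s -> is_derive s 1 Q (g s * x s)) ->
  Q 0 = 0 -> (forall s : R, 0 <= s <= t -> x s = x0 - Q s + c * (beta s - beta 0)) ->
  \sum_(i < N.+1) f (i%:R * grid_step t N) * (c *
    (beta (i.+1%:R * grid_step t N) - beta (i%:R * grid_step t N)))
    @[N --> \oo] --> f t * x t - x0.
Proof.
move=> t0 f0 gc xc fd Qd Q0 xE.
have fc (s : R) : 0 <= s -> {for s, continuous f} by move=> /fd /is_derive_continuous.
pose u p q := f p * (c * (beta q - beta p)) - (f q * x q - f p * x p).
have u0 : \sum_(i < N.+1) u (i%:R * grid_step t N) (i.+1%:R * grid_step t N)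
    @[N --> \oo] --> (0 : R).
  have [Kg Kg0 gK] := continuous_bounded (ltW t0) (fun s st => gc s (andP st).1).
  have [Kx Kx0 xK] := continuous_bounded (ltW t0) (fun s st => xc s (andP st).1).
  have [Kf Kf0 fK] := continuous_bounded (ltW t0) (fun s st => fc s (andP st).1).
  apply: grid_sum_cvg0 => // eta eta0.
  (* With g, x and f bounded by Kg, Kx and Kf, the derivative on a cell is at most Kg (Kx + Kf)
     eta'. *)
  pose eta' := eta / (Kg * (Kx + Kf)).
  have K0 : 0 < Kg * (Kx + Kf) by rewrite mulr_gt0// addr_gt0.
  have eta'0 : 0 < eta' by rewrite divr_gt0.
  have [d1 d10 fu] := @uniform_continuity f t (fun s st => fc s (andP st).1) _ eta'0.
  have [d2 d20 xu] := @uniform_continuity x t (fun s st => xc s (andP st).1) _ eta'0.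
  exists (Num.min d1 d2); first by rewrite lt_min d10.
  move=> p q p0 pq qt; rewrite lt_min => /andP[qp1 qp2].
  have q0 := le_trans p0 (ltW pq); have pt := le_trans (ltW pq) qt.
  have [|s /andP[ps sq]] := @mean_value (fun s => f p * Q s - x q * f s)
     (fun s => f p * (g s * x s) - x q * (g s * f s)) p q pq.
    move=> s /andP[ps _]; have s0 := le_trans p0 ps.
    exact: (is_deriveB (is_deriveZ (f p) (Qd s s0)) (is_deriveZ (x q) (fd s s0))).
  (* The equation of the path eliminates [beta], leaving a function whose moving parts [Q] and [f]
     are differentiable although [x] is not. *)
  have -> : f p * Q q - x q * f q - (f p * Q p - x q * f p) = u p q.
    rewrite /u; have -> : c * (beta q - beta p) = (x q - x p) + (Q q - Q p).
      by rewrite !xE ?p0 ?q0//; ring.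
    by ring.
  move=> ->; rewrite normrM (gtr0_norm (_ : 0 < q - p)) ?subr_gt0//.
  rewrite ler_pM2r ?subr_gt0//.
  have s0 := le_trans p0 ps; have st := le_trans sq qt.
  have -> : f p * (g s * x s) - x q * (g s * f s) =
    g s * ((f p - f s) * x s + (x s - x q) * f s) by ring.
  have -> : eta = Kg * (eta' * Kx + eta' * Kf).
    by rewrite -mulrDr mulrCA /eta' divfK// gt_eqF.
  rewrite normrM ler_pM ?gK ?s0//.
  apply: le_trans (ler_normD _ _) _; rewrite !normrM lerD// ler_pM ?xK ?fK ?s0//.
    by apply: fu; rewrite ?p0// distrC ger0_norm ?subr_ge0//; lra.
  by apply: xu; rewrite ?s0// distrC ger0_norm ?subr_ge0//; lra.
have x00 : x 0 = x0 by rewrite xE ?lexx ?ltW// Q0 subrr mulr0 subr0 addr0.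
have -> : (fun N => \sum_(i < N.+1) f (i%:R * grid_step t N) * (c *
    (beta (i.+1%:R * grid_step t N) - beta (i%:R * grid_step t N)))) =
  (fun N => \sum_(i < N.+1) u (i%:R * grid_step t N) (i.+1%:R * grid_step t N)
    + (f t * x t - x0)).
  apply/funext => N; pose W s := f s * x s.
  have <- : \sum_(i < N.+1) (W (i.+1%:R * grid_step t N) - W (i%:R * grid_step t N))
     = f t * x t - x0.
    rewrite -(big_mkord xpredT (fun i : nat =>
      W (i.+1%:R * grid_step t N) - W (i%:R * grid_step t N))).
    rewrite (telescope_sumr (fun i : nat => W (i%:R * grid_step t N)))// grid_end mul0r.
    by rewrite /W f0 x00 mul1r.
  by rewrite -big_split/=; apply: eq_bigr => i _; rewrite /u subrK.
by rewrite -[X in _ --> X]add0r; apply: cvgD => //; exact: cvg_cst.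
Qed.

End calculus.

Lemma continuous_max0 {R : realType} (h : R -> R) : {within `[0, +oo[, continuous h} ->
  continuous (fun s : R => h (Num.max 0 s)).
Proof.
move=> /subspace_continuousP hc s.
have m0 : `[0, +oo[%classic (Num.max 0 s) by rewrite /= in_itv/= le_max lexx.
have mc : Num.max 0 s' @[s' --> s] --> within `[0, +oo[%classic (nbhs (Num.max 0 s)).
  move=> U /= nU; have mcont : {for s, continuous (fun s' : R => Num.max 0 s')}.
    apply: (@continuous_comp R (R * R)%type R (fun s' => (0, s')) (fun p => Num.max p.1 p.2)).
      exact: (cvg_pair (cvg_cst 0) cvg_id).
    exact: max_continuous.
  have /mcont nU' : nbhs (Num.max 0 s) [set x | `[0, +oo[%classic x -> U x] by exact: nU.
  change (nbhs (s : R) [set s' : R | `[0, +oo[%classic (Num.max 0 s') -> U (Num.max 0 s')]) in nU'.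
  change (nbhs (s : R) [set s' : R | U (Num.max 0 s')]).
  by apply: filterS nU' => s' /=; apply; rewrite in_itv/= le_max lexx.
by move=> U /(hc _ m0); exact: mc.
Qed.

(* [Num.max 0 s] extends A continuously to negative times, which makes the
   derivatives at 0 two-sided. *)
Lemma growth_factor {R : realType} (theta : R) (A : R -> R) :
  {within `[0, +oo[, continuous A} ->
  exists f V : R -> R, [/\ f 0 = 1 /\ V 0 = 0, forall s, 0 < f s,
    forall s : R, 0 <= s -> is_derive s 1 f ((theta - A (Num.max 0 s)) * f s),
    forall s : R, 0 <= s -> is_derive s 1 V (f s ^+ 2) &
    forall t : R, 0 <= t ->
      f t = expR (theta * t - \int[lebesgue_measure]_(s in `[0, t]) A s)].
Proof.
move=> /continuous_max0 Ac.
(* Two margins left of 0 are needed: H is differentiable beyond -2, hence f^2 is continuous from -1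
   on, which makes V differentiable at 0. *)
have n2 : (-2 : R) < 0 by rewrite oppr_lt0.
have [H [H0 Hd HE]] := continuous_primitive n2 (fun s _ => Ac s).
pose f s := expR (theta * s - H s).
have fd (s : R) : -2 < s -> is_derive s 1 f ((theta - A (Num.max 0 s)) * f s).
  move=> s2; have Hs := Hd s s2.
  have d1 : is_derive s 1 (fun s => theta * s - H s) (theta - A (Num.max 0 s)).
    apply: is_deriveB.
    by have := is_deriveZ theta (is_derive_id s (1 : R)); rewrite /GRing.scale/= mulr1.
  have := @is_derive1_comp _ expR (fun s => theta * s - H s) s _ _ (is_derive_expR _) d1.
  by rewrite /GRing.scale/= mulrC.
have n1 : (-1 : R) < 0 by rewrite oppr_lt0.
have f2c (s : R) : -1 <= s -> {for s, continuous (fun s => f s ^+ 2)}.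
  move=> s1; have fs : {for s, continuous f}.
    by apply/is_derive_continuous/fd; lra.
  exact: (cvgM fs fs).
have [V [V0 Vd _]] := continuous_primitive n1 f2c.
exists f, V; split.
- by rewrite /f H0 subr0 mulr0 expR0.
- by move=> s; exact: expR_gt0.
- by move=> s s0; apply: fd; lra.
- by move=> s s0; apply: Vd; lra.
- move=> t t0; rewrite /f -HE//; congr (expR (_ - _)).
  by apply: eq_Rintegral => s; rewrite inE/= in_itv/= => /andP[s0 _]; rewrite max_r.
Qed.

(** * The joint law of the initial value and the solution *)

Lemma eq_measure_ae {d} {T : measurableType d} {R : realType} (P : {measure set T -> \bar R})
    (A B : set T) : measurable A -> measurable B ->
  {ae P, forall w, A w <-> B w} -> P A = P B.
Proof.
have le A' B' : measurable A' -> measurable B' -> {ae P, forall w, A' w <-> B' w} ->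
    (P A' <= P B')%E.
  move=> mA mB [N [mN N0 AB]].
  rewrite -[leRHS]adde0 -N0; apply: le_trans (measureU2 _ mB mN).
  apply: le_measure; rewrite ?inE//; first exact: measurableU.
  move=> w Aw; have [Bw|nB] := pselect (B' w); first by left.
  by right; apply: AB => -[/(_ Aw)].
move=> mA mB AB; apply/eqP; rewrite eq_le !le//.
by apply: filterS AB => w [].
Qed.

Section solution_law.
Context {d : measure_display} {T : measurableType d} {R : realType}.
Variables (P : probability T R) (xi : {RV P >-> R}) (B X : R -> {RV P >-> R}).
Variables (theta c : R) (A f V : R -> R).
Hypotheses (c0 : 0 < c) (A_cont : {within `[0, +oo[, continuous A}).
Hypotheses (f0 : f 0 = 1) (V0 : V 0 = 0) (f_gt0 : forall s, 0 < f s).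
Hypothesis f_derive : forall s : R, 0 <= s ->
  is_derive s 1 f ((theta - A (Num.max 0 s)) * f s).
Hypothesis V_derive : forall s : R, 0 <= s -> is_derive s 1 V (f s ^+ 2).
Hypothesis B_bm : standard_brownian_motion B.
Hypothesis xi_B : independent_of_process xi B.
Hypothesis X_sol : strong_solution (fun t x => - (theta - A t) * x) c xi B X.
Notation gamma := (@normal_law R 0 1).

Lemma variance_gt0 (t : R) : 0 < t -> 0 < V t.
Proof.
move=> t0; have [|s _] := @mean_value _ V (fun s => f s ^+ 2) 0 t t0.
  by move=> s /andP[/V_derive].
by rewrite V0 !subr0 => ->; rewrite mulr_gt0// exprn_gt0.
Qed.

Let Z_ (t : R) (N : nat) (w : T) : R :=
  let t_ i := i%:R * grid_step t N in
  increment_sum B t_ (f \o t_) N.+1 w / Num.sqrt (increment_sum_var t_ (f \o t_) N.+1).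
(** Defined from [X t] and [xi] at every w, so the representation of [X t] in [solution_noise] holds
    everywhere; only the convergence of [Z_] to it is almost sure. *)
Let Z (t : R) (w : T) : R := (f t * X t w - xi w) / (c * Num.sqrt (V t)).

Let Z_cvg (t : R) : 0 < t -> {ae P, forall w, Z_ t n w @[n --> \oo] --> Z t w}.
Proof.
move=> t0; have [_ Xc X0 Xeq] := X_sol.
apply: filterS3 Xc X0 Xeq => w Xc X0 Xeq.
have gc : continuous (fun s : R => theta - A (Num.max 0 s)).
  by move=> s; apply: cvgB; [exact: cvg_cst|exact: continuous_max0].
have xc : continuous (fun s : R => X (Num.max 0 s) w).
  exact: (@continuous_max0 _ (fun s => X s w)).
have n1 : (-1 : R) < 0 by rewrite oppr_lt0.
have gxc (s : R) : -1 <= s ->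
    {for s, continuous (fun s : R => (theta - A (Num.max 0 s)) * X (Num.max 0 s) w)}.
  by move=> _; apply: cvgM; [exact: gc|exact: xc].
have [Q [Q0 Qd QE]] := continuous_primitive n1 gxc.
have fc (s : R) : 0 <= s -> {for s, continuous f}.
  by move=> /f_derive /is_derive_continuous.
have xE (s : R) : 0 <= s <= t ->
    X (Num.max 0 s) w = xi w - Q s + c * (B s w - B 0 w).
  move=> /andP[s0 _]; rewrite max_r//; have [_ ->] := Xeq s s0.
  congr (_ + _ + _); rewrite -QE// -mulN1r -RintegralZl//; last first.
    apply: continuous_compact_integrable; first exact: segment_compact.
    apply/subspace_continuousP => u _; apply: cvg_within_filter.
    by apply: cvgM; [exact: gc|exact: xc].
  apply: eq_Rintegral => u; rewrite inE/= in_itv/= => /andP[u0 _].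
  by rewrite max_r// mulN1r mulNr.
have lim1 := @variation_of_constants R (fun s : R => theta - A (Num.max 0 s)) f
  (fun s : R => X (Num.max 0 s) w) Q (fun s => B s w) (xi w) c t t0 f0
  (fun s _ => gc s) (fun s _ => xc s) f_derive
  (fun s s0 => Qd s (lt_le_trans n1 s0)) Q0 xE.
rewrite /= max_r ?(ltW t0)// in lim1.
have f2c (s : R) : 0 <= s <= t -> {for s, continuous (fun s => f s ^+ 2)}.
  by move=> /andP[/fc fs _]; exact: (cvgM fs fs).
have lim2 := riemann_sum_cvg t0 f2c (fun s st => V_derive (andP st).1).
rewrite V0 subr0 in lim2.
have Vt := variance_gt0 t0.
(* Numerator and denominator are both multiplied by c to match the sums in [lim1]. *)
have -> : Z_ t ^~ w = (fun n =>
   (\sum_(i < n.+1) f (i%:R * grid_step t n) * (c *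
     (B (i.+1%:R * grid_step t n) w - B (i%:R * grid_step t n) w))) *
   (c * Num.sqrt (\sum_(i < n.+1) f (i%:R * grid_step t n) ^+ 2 *
     (i.+1%:R * grid_step t n - i%:R * grid_step t n)))^-1).
  apply/funext => n; rewrite /Z_ /increment_sum /increment_sum_var /increment /=.
  under [in RHS]eq_bigr do rewrite mulrCA.
  by rewrite -mulr_sumr invfM mulrACA divff ?mul1r// gt_eqF.
apply: cvgM => //; apply: cvgV; first by rewrite mulf_neq0 ?gt_eqF ?sqrtr_gt0.
apply: cvgM; first exact: cvg_cst.
by apply: continuous_cvg => //; exact: sqrt_continuous.
Qed.

Lemma solution_noise (t : R) : 0 < t -> exists2 Z : {RV P >-> R},
  forall w, X t w = (f t)^-1 * (xi w + c * Num.sqrt (V t) * Z w) &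
  forall E F, measurable E -> measurable F ->
    P (xi @^-1` E `&` Z @^-1` F) = (P (xi @^-1` E) * gamma F)%E.
Proof.
move=> t0.
have mZ_ n : measurable_fun setT (Z_ t n).
  by apply: measurable_funM => //; exact: measurable_increment_sum.
have mZ : measurable_fun setT (Z t).
  by apply: measurable_funM => //; apply: measurable_funB => //; exact: measurable_funM.
pose Zm_ n : {mfun T >-> R} := HB.pack (Z_ t n) (isMeasurableFun.Build _ _ _ _ _ (mZ_ n)).
pose Zm : {mfun T >-> R} := HB.pack (Z t) (isMeasurableFun.Build _ _ _ _ _ mZ).
exists Zm.
  move=> w; have k0 : c * Num.sqrt (V t) != 0.
    by rewrite mulf_neq0 ?gt_eqF// sqrtr_gt0 variance_gt0.
  have -> : Zm w = Z t w by [].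
  rewrite /Z [_ / _]mulrC mulVKf// [xi w + _]addrC subrK mulKf//.
  by rewrite gt_eqF.
move=> E F mE mF.
have mxE : measurable (xi @^-1` E).
  by rewrite -[X in measurable X]setTI; exact: measurable_funP.
apply: (@limit_law _ _ _ P _ mxE gamma Zm_ Zm _ (Z_cvg t0) F mF) => n F' mF'.
apply: normalised_increment_sum_law => //.
- by rewrite mul0r.
- by move=> i j ij; rewrite ltr_pM2r ?ltr_nat// divr_gt0.
- by move=> i; exact: f_gt0.
Qed.

End solution_law.

Section gaussian_pair_law.
Context {d : measure_display} {T : measurableType d} {R : realType}.
Variables (P : probability T R) (xi Z Y0 Yt : {RV P >-> R}) (a b m s : R).
Hypotheses (b0 : 0 < b) (m0 : 0 < m) (s0 : 0 < s).
Notation gamma := (@normal_law R 0 1).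
Hypothesis xi_normal : is_normal xi a b.
Hypothesis xi_Z : forall E F, measurable E -> measurable F ->
  P (xi @^-1` E `&` Z @^-1` F) = (P (xi @^-1` E) * gamma F)%E.
Hypothesis Y0E : {ae P, forall w, Y0 w = xi w}.
Hypothesis YtE : forall w, Yt w = m * xi w + s * Z w.

Let pre {d1} {S1 : measurableType d1} {d2} {S2 : measurableType d2} (g : S1 -> S2) E :
  measurable_fun setT g -> measurable E -> measurable (g @^-1` E).
Proof. by move=> mg mE; rewrite -[X in measurable X]setTI; exact: mg. Qed.

Let xi_law E : measurable E ->
  P (xi @^-1` E) = gamma ((fun x : R => a + b * x) @^-1` E).
Proof.
move=> mE; transitivity (normal_law a b E); last exact: normal_law_affine.
exact: (xi_normal mE).
Qed.

Let xi_Z_law E : measurable E -> P ((fun w => (xi w, Z w)) @^-1` E) =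
  gauss2 ((fun p : R * R => (a + b * p.1, p.2)) @^-1` E).
Proof.
move=> mE.
have mphi : measurable_fun setT (fun w => (xi w, Z w)) by exact: measurable_fun_pair.
have mpsi : measurable_fun setT (fun p : R * R => (a + b * p.1, p.2)).
  apply: measurable_fun_pair => //; apply: measurable_funD => //.
  exact: measurable_funM.
have [m1 m1E] := restr_image_measure P measurableT mphi.
have [m2 m2E] := restr_image_measure gauss2 measurableT mpsi.
rewrite -[X in P X]setTI -[X in gauss2 X]setTI -m1E -m2E.
apply: eq_finite_measure_prod mE.
  by rewrite m1E preimage_setT setIT [X in (X < _)%E](@probability_setT _ _ _ P) ltry.
move=> C F mC mF; rewrite m1E m2E !setTI.
transitivity (gamma ((fun x : R => (a + b * x)%R) @^-1` C) * gamma F)%E.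
  by rewrite -xi_law//; exact: xi_Z.
have mC' : measurable ((fun x : R => a + b * x) @^-1` C).
  by apply: pre => //; apply: measurable_funD => //; exact: measurable_funM.
exact/esym/gauss2_rect.
Qed.

Lemma joint_gaussian_law E : measurable E -> joint_law Y0 Yt E =
  gauss2 ((fun p : R * R => (a + b * p.1, m * (a + b * p.1) + s * p.2)) @^-1` E).
Proof.
move=> mE; pose g (p : R * R) := (p.1, m * p.1 + s * p.2).
have mg : measurable_fun setT g.
  by apply: measurable_fun_pair => //; apply: measurable_funD; exact: measurable_funM.
transitivity (P ((fun w => (xi w, Z w)) @^-1` (g @^-1` E))); last first.
  by rewrite xi_Z_law//; exact: pre.
transitivity (P (rv_pair Y0 Yt @^-1` E)); first by [].
apply: (@eq_measure_ae _ _ _ P).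
- by apply: (pre _ mE); exact: measurable_rv_pair.
- apply: (pre _ (pre mg mE)); exact: measurable_fun_pair.
- by apply: filterS Y0E => w Y0w; rewrite /preimage/= /g/= /rv_pair Y0w YtE.
Qed.

(** The law of [Yt] comes from the joint law on strips, where m b x + s y is distributed as tau
    times a standard Gaussian. *)
Lemma product_gaussian_law E : measurable E -> product_law Y0 Yt E =
  gauss2 ((fun p : R * R => (a + b * p.1,
    m * a + Num.sqrt (m ^+ 2 * b ^+ 2 + s ^+ 2) * p.2)) @^-1` E).
Proof.
set tau := Num.sqrt _ => mE.
have mpsi : measurable_fun setT (fun p : R * R => (a + b * p.1, m * a + tau * p.2)).
  by apply: measurable_fun_pair => //; apply: measurable_funD => //; exact: measurable_funM.
have [m2 m2E] := restr_image_measure gauss2 measurableT mpsi.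
rewrite -[X in gauss2 X]setTI -m2E.
apply: eq_finite_measure_prod mE.
  by rewrite [X in (X < _)%E](@probability_setT _ _ _ (product_law Y0 Yt)) ltry.
move=> C F mC mF; rewrite m2E setTI.
have mC' : measurable ((fun x : R => a + b * x) @^-1` C).
  by apply: pre => //; apply: measurable_funD => //; exact: measurable_funM.
have mF' : measurable ((fun x : R => m * a + tau * x) @^-1` F).
  by apply: pre => //; apply: measurable_funD => //; exact: measurable_funM.
transitivity (gamma ((fun x : R => (a + b * x)%R) @^-1` C) *
  gamma ((fun x : R => (m * a + tau * x)%R) @^-1` F))%E; last exact/esym/gauss2_rect.
transitivity (P (Y0 @^-1` C) * P (Yt @^-1` F))%E; first exact: product_measure1E.
congr (_ * _)%E.
  rewrite -xi_law//; apply: (@eq_measure_ae _ _ _ P); [exact: pre|exact: pre|].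
  by apply: filterS Y0E => w Y0w; rewrite /preimage/= Y0w.
have := @joint_gaussian_law (setT `*` F) (measurableX measurableT mF).
have -> : joint_law Y0 Yt (setT `*` F) = P (Yt @^-1` F).
  by congr (P _); apply/seteqP; split => w //= [].
move=> ->.
have mF2 : measurable ((fun x : R => m * a + x) @^-1` F).
  by apply: pre => //; exact: measurable_funD.
have sE : tau = Num.sqrt ((m * b) ^+ 2 + s ^+ 2) by rewrite /tau exprMn.
have := normal_comb_law (m * b) s0 mF2; rewrite -sE => <-.
congr (gauss2 _); apply/seteqP; split => p /=; rewrite mulrDr !mulrA !addrA//.
by move=> [].
Qed.

End gaussian_pair_law.

(** * Asymptotics *)

(** Along any sequence of times tending to infinity, dominated convergence applies to the
    truncations of [A], with bound the absolute value of [A]. *)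
Lemma Rintegral_itvy_cvg {R : realType} (A : R -> R) : {within `[0, +oo[, continuous A} ->
  (\int[lebesgue_measure]_(t in `[0%R, +oo[) `|A t|%:E < +oo)%E ->
  \int[lebesgue_measure]_(s in `[0, t]) A s @[t --> +oo] -->
  \int[lebesgue_measure]_(s in `[0, +oo[) A s.
Proof.
move=> Ac Ai.
have mA : measurable_fun (`[0, +oo[%classic : set R) A.
  by apply: subspace_continuous_measurable_fun => //; exact: measurable_itv.
have iA : (@lebesgue_measure R).-integrable `[0, +oo[ (EFin \o A).
  by apply/integrableP; split; [exact/measurable_EFinP|exact: Ai].
apply/cvg_pinftyP => u uy.
pose f_ n := (EFin \o A) \_ `[0, u n].
have sub (t : R) : (`[0, t]%classic : set R) `<=` `[0%R, +oo[%classic by apply: subset_itvl.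
have fE n : (\int[lebesgue_measure]_(s in `[0%R, u n]) (A s)%:E =
    \int[lebesgue_measure]_(s in `[0%R, +oo[) f_ n s)%E.
  rewrite /f_ -integral_mkcondr setIidr//.
have [|||||_ _] := @dominated_convergence _ _ R (@lebesgue_measure R) `[0, +oo[%classic
  (measurable_itv _) f_ (EFin \o A) (fun t => `|A t|%:E).
- move=> n; apply/measurable_restrict => //.
  by apply/measurable_EFinP; apply: measurable_funS mA.
- exact/measurable_EFinP.
- apply/aeW => s; rewrite /= in_itv/= andbT => s0.
  apply: (@cvg_near_cst _ _ _ _ _ _); near=> n.
  rewrite /f_ patchE mem_set// /= in_itv/= s0/=.
  by near: n; move/cvgryPge : uy; exact.
- exact: integrable_norm.
- apply/aeW => s n _; rewrite /f_ patchE; case: ifP => _; first by [].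
  by rewrite abse0 lee_fin.
have iAf : (\int[lebesgue_measure]_(s in `[0%R, +oo[) (EFin \o A) s)%E \is a fin_num.
  by apply: integrable_fin_num => //; exact: measurable_itv.
rewrite -(fineK iAf) => /fine_cvg; apply: cvg_trans.
by apply: near_eq_cvg; near=> n; rewrite /= /Rintegral fE.
Unshelve. all: by end_near. Qed.

Section growth_asymptotics.
Context {R : realType}.
Variables (theta : R) (A f V : R -> R).
Hypothesis theta0 : 0 < theta.
Hypotheses (A_cont : {within `[0, +oo[, continuous A}) (A_cvg0 : A t @[t --> +oo] --> 0).
Hypothesis A_int : (\int[lebesgue_measure]_(t in `[0%R, +oo[) `|A t|%:E < +oo)%E.
Hypothesis f_gt0 : forall s, 0 < f s.
Hypothesis f_derive : forall s : R, 0 <= s ->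
  is_derive s 1 f ((theta - A (Num.max 0 s)) * f s).
Hypothesis V_derive : forall s : R, 0 <= s -> is_derive s 1 V (f s ^+ 2).
Hypothesis fE : forall t : R, 0 <= t ->
  f t = expR (theta * t - \int[lebesgue_measure]_(s in `[0, t]) A s).

(** For t >= 0 the product is the exponential of the integral of [A] over [0, t]; the limit is the
    inverse of alpha. *)
Lemma growth_factor_cvg : (f t)^-1 * expR (theta * t) @[t --> +oo] -->
  (expR (- \int[lebesgue_measure]_(s in `[0, +oo[) A s))^-1.
Proof.
rewrite -expRN opprK.
have H : expR (\int[lebesgue_measure]_(s in `[0, t]) A s) @[t --> +oo] -->
    expR (\int[lebesgue_measure]_(s in `[0, +oo[) A s).
  by apply: continuous_cvg; [exact: continuous_expR|exact: Rintegral_itvy_cvg].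
apply: cvg_trans H; apply: near_eq_cvg; near=> t.
rewrite fE; last by near: t; exact: nbhs_pinfty_ge.
by rewrite -expRN -expRD opprB subrK.
Unshelve. all: by end_near. Qed.

Lemma growth_factor_inv_cvg0 : (f t)^-1 @[t --> +oo] --> 0.
Proof.
have H : (f t)^-1 * expR (theta * t) * expR (- (theta * t)) @[t --> +oo] --> (0 : R).
  rewrite -[X in _ --> X](mulr0 (expR (- \int[lebesgue_measure]_(s in `[0, +oo[) A s))^-1).
  apply: cvgM; first exact: growth_factor_cvg.
  apply: (@cvg_comp _ _ _ (fun t => theta * t) (fun t => expR (- t)) _ +oo).
    by apply: gt0_cvgMry => //; exact: cvg_id.
  exact: cvgr_expR.
apply: cvg_trans H; apply: near_eq_cvg; near=> t.
by rewrite -mulrA -expRD subrr expR0 mulr1.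
Unshelve. all: by end_near. Qed.

(** A form of l'Hospital's rule: the quotient of the derivatives is 1 / (2 (theta - A)), and the
    constants left by integrating differential inequalities vanish after division by f^2, which
    tends to infinity. *)
Lemma variance_ratio_cvg : V t / f t ^+ 2 @[t --> +oo] --> (2 * theta)^-1.
Proof.
suff H : 2 * theta * (V t / f t ^+ 2) @[t --> +oo] --> (1 : R).
  have th0 : 2 * theta != 0 by rewrite mulf_neq0// gt_eqF.
  rewrite -[X in _ --> X]mulr1.
  apply: (@cvg_trans _ ((2 * theta)^-1 * (2 * theta * (V t / f t ^+ 2)) @[t --> +oo])).
    apply: near_eq_cvg; near=> t.
    by rewrite mulKf.
  by apply: cvgM; [exact: cvg_cst|exact: H].
apply/cvgrPdist_le => eta eta0.
(* k <= 1/2 gives the a priori bound theta V / f^2 <= 2; then k <= eta / 8 keeps 2 k theta V / f^2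
   below eta / 2. The other half of eta is left for C / f^2. *)
pose k := Num.min (2^-1) (eta / 8); pose eps := k * theta.
have k0 : 0 < k by rewrite lt_min invr_gt0 ltr0n divr_gt0.
have k2 : k <= 2^-1 by rewrite ge_min lexx.
have k8 : k <= eta / 8 by rewrite ge_min lexx orbT.
have eps0 : 0 < eps by rewrite mulr_gt0.
have [T [Treal TA]] : \forall t \near +oo, `|A t| <= eps.
  by move/cvgrPdist_le : A_cvg0 => /(_ _ eps0); apply: filterS => t; rewrite sub0r normrN.
pose T0 := Num.max 0 T + 1.
have T00 : 0 <= T0 by rewrite addr_ge0// le_max lexx.
have TT0 : T < T0 by rewrite ltr_pwDr// le_max lexx orbT.
have Ab (s : R) : T0 <= s -> `|A (Num.max 0 s)| <= eps.
  move=> Ts; rewrite max_r ?(le_trans T00)//; apply: TA.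
  exact: lt_le_trans Ts.
have f2d (s : R) : T0 <= s ->
    is_derive s 1 (fun u => f u ^+ 2) (2 * (theta - A (Num.max 0 s)) * f s ^+ 2).
  move=> Ts; have d := f_derive (le_trans T00 Ts).
  have := is_deriveM d d; rewrite /GRing.scale/=.
  suff -> : f s * ((theta - A (Num.max 0 s)) * f s) + f s * ((theta - A (Num.max 0 s)) * f s)
    = 2 * (theta - A (Num.max 0 s)) * f s ^+ 2 by [].
  ring.
have Vd (s : R) : T0 <= s -> is_derive s 1 V (f s ^+ 2).
  by move=> Ts; apply: V_derive; exact: le_trans Ts.
(* V' = f^2 and (f^2)' = 2 (theta - A) f^2, so both combinations below eventually
   decrease. *)
pose D1 s := 2 * (theta - eps) * V s - f s ^+ 2.
pose D2 s := f s ^+ 2 - 2 * (theta + eps) * V s.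
have D1le (s : R) : T0 <= s -> D1 s <= D1 T0.
  apply: (@derive_nincr _ D1 (fun s => 2 * (theta - eps) * f s ^+ 2
      - 2 * (theta - A (Num.max 0 s)) * f s ^+ 2)) => {}s Ts.
    exact: (is_deriveB (is_deriveZ _ (Vd s Ts)) (f2d s Ts)).
  rewrite -mulrBl mulr_le0_ge0 ?sqr_ge0//.
  by have := Ab s Ts; rewrite ler_norml => /andP[]; lra.
have D2le (s : R) : T0 <= s -> D2 s <= D2 T0.
  apply: (@derive_nincr _ D2 (fun s => 2 * (theta - A (Num.max 0 s)) * f s ^+ 2 -
      2 * (theta + eps) * f s ^+ 2)) => {}s Ts.
    exact: (is_deriveB (f2d s Ts) (is_deriveZ _ (Vd s Ts))).
  rewrite -mulrBl mulr_le0_ge0 ?sqr_ge0//.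
  by have := Ab s Ts; rewrite ler_norml => /andP[]; lra.
pose C := `|D1 T0| + `|D2 T0|.
have C1 : D1 T0 <= C by rewrite (le_trans (ler_norm _))// lerDl.
have C2 : D2 T0 <= C by rewrite (le_trans (ler_norm _))// lerDr.
have Cf : C * (f t)^-1 ^+ 2 @[t --> +oo] --> (0 : R).
  rewrite -[X in _ --> X](mulr0 C) -[X in C * X](mulr0 0).
  apply: cvgM; first exact: cvg_cst.
  by apply: (cvgM growth_factor_inv_cvg0 growth_factor_inv_cvg0).
near=> t.
have Tt : T0 <= t by near: t; apply: nbhs_pinfty_ge; exact: num_real.
have : `|0 - C * (f t)^-1 ^+ 2| <= Num.min 1 (eta / 2).
  near: t; move/cvgrPdist_le : Cf; apply.
  by rewrite lt_min ltr01 divr_gt0.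
rewrite sub0r normrN le_min => /andP[/(le_trans (ler_norm _)) c1 /(le_trans (ler_norm _)) c2].
have F0 : 0 < (f t)^-1 ^+ 2 by rewrite exprn_gt0// invr_gt0.
have E1 := le_trans (D1le t Tt) C1.
have E2 := le_trans (D2le t Tt) C2.
have fF : f t ^+ 2 * (f t)^-1 ^+ 2 = 1 by rewrite -exprMn divff ?expr1n// gt_eqF.
pose v := V t * (f t)^-1 ^+ 2; pose cc := C * (f t)^-1 ^+ 2.
have -> : V t / f t ^+ 2 = v by rewrite /v exprVn.
have {}E1 : 2 * (theta - k * theta) * v - 1 <= cc.
  have -> : 2 * (theta - k * theta) * v - 1 = D1 t * (f t)^-1 ^+ 2.
    by rewrite /D1 mulrBl fF /v mulrA.
  by rewrite /cc ler_pM2r.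
have {}E2 : 1 - 2 * (theta + k * theta) * v <= cc.
  have -> : 1 - 2 * (theta + k * theta) * v = D2 t * (f t)^-1 ^+ 2.
    by rewrite /D2 mulrBl fF /v mulrA.
  by rewrite /cc ler_pM2r.
rewrite -/cc in c1 c2.
have v2 : theta * v <= 2.
  rewrite leNgt; apply/negP => v2.
  have : 0 <= (2^-1 - k) * (theta * v).
    by rewrite mulr_ge0 ?subr_ge0// ltW// (lt_trans _ v2).
  lra.
have kv : k * (theta * v) <= eta / 4.
  have : 0 <= k * (2 - theta * v) by rewrite mulr_ge0 ?subr_ge0// ltW.
  lra.
by rewrite ler_norml; apply/andP; split; lra.
Unshelve. all: by end_near. Qed.

End growth_asymptotics.

(** The two laws as a predicate in the parameters, so that it can be required for [e] near 0
    only. *)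
Definition gaussian_pair {R : realType} (a b m s : R)
    (J I : probability (R * R)%type R) :=
  (forall E, measurable E -> J E =
    gauss2 ((fun p : R * R => (a + b * p.1, m * (a + b * p.1) + s * p.2)) @^-1` E)) /\
  (forall E, measurable E -> I E =
    gauss2 ((fun p : R * R => (a + b * p.1,
      m * a + Num.sqrt (m ^+ 2 * b ^+ 2 + s ^+ 2) * p.2)) @^-1` E)).

(** * Limits of the three distances for small noise *)

Section small_noise_limit.
Context {R : realType}.
(* M and S are the slope m and the noise s of the pair, divided by e. *)
Variables (J I : R -> probability (R * R)%type R) (M S : R -> R) (a b kappa vs : R).
Hypotheses (b0 : 0 < b) (kappa0 : 0 < kappa) (vs0 : 0 < vs).
Hypotheses (M_cvg : M e @[e --> 0^'+] --> kappa) (S_cvg : S e @[e --> 0^'+] --> vs).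
Hypothesis JI : \forall e \near 0^'+, gaussian_pair a b (e * M e) (e * S e) (J e) (I e).

Let sd (m s : R) := Num.sqrt (m ^+ 2 * b ^+ 2 + s ^+ 2).

(** This homogeneity cancels [e] in the correlation and pulls one factor [e] out of the Wasserstein
    bounds. *)
Let sd_scale (e m s : R) : 0 < e -> sd (e * m) (e * s) = e * sd m s.
Proof.
move=> e0; rewrite /sd !exprMn -mulrA -mulrDr sqrtrM ?sqr_ge0//.
by rewrite sqrtr_sqr gtr0_norm.
Qed.

Let sd0 : 0 < sd kappa vs.
Proof.
rewrite sqrtr_gt0; apply: ltr_wpDl; last exact: exprn_gt0.
by rewrite mulr_ge0 ?sqr_ge0.
Qed.

Let cvg_sqr (g : R -> R) (l : R) : g e @[e --> 0^'+] --> l ->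
  g e ^+ 2 @[e --> 0^'+] --> l ^+ 2.
Proof. by move=> gl; exact: (cvgM gl gl). Qed.

Let sd_cvg : sd (M e) (S e) @[e --> 0^'+] --> sd kappa vs.
Proof.
apply: continuous_cvg; first exact: sqrt_continuous.
by apply: cvgD; [apply: cvgM; [exact: cvg_sqr|exact: cvg_cst]|exact: cvg_sqr].
Qed.

Let corr_cvg : e * M e * b / sd (e * M e) (e * S e) @[e --> 0^'+] -->
  kappa * b / sd kappa vs.
Proof.
have H : M e * b / sd (M e) (S e) @[e --> 0^'+] --> kappa * b / sd kappa vs.
  by apply: cvgM; [apply: cvgM => //; exact: cvg_cst|apply: cvgV => //; rewrite gt_eqF].
apply: cvg_trans H; apply: near_eq_cvg; near=> e.
have e0 : 0 < e by near: e; exact: nbhs_right_gt.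
by rewrite sd_scale// -[e * M e * b]mulrA -mulf_div divff ?mul1r// gt_eqF.
Unshelve. all: by end_near. Qed.

Let corr_limE : 1 - (kappa * b / sd kappa vs) ^+ 2 = vs ^+ 2 / sd kappa vs ^+ 2.
Proof.
have s0 : sd kappa vs ^+ 2 != 0 by rewrite expf_neq0// gt_eqF.
have sE : sd kappa vs ^+ 2 = (kappa * b) ^+ 2 + vs ^+ 2.
  have h : 0 <= kappa ^+ 2 * b ^+ 2 + vs ^+ 2.
    by apply: addr_ge0; [apply: mulr_ge0|]; exact: sqr_ge0.
  by rewrite /sd (sqr_sqrtr h) exprMn.
rewrite expr_div_n; apply: (mulIf s0); rewrite mulrBl mul1r !divfK// sE.
by rewrite addrC addKr.
Qed.

Let corr_lim_lt1 : (kappa * b / sd kappa vs) ^+ 2 < 1.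
Proof. by rewrite -subr_gt0 corr_limE divr_gt0 ?exprn_gt0. Qed.

Lemma kl_div_small_noise : kl_div (J e) (I e) @[e --> 0^'+] -->
  (- (2^-1 * ln (1 - (kappa * b / sd kappa vs) ^+ 2)))%:E.
Proof.
have H : (- (2^-1 * ln (1 - (e * M e * b / sd (e * M e) (e * S e)) ^+ 2)))%:E
    @[e --> 0^'+] --> (- (2^-1 * ln (1 - (kappa * b / sd kappa vs) ^+ 2)))%:E.
  apply: cvg_EFin; first exact: nearW.
  apply: cvgN; apply: cvgM; first exact: cvg_cst.
  apply: continuous_cvg; first by apply: continuous_ln; rewrite subr_gt0.
  by apply: cvgB; [exact: cvg_cst|exact: cvg_sqr].
apply: cvg_trans H; apply: near_eq_cvg; near=> e.
have e0 : 0 < e by near: e; exact: nbhs_right_gt.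
have Se : 0 < e * S e by rewrite mulr_gt0//; near: e; exact: (cvgr_gt _ S_cvg).
have [JE IE] : gaussian_pair a b (e * M e) (e * S e) (J e) (I e) by near: e.
by rewrite (kl_div_pair b0 Se JE IE).
Unshelve. all: by end_near. Qed.

Lemma tv_dist_small_noise : tv_dist (J e) (I e) @[e --> 0^'+] -->
  tv_dist (centred_gaussian2 (corr_mx (kappa * b / sd kappa vs)))
          (centred_gaussian2 (1%:M : 'M[R]_2)).
Proof.
have H : (1 - corr_overlap (e * M e * b / sd (e * M e) (e * S e)))%E
    @[e --> 0^'+] --> (1 - corr_overlap (kappa * b / sd kappa vs))%E.
  apply: cvgeB; first by rewrite fin_num_adde_defr// corr_overlap_fin.
    exact: cvg_cst.
  exact: (cvg_comp _ _ corr_cvg (corr_overlap_continuous corr_lim_lt1)).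
rewrite tv_corr//; apply: cvg_trans H; apply: near_eq_cvg; near=> e.
have e0 : 0 < e by near: e; exact: nbhs_right_gt.
have Se : 0 < e * S e by rewrite mulr_gt0//; near: e; exact: (cvgr_gt _ S_cvg).
have [JE IE] : gaussian_pair a b (e * M e) (e * S e) (J e) (I e) by near: e.
rewrite (tv_dist_pair b0 Se JE IE) tv_corr//.
near: e; apply: (cvgr_lt _ (cvg_sqr corr_cvg)); exact: corr_lim_lt1.
Unshelve. all: by end_near. Qed.

Lemma wasserstein2_small_noise : (wasserstein2 (J e) (I e) * e^-1%:E)%E @[e --> 0^'+] -->
  (Num.sqrt (2 * sd kappa vs ^+ 2 - 2 * sd kappa vs * vs))%:E.
Proof.
pose L e := 2 * sd (M e) (S e) ^+ 2 - 2 * sd (M e) (S e) * S e.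
have L_cvg : L e @[e --> 0^'+] --> 2 * sd kappa vs ^+ 2 - 2 * sd kappa vs * vs.
  apply: cvgB; first by apply: cvgM; [exact: cvg_cst|exact: cvg_sqr].
  by apply: cvgM => //; apply: cvgM => //; exact: cvg_cst.
(* The gap m^2 tau^2 between the squared bounds carries e^4; division of the distance by e leaves
   e^2 of it. *)
have Q_cvg : e ^+ 2 * M e ^+ 2 * sd (M e) (S e) ^+ 2 @[e --> 0^'+] --> (0 : R).
  rewrite -[X in _ --> X](mul0r (sd kappa vs ^+ 2)).
  apply: cvgM; last exact: cvg_sqr.
  rewrite -[X in _ --> X](mul0r (kappa ^+ 2)) -[X in X * _](mul0r 0).
  apply: cvgM; last exact: cvg_sqr.
  by apply: cvg_sqr; apply: cvg_at_right_filter; exact: cvg_id.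
apply: (@squeeze_cvge _ _ _ _
  (fun e => (Num.sqrt (L e - e ^+ 2 * M e ^+ 2 * sd (M e) (S e) ^+ 2))%:E) _
  (fun e => (Num.sqrt (L e))%:E)); last 2 first.
- apply: cvg_EFin; first exact: nearW.
  apply: continuous_cvg; first exact: sqrt_continuous.
  by rewrite -[X in _ --> X]subr0; exact: cvgB.
- apply: cvg_EFin; first exact: nearW.
  by apply: continuous_cvg => //; exact: sqrt_continuous.
near=> e.
have e0 : 0 < e by near: e; exact: nbhs_right_gt.
have Se : 0 < e * S e by rewrite mulr_gt0//; near: e; exact: (cvgr_gt _ S_cvg).
have Me : 0 < e * M e by rewrite mulr_gt0//; near: e; exact: (cvgr_gt _ M_cvg).
have [JE IE] : gaussian_pair a b (e * M e) (e * S e) (J e) (I e) by near: e.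
have scale x : Num.sqrt (e ^+ 2 * x) * e^-1 = Num.sqrt x.
  by rewrite sqrtrM ?sqr_ge0// sqrtr_sqr gtr0_norm// mulrAC divff ?mul1r// gt_eqF.
have := wasserstein2_pair_le b0 Me Se JE IE.
have := wasserstein2_pair_ge Me Se JE IE.
rewrite -/(sd (e * M e) (e * S e)) sd_scale// => lo up; apply/andP; split.
  rewrite -[X in X%:E]scale EFinM lee_pmul2r ?lte_fin ?invr_gt0//.
  apply: le_trans lo; rewrite lee_fin; apply: ler_wsqrtr.
  by rewrite le_eqVlt; apply/orP; left; apply/eqP; rewrite /L; ring.
rewrite -[X in (_ <= X%:E)%E]scale EFinM lee_pmul2r ?lte_fin ?invr_gt0//.
apply: (le_trans up); rewrite lee_fin; apply: ler_wsqrtr.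
by rewrite le_eqVlt; apply/orP; left; apply/eqP; rewrite /L; ring.
Unshelve. all: by end_near. Qed.

End small_noise_limit.

(** * Diameters *)

Section diameters.
Context {R : realType}.

Let measurable_point (z : R * R) : measurable [set z].
Proof.
case: z => x y; have -> : [set (x, y)] = [set x] `*` [set y].
  by apply/seteqP; split => [[? ?] [-> ->]|[? ?] /= [-> ->]].
by apply: measurableX; exact: measurable_set1.
Qed.

Let dirac_prob (z : R * R) : probability (R * R)%type R := \d_z.

Let dirac_self (z : R * R) : dirac_prob z [set z] = 1%E.
Proof. by rewrite /dirac_prob/= diracE mem_set. Qed.

Let dirac_other (z z' : R * R) : z <> z' -> dirac_prob z [set z'] = 0%E.
Proof. by move=> zz'; rewrite /dirac_prob/= diracE memNset. Qed.

Let p00 : R * R := (0, 0).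
Let p10 : R * R := (1, 0).
Let p01 : p10 <> p00.
Proof. by case=> /eqP; rewrite oner_eq0. Qed.

(** Of two Dirac masses at distinct points neither dominates the other, so the value is attained. *)
Lemma diameter_kl_div : diameter (fun Q1 Q2 : probability (R * R)%type R => kl_div Q1 Q2) = +oo%E.
Proof.
apply/eqP; rewrite -leye_eq; apply: ereal_sup_ubound.
exists (dirac_prob p00) => //; exists (dirac_prob p10) => //.
rewrite /kl_div; case: pselect => // /null_content_dominatesP /(_ _ (measurable_point p00)).
move=> /(_ (dirac_other p01)) H.
by have := dirac_self p00; rewrite [LHS]H => /esym/eqP; rewrite onee_eq0.
Qed.

Lemma diameter_tv_dist : diameter (fun Q1 Q2 : probability (R * R)%type R => tv_dist Q1 Q2) = 1%E.
Proof.
apply/eqP; rewrite eq_le; apply/andP; split.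
  apply: ub_ereal_sup => _ [P _ [Q _ <-]]; apply: ub_ereal_sup => _ [E mE <-].
  have abs1 (x y : \bar R) : (0 <= x <= 1 -> 0 <= y <= 1 -> `|x - y| <= 1)%E.
    case: x y => [x| |] [y| |]//=; rewrite ?leye_eq ?leNye ?andbF//.
    rewrite !lee_fin => /andP[x0 x1] /andP[y0 y1].
    by rewrite ler_norml; apply/andP; split; lra.
  apply: abs1; apply/andP; split; [exact: measure_ge0| |exact: measure_ge0|].
    exact: (probability_le1 P mE).
  exact: (probability_le1 Q mE).
apply: ereal_sup_ge; exists (tv_dist (dirac_prob p00) (dirac_prob p10)).
  by exists (dirac_prob p00) => //; exists (dirac_prob p10).
apply: ereal_sup_ubound; exists [set p00]; first exact: measurable_point.
transitivity (`|1 - 0| : \bar R)%E; last by rewrite sube0 abse1.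
by congr (`|_ - _|)%E; [exact: dirac_self|exact: (dirac_other p01)].
Qed.

(** Any coupling of two Dirac masses is carried by a single point: the complement is covered by two
    strips, null by the marginal conditions. *)
Let wasserstein2_dirac_ge (K : R) : 0 < K ->
  (K%:E <= wasserstein2 (dirac_prob p00) (dirac_prob (K, 0%R)))%E.
Proof.
move=> K0; apply: le_ereal_inf_tmp => _ [Pi /= cPi <-].
set W := integral _ _ _.
have W0 : (0 <= W)%E by apply: integral_ge0 => q _; rewrite lee_fin sqr_ge0.
suff KW : ((K ^+ 2)%:E <= W)%E.
  have -> : K = Num.sqrt (K ^+ 2) by rewrite sqrtr_sqr gtr0_norm.
  rewrite -(powR12_sqrt (sqr_ge0 K)) -poweR_EFin; apply: gt0_ler_poweR => //.
  - by rewrite in_itv/= lee_fin sqr_ge0 leey.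
  - by rewrite in_itv/= W0 leey.
pose A := [set p00]; pose C := [set ((K, 0) : R * R)].
have mA : measurable A by exact: measurable_point.
have mC : measurable C by exact: measurable_point.
have mE : measurable (A `*` C) by exact: measurableX.
have PiE : Pi (A `*` C) = 1%E.
  have [PA _] := cPi (~` A) (measurableC mA).
  have [_ PC] := cPi (~` C) (measurableC mC).
  have N0 : Pi (~` (A `*` C)) = 0%E.
    apply/eqP; rewrite eq_le measure_ge0 andbT.
    apply: (@le_trans _ _ (Pi ((~` A `*` setT) `|` (setT `*` ~` C)))).
      apply: le_measure; rewrite ?inE.
      - exact: measurableC.
      - by apply: measurableU; apply: measurableX => //; exact: measurableC.
      - move=> [u v] /= nE; have [Au|nA] := pselect (A u); last by left.
        by right; split => // Cv; exact: nE.
    apply: le_trans (measureU2 _ _ _) _; try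
      by apply: measurableX => //; exact: measurableC.
    rewrite [X in (X + _)%E]PA [X in (_ + X)%E]PC.
    rewrite !probability_setC// dirac_self dirac_self subee// adde0.
    exact: lexx.
  have := probability_setC Pi mE; rewrite N0 => /esym/eqP.
  by rewrite sube_eq// add0e => /eqP.
have mf : measurable_fun setT (fun p : (R * R) * (R * R) => euclid_norm (p.1 - p.2) ^+ 2).
  exact: measurable_sqr_dist.
apply: (@le_trans _ _ (\int[Pi]_(p in A `*` C) (K ^+ 2)%:E)%E).
  by rewrite integral_cst// [X in (_ * X)%E]PiE mule1.
apply: (@le_trans _ _ (\int[Pi]_(p in A `*` C) (euclid_norm (p.1 - p.2) ^+ 2)%:E)%E).
  apply: ge0_le_integral => //.
  - by move=> *; rewrite lee_fin sqr_ge0.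
  - by apply/measurable_EFinP; exact: measurable_funS mf.
  - move=> [u v] /= [-> ->]; rewrite lee_fin /euclid_norm/= !sub0r.
    by rewrite oppr0 expr0n addr0 sqr_sqrtr ?sqr_ge0// sqrrN.
apply: ge0_subset_integral => //; first exact/measurable_EFinP.
by move=> *; rewrite lee_fin sqr_ge0.
Qed.

Lemma diameter_wasserstein2 (c : R) : 0 < c ->
  diameter (fun Q1 Q2 : probability (R * R)%type R => (wasserstein2 Q1 Q2 * c%:E)%E) = +oo%E.
Proof.
move=> c0; apply: eq_infty => K.
(* Two points at this distance have scaled distance |K| + 1, beyond K. *)
have K0 : 0 < (`|K| + 1) / c by rewrite divr_gt0// ltr_wpDl.
apply: ereal_sup_ge; eexists.
  by exists (dirac_prob p00) => //; exists (dirac_prob ((`|K| + 1) / c, 0)).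
apply: le_trans (_ : ((`|K| + 1) / c)%:E * c%:E <= _)%E.
  rewrite -EFinM divfK ?gt_eqF// lee_fin (le_trans (ler_norm _))// lerDl.
  exact: ler01.
by rewrite lee_pmul2r ?lte_fin//; exact: wasserstein2_dirac_ge.
Qed.

End diameters.

(** * The limit profiles *)

Section limit_profile.
Context {R : realType} {F : set_system R} {FF : ProperFilter F}.
Variables (b vs : R) (K : R -> R).
Hypotheses (b0 : 0 < b) (vs0 : 0 < vs) (K0 : forall r, 0 < K r).

(** [K r] stands for the limiting slope. The filter [F] is left arbitrary: the limits for [K]
    tending to 0 serve at r -> +oo, those for [K] tending to infinity at r -> -oo. *)
Let sd (k : R) : R := Num.sqrt (k ^+ 2 * b ^+ 2 + vs ^+ 2).

Let sqr_sd k : sd k ^+ 2 = k ^+ 2 * b ^+ 2 + vs ^+ 2.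
Proof.
by rewrite sqr_sqrtr//; apply: addr_ge0; [apply: mulr_ge0|]; exact: sqr_ge0.
Qed.

Let sd_gt0 k : 0 < sd k.
Proof.
rewrite sqrtr_gt0; apply: ltr_wpDl; last exact: exprn_gt0.
by rewrite mulr_ge0 ?sqr_ge0.
Qed.

Let corr_sqrE k : 1 - (k * b / sd k) ^+ 2 = (1 + k ^+ 2 * b ^+ 2 / vs ^+ 2)^-1.
Proof.
have s0 : sd k ^+ 2 != 0 by rewrite expf_neq0// gt_eqF.
have v0 : vs ^+ 2 != 0 by rewrite expf_neq0// gt_eqF.
have -> : 1 + k ^+ 2 * b ^+ 2 / vs ^+ 2 = sd k ^+ 2 / vs ^+ 2.
  by rewrite sqr_sd mulrDl divff// addrC.
rewrite invf_div expr_div_n; apply: (mulIf s0); rewrite mulrBl mul1r !divfK// sqr_sd.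
by rewrite exprMn addrC addKr.
Qed.

Lemma corr_profile_lt1 k : (k * b / sd k) ^+ 2 < 1.
Proof.
rewrite -subr_gt0 corr_sqrE invr_gt0 ltr_pwDl// divr_ge0 ?sqr_ge0//.
by rewrite mulr_ge0 ?sqr_ge0.
Qed.

Lemma kl_profileE k : - (2^-1 * ln (1 - (k * b / sd k) ^+ 2)) =
  2^-1 * ln (1 + k ^+ 2 * b ^+ 2 / vs ^+ 2).
Proof.
rewrite corr_sqrE lnV ?mulrN ?opprK// posrE ltr_pwDl// divr_ge0 ?sqr_ge0//.
by rewrite mulr_ge0 ?sqr_ge0.
Qed.

Let cvg_sqr (g : R -> R) (l : R) : g e @[e --> F] --> l -> g e ^+ 2 @[e --> F] --> l ^+ 2.
Proof. by move=> gl; exact: (cvgM gl gl). Qed.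

Let sd_cvg0 : K r @[r --> F] --> 0 -> sd (K r) @[r --> F] --> vs.
Proof.
move=> Kl; have vE : Num.sqrt (0 ^+ 2 * b ^+ 2 + vs ^+ 2) = vs.
  by rewrite expr0n mul0r add0r sqrtr_sqr gtr0_norm.
rewrite -[X in _ --> X]vE /sd; apply: continuous_cvg; first exact: sqrt_continuous.
by apply: cvgD; [apply: cvgM; [exact: cvg_sqr|exact: cvg_cst]|exact: cvg_cst].
Qed.

Lemma kl_profile_cvg0 : K r @[r --> F] --> 0 ->
  (2^-1 * ln (1 + K r ^+ 2 * b ^+ 2 / vs ^+ 2))%:E @[r --> F] --> 0%E.
Proof.
move=> Kl; apply: cvg_EFin; first exact: nearW.
rewrite -[X in _ --> X](mulr0 2^-1); apply: cvgM; first exact: cvg_cst.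
rewrite -[X in _ --> X](@ln1 R); apply: continuous_cvg; first exact: continuous_ln.
rewrite -[X in _ --> X]addr0; apply: cvgD; first exact: cvg_cst.
rewrite -[X in _ --> X](mul0r (vs ^+ 2)^-1); apply: cvgM; last exact: cvg_cst.
rewrite -[X in _ --> X](mul0r (b ^+ 2)); apply: cvgM; last exact: cvg_cst.
by rewrite -[X in _ --> X](mulr0 0); exact: (cvgM Kl Kl).
Qed.

Lemma kl_profile_cvgy : K r @[r --> F] --> +oo ->
  (2^-1 * ln (1 + K r ^+ 2 * b ^+ 2 / vs ^+ 2))%:E @[r --> F] --> +oo%E.
Proof.
move=> /cvgryPge Kl; apply/cvgeryP/cvgryPge => C; near=> r.
(* The threshold solves K^2 b^2 / vs^2 >= exp (2 C). *)
have KC : expR C * vs / b <= K r by near: r; exact: Kl.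
rewrite mulrC ler_pdivlMr// -[leLHS]expRK ler_ln ?posrE ?expR_gt0//; last first.
  by rewrite ltr_pwDl// divr_ge0 ?sqr_ge0// mulr_ge0 ?sqr_ge0.
apply: (@le_trans _ _ (K r ^+ 2 * b ^+ 2 / vs ^+ 2)); last by rewrite lerDr.
rewrite ler_pdivlMr ?exprn_gt0//.
have -> : expR (C * 2) * vs ^+ 2 = (expR C * vs) ^+ 2.
  by rewrite exprMn expRM_natr.
rewrite -exprMn ler_sqr ?nnegrE ?mulr_ge0 ?expR_ge0 ?(ltW (K0 r)) ?(ltW b0) ?(ltW vs0)//.
by rewrite -ler_pdivrMr.
Unshelve. all: by end_near. Qed.

Lemma wasserstein2_profile_cvg0 : K r @[r --> F] --> 0 ->
  (Num.sqrt (2 * sd (K r) ^+ 2 - 2 * sd (K r) * vs))%:E @[r --> F] --> 0%E.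
Proof.
move=> /sd_cvg0 Kl; apply: cvg_EFin; first exact: nearW.
have vE : Num.sqrt (2 * vs ^+ 2 - 2 * vs * vs) = 0.
  by rewrite -mulrA -expr2 subrr sqrtr0.
rewrite -[X in _ --> X]vE.
apply: continuous_cvg; first exact: sqrt_continuous.
apply: cvgB; first by apply: cvgM; [exact: cvg_cst|exact: cvg_sqr].
by apply: cvgM; [apply: cvgM => //; exact: cvg_cst|exact: cvg_cst].
Qed.

Lemma wasserstein2_profile_cvgy : K r @[r --> F] --> +oo ->
  (Num.sqrt (2 * sd (K r) ^+ 2 - 2 * sd (K r) * vs))%:E @[r --> F] --> +oo%E.
Proof.
move=> /cvgryPge Kl; apply/cvgeryP/cvgryPge => C; near=> r.
have KC : (`|C| + vs) / b <= K r by near: r; exact: Kl.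
have sC : `|C| + vs <= sd (K r).
  rewrite -ler_sqr ?nnegrE ?addr_ge0 ?(ltW vs0) ?(ltW (sd_gt0 _))//.
  apply: (@le_trans _ _ ((K r * b) ^+ 2)).
    rewrite ler_sqr ?nnegrE ?addr_ge0 ?mulr_ge0 ?(ltW (K0 r)) ?(ltW b0) ?(ltW vs0)//.
    by rewrite -ler_pdivrMr.
  by rewrite sqr_sd exprMn lerDl sqr_ge0.
apply: le_trans (ler_norm C) _; rewrite -[leLHS]normr_id -sqrtr_sqr; apply: ler_wsqrtr.
have C0 : 0 <= `|C| by []; have s0 := sd_gt0 (K r).
(* With d = sd (K r), 2 d^2 - 2 d vs = (d - vs)^2 + (d - vs)(d + vs): the first term is at least
   C^2, the second nonnegative. *)
have h1 : 0 <= (sd (K r) - vs - `|C|) * (sd (K r) - vs + `|C|).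
  by apply: mulr_ge0; lra.
have h2 : 0 <= (sd (K r) - vs) * (sd (K r) + vs).
  by rewrite mulr_ge0 ?subr_ge0 ?addr_ge0 ?(ltW s0) ?(ltW vs0)// (le_trans _ sC)// lerDr.
by nra.
Unshelve. all: by end_near. Qed.

Lemma tv_profile_cvg0 : K r @[r --> F] --> 0 ->
  (1 - corr_overlap (K r * b / sd (K r)))%E @[r --> F] --> 0%E.
Proof.
move=> Kl.
have rho : K r * b / sd (K r) @[r --> F] --> 0.
  rewrite -[X in _ --> X](mul0r vs^-1); apply: cvgM; last first.
    by apply: cvgV; [rewrite gt_eqF|exact: sd_cvg0].
  by rewrite -[X in _ --> X](mul0r b); apply: cvgM => //; exact: cvg_cst.
rewrite (_ : 0%E = (1 - @corr_overlap R 0)%E); last by rewrite corr_overlap0 subee.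
apply: cvgeB; first by rewrite fin_num_adde_defr// corr_overlap_fin.
  exact: cvg_cst.
apply: (cvg_comp _ _ rho); apply: corr_overlap_continuous.
by rewrite expr0n ltr01.
Qed.

(** Factoring [K r] out of the standard deviation shows that the correlation tends to 1; being
    always below 1, it does so from the left, where [corr_overlap_at_left1] applies. *)
Lemma tv_profile_cvgy : K r @[r --> F] --> +oo ->
  (1 - corr_overlap (K r * b / sd (K r)))%E @[r --> F] --> 1%E.
Proof.
move=> Kl.
have Kl' : (K r)^-1 @[r --> F] --> 0 by apply/gtr0_cvgV0 => //; exact: nearW.
have rho : K r * b / sd (K r) @[r --> F] --> (1 : R).
  have H : b / Num.sqrt (b ^+ 2 + (K r)^-1 ^+ 2 * vs ^+ 2) @[r --> F] --> b / b.
    apply: cvgM; first exact: cvg_cst.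
    apply: cvgV; first by rewrite gt_eqF.
    have bE : Num.sqrt (b ^+ 2 + 0 ^+ 2 * vs ^+ 2) = b.
      by rewrite expr0n mul0r addr0 sqrtr_sqr gtr0_norm.
    rewrite -[X in _ --> X]bE.
    apply: continuous_cvg; first exact: sqrt_continuous.
    by apply: cvgD; [exact: cvg_cst|apply: cvgM; [exact: cvg_sqr|exact: cvg_cst]].
  rewrite divff ?gt_eqF// in H.
  suff -> : (fun r => K r * b / sd (K r)) =
    (fun r => b / Num.sqrt (b ^+ 2 + (K r)^-1 ^+ 2 * vs ^+ 2)) by [].
  apply/funext => r; have k0 := K0 r.
  have -> : sd (K r) = K r * Num.sqrt (b ^+ 2 + (K r)^-1 ^+ 2 * vs ^+ 2).
    rewrite -[X in X * _](gtr0_norm k0) -sqrtr_sqr -sqrtrM ?sqr_ge0//.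
    have KK : K r ^+ 2 * (K r)^-1 ^+ 2 = 1 by rewrite -exprMn divff ?expr1n// gt_eqF.
    by rewrite mulrDr [X in _ + X]mulrA KK mul1r.
  by rewrite -mulf_div divff ?mul1r// gt_eqF.
have rho1 r : K r * b / sd (K r) < 1.
  rewrite ltr_pdivrMr// mul1r -ltr_sqr ?nnegrE ?(ltW (sd_gt0 _))//; last first.
    by rewrite mulr_ge0 ?(ltW (K0 r)) ?(ltW b0).
  by rewrite sqr_sd exprMn ltrDl exprn_gt0.
have rhol : K r * b / sd (K r) @[r --> F] --> 1^'-.
  move=> U nU; have {}nU : nbhs (1 : R) [set x | x < 1 -> U x] by exact: nU.
  have nF : F [set r | K r * b / sd (K r) < 1 -> U (K r * b / sd (K r))] := rho _ nU.
  change (F [set r | U (K r * b / sd (K r))]).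
  by apply: filterS nF => r /=; apply; exact: rho1.
rewrite -[X in _ --> X]sube0; apply: cvgeB; first by rewrite fin_num_adde_defr.
  exact: cvg_cst.
exact: (cvg_comp _ _ rhol corr_overlap_at_left1).
Qed.

End limit_profile.

(** * The cutoff time and its window *)

Section cutoff_window.
Context {R : realType}.
Variables (theta w : R) (w_ : R -> R).
Hypotheses (theta0 : 0 < theta) (w0 : 0 < w) (w_cvg : w_ e @[e --> 0^'+] --> w).

Lemma cutoff_time_cvgy : `|ln e| / theta @[e --> 0^'+] --> +oo.
Proof.
apply: gt0_cvgMly; first by rewrite invr_gt0.
apply: (@ger_cvgy _ _ _ _ (fun e : R => - ln e)).
  by apply: nearW => e; rewrite -normrN ler_norm.
by apply/cvgNry; exact: lnNy.
Qed.

Let window_bounded : \forall e \near 0^'+, `|w_ e| <= w + 1.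
Proof.
near=> e; have : `|w - w_ e| <= 1.
  by near: e; move/cvgrPdist_le : w_cvg; apply; exact: ltr01.
have := ler_normD (w_ e - w) w; rewrite subrK distrC (gtr0_norm w0) => h1 h2.
by apply: (le_trans h1); rewrite addrC lerD2l.
Unshelve. all: by end_near. Qed.

Lemma cutoff_window_littleo : w_ =o_ (0^'+) (fun e => `|ln e| / theta).
Proof.
apply/eqoP => eps eps0; near=> e.
have : (w + 1) / eps <= `|ln e| / theta.
  by near: e; move/cvgryPge : cutoff_time_cvgy; exact.
rewrite ler_pdivrMr// mulrC => H; apply: (@le_trans _ _ (w + 1)).
  by near: e; exact: window_bounded.
apply: le_trans H _; rewrite ler_pM2l//; exact: ler_norm.
Unshelve. all: by end_near. Qed.

Lemma cutoff_shift_cvgy r : `|ln e| / theta + r * w_ e @[e --> 0^'+] --> +oo.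
Proof.
apply/cvgryPge => C; near=> e.
have H : C + `|r| * (w + 1) <= `|ln e| / theta.
  by near: e; move/cvgryPge : cutoff_time_cvgy; exact.
have W : `|w_ e| <= w + 1 by near: e; exact: window_bounded.
have : - (r * w_ e) <= `|r| * (w + 1).
  by apply: le_trans (ler_norm _) _; rewrite normrN normrM ler_wpM2l.
by move: H; lra.
Unshelve. all: by end_near. Qed.

(** The cutoff time is chosen so that exp (theta t_e) = 1 / e for e < 1. The slope 1 / f is
    asymptotic to exp (- theta t) / alpha, hence at the shifted time to e exp (- theta r w) /
    alpha. *)
Lemma cutoff_scaling (f : R -> R) (alpha r : R) :
  (f t)^-1 * expR (theta * t) @[t --> +oo] --> alpha^-1 ->
  (f (`|ln e| / theta + r * w_ e))^-1 / e @[e --> 0^'+] -->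
  expR (- (theta * r * w)) / alpha.
Proof.
move=> f_cvg.
have H : (f (`|ln e| / theta + r * w_ e))^-1 *
    expR (theta * (`|ln e| / theta + r * w_ e)) * expR (- (theta * r * w_ e))
    @[e --> 0^'+] --> alpha^-1 * expR (- (theta * r * w)).
  apply: cvgM; first exact: (cvg_comp _ _ (cutoff_shift_cvgy r) f_cvg).
  apply: continuous_cvg; first exact: continuous_expR.
  by apply: cvgN; apply: cvgM => //; exact: cvg_cst.
rewrite mulrC; apply: cvg_trans H; apply: near_eq_cvg; near=> e.
have e0 : 0 < e by near: e; exact: nbhs_right_gt.
have e1 : e < 1 by near: e; apply: nbhs_right_lt; exact: ltr01.
rewrite -mulrA -expRD; congr (_ * _).
have -> : theta * (`|ln e| / theta + r * w_ e) - theta * r * w_ e = - ln e.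
  rewrite mulrDr mulrA addrK mulrCA divff ?mulr1 ?gt_eqF//.
  by rewrite ltr0_norm// ln_lt0// e0.
by rewrite expRN lnK.
Unshelve. all: by end_near. Qed.

End cutoff_window.

Lemma expR_profile_cvg0 {R : realType} (c alpha : R) : 0 < c ->
  expR (- (c * r)) / alpha @[r --> +oo] --> 0.
Proof.
move=> c0; rewrite -[X in _ --> X](mul0r alpha^-1); apply: cvgM; last exact: cvg_cst.
apply: (@cvg_comp _ _ _ (fun r => c * r) (fun t => expR (- t)) _ +oo).
  by apply: gt0_cvgMry => //; exact: cvg_id.
exact: cvgr_expR.
Qed.

Lemma expR_profile_cvgy {R : realType} (c alpha : R) : 0 < c -> 0 < alpha ->
  expR (- (c * r)) / alpha @[r --> -oo] --> +oo.
Proof.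
move=> c0 a0; apply: gt0_cvgMly; first by rewrite invr_gt0.
apply/cvgNy_compNP => /=; apply: (@ger_cvgy _ _ _ _ (fun r : R => c * r)).
  apply: nearW => r /=; rewrite mulrN opprK.
  by apply: le_trans (expR_ge1Dx _); rewrite lerDr.
by apply: gt0_cvgMry => //; exact: cvg_id.
Qed.

(** * Profile formulas in terms of the parameters of the equation *)

Section ornstein_uhlenbeck.
Context {R : realType}.
Variables (theta sigma sigma0 alpha w : R).
Hypotheses (theta0 : 0 < theta) (sigma_gt0 : 0 < sigma) (sigma0_gt0 : 0 < sigma0).
Hypothesis alpha0 : 0 < alpha.

(** [kappa] and [vs] are the limits of m / e and s / e; [vs] is the stationary standard deviation of
    the Ornstein-Uhlenbeck process with drift theta and noise sigma. *)
Let kappa r := expR (- (theta * r * w)) / alpha.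
Let vs := sigma * Num.sqrt (2 * theta)^-1.
Let E r := expR (2 * theta * r * w).
Let sd r := Num.sqrt (kappa r ^+ 2 * sigma0 ^+ 2 + vs ^+ 2).

Let sqr_kappa r : kappa r ^+ 2 = (E r * alpha ^+ 2)^-1.
Proof.
rewrite /kappa expr_div_n [RHS]invfM; congr (_ / _).
by rewrite /E -expRN -expRM_natr; congr expR; ring.
Qed.

Let sqr_vs : vs ^+ 2 = sigma ^+ 2 / (2 * theta).
Proof. by rewrite exprMn sqr_sqrtr// invr_ge0 mulr_ge0// ltW. Qed.

Let sqr_sd r : sd r ^+ 2 = kappa r ^+ 2 * sigma0 ^+ 2 + vs ^+ 2.
Proof.
by rewrite sqr_sqrtr//; apply: addr_ge0; [apply: mulr_ge0|]; exact: sqr_ge0.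
Qed.

Let E0 r : E r != 0. Proof. by rewrite gt_eqF// expR_gt0. Qed.

Lemma ou_kl_profile r :
  2^-1 * ln (1 + 2 * theta * sigma0 ^+ 2 / (sigma ^+ 2 * alpha ^+ 2 * E r)) =
  2^-1 * ln (1 + kappa r ^+ 2 * sigma0 ^+ 2 / vs ^+ 2).
Proof.
congr (_ * ln (1 + _)); rewrite sqr_kappa sqr_vs; have e0 := E0 r.
by field; rewrite e0 !gt_eqF.
Qed.

(** The inner radicand is a perfect square, that of sd vs / sigma0^2. *)
Lemma ou_wasserstein2_profile r :
  2 * sigma0 ^+ 2 * (sigma ^+ 2 / (2 * theta * sigma0 ^+ 2)
     + expR (- (2 * theta * r * w)) / alpha ^+ 2
     - Num.sqrt (sigma ^+ 4 / (4 * theta ^+ 2 * sigma0 ^+ 4)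
         + sigma ^+ 2 * expR (- (2 * r * theta * w)) /
           (2 * theta * sigma0 ^+ 2 * alpha ^+ 2))) =
  2 * sd r ^+ 2 - 2 * sd r * vs.
Proof.
have e0 := E0 r.
have -> : expR (- (2 * r * theta * w)) = (E r)^-1.
  by rewrite /E -expRN [2 * r * theta]mulrAC.
have -> : expR (- (2 * theta * r * w)) = (E r)^-1.
  by rewrite /E -expRN.
have vs0 : 0 <= vs by rewrite mulr_ge0 ?sqrtr_ge0// ltW.
have -> : sigma ^+ 4 / (4 * theta ^+ 2 * sigma0 ^+ 4)
         + sigma ^+ 2 * (E r)^-1 / (2 * theta * sigma0 ^+ 2 * alpha ^+ 2) =
    (sd r * vs / sigma0 ^+ 2) ^+ 2.
  rewrite expr_div_n exprMn sqr_sd sqr_kappa sqr_vs.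
  by field; rewrite e0 !gt_eqF.
have p0 : 0 <= sd r * vs / sigma0 ^+ 2.
  by apply: divr_ge0; [apply: mulr_ge0; [exact: sqrtr_ge0|]|exact: sqr_ge0].
rewrite sqrtr_sqr (ger0_norm p0) sqr_sd sqr_kappa sqr_vs.
by field; rewrite e0 !gt_eqF.
Qed.

Lemma ou_correlation r :
  sigma0 * Num.sqrt (2 * theta / (sigma ^+ 2 * alpha ^+ 2 * E r + 2 * theta * sigma0 ^+ 2)) =
  kappa r * sigma0 / sd r.
Proof.
have e0 := E0 r; have e1 : 0 < E r by exact: expR_gt0.
have k0 : 0 <= kappa r by rewrite divr_ge0 ?expR_ge0// ltW.
have D0 : sigma0 ^+ 2 * (2 * theta) + sigma ^+ 2 * (E r * alpha ^+ 2) != 0.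
  by rewrite gt_eqF// addr_gt0// !mulr_gt0// exprn_gt0.
have -> : 2 * theta / (sigma ^+ 2 * alpha ^+ 2 * E r + 2 * theta * sigma0 ^+ 2) =
    (kappa r / sd r) ^+ 2.
  rewrite expr_div_n sqr_sd sqr_kappa sqr_vs.
  by field; rewrite e0 D0 !gt_eqF.
have q0 : 0 <= kappa r / sd r by apply: divr_ge0 => //; exact: sqrtr_ge0.
rewrite sqrtr_sqr (ger0_norm q0).
by rewrite mulrCA mulrA.
Qed.

End ornstein_uhlenbeck.
Theorem theorem1 (R : realType) (d : measure_display) (T : measurableType d)
    (P : probability T R) (theta sigma mu0 sigma0 : R) (A : R -> R)
    (xi : {RV P >-> R}) (B : R -> {RV P >-> R}) (X : R -> R -> {RV P >-> R})
    (w_ : R -> R) (w : R)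
    (theta_gt0 : 0 < theta) (sigma_gt0 : 0 < sigma) (sigma0_gt0 : 0 < sigma0)
    (A_cont : {within `[0, +oo[, continuous A})
    (A_cvg0 : A t @[t --> +oo] --> 0)
    (A_int : (\int[lebesgue_measure]_(t in `[0%R, +oo[) `|A t|%:E < +oo)%E)
    (xi_normal : is_normal xi mu0 sigma0)
    (B_bm : standard_brownian_motion B)
    (xi_B_indep : independent_of_process xi B)
    (X_sol : forall e, 0 < e ->
      strong_solution (fun t x => - (theta - A t) * x) (e * sigma) xi B (X e))
    (w_gt0 : 0 < w)
    (w_cvg : w_ e @[e --> 0^'+] --> w) :
  let alpha := expR (- \int[lebesgue_measure]_(s in `[0, +oo[) A s) in
  let t_ e := `|ln e| / theta in
  let phi r := sigma0 * Num.sqrt (2 * theta /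
    (sigma ^+ 2 * alpha ^+ 2 * expR (2 * theta * r * w)
     + 2 * theta * sigma0 ^+ 2)) in
  let Mr r : 'M[R]_2 := \matrix_(i, j) (if i == j then 1 else phi r) in
  [/\ decorrelation_profile X (fun _ Q1 Q2 => kl_div Q1 Q2) +oo%E t_ w_
        (fun r => (2^-1 * ln (1 + 2 * theta * sigma0 ^+ 2 /
           (sigma ^+ 2 * alpha ^+ 2 * expR (2 * theta * r * w))))%:E),
      decorrelation_profile X
        (fun e Q1 Q2 => (wasserstein2 Q1 Q2 * e^-1%:E)%E) +oo%E t_ w_
        (fun r => (Num.sqrt (2 * sigma0 ^+ 2 *
           (sigma ^+ 2 / (2 * theta * sigma0 ^+ 2)
            + expR (- (2 * theta * r * w)) / alpha ^+ 2
            - Num.sqrt (sigma ^+ 4 / (4 * theta ^+ 2 * sigma0 ^+ 4)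
               + sigma ^+ 2 * expR (- (2 * r * theta * w)) /
                 (2 * theta * sigma0 ^+ 2 * alpha ^+ 2)))))%:E) &
      decorrelation_profile X (fun _ Q1 Q2 => tv_dist Q1 Q2) 1%E t_ w_
        (fun r => tv_dist (centred_gaussian2 (Mr r))
                          (centred_gaussian2 (1%:M : 'M[R]_2)))].
Proof.
move=> alpha t_ phi Mr.
have [f [V [[f0 V0] f_gt0 f_d V_d fE]]] := growth_factor theta A_cont.
have alpha0 : 0 < alpha by exact: expR_gt0.
pose kappa r := expR (- (theta * r * w)) / alpha.
pose vs := sigma * Num.sqrt (2 * theta)^-1.
have kappa0 r : 0 < kappa r by rewrite divr_gt0 ?expR_gt0.
have vs0 : 0 < vs by rewrite mulr_gt0// sqrtr_gt0 invr_gt0 mulr_gt0.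
pose T_ r e := t_ e + r * w_ e.
(* Slope 1 / f and noise e sigma sqrt V / f at the shifted time, both divided by e. *)
pose M_ r e := (f (T_ r e))^-1 / e.
pose S_ r e := sigma * Num.sqrt (V (T_ r e) / f (T_ r e) ^+ 2).
have Ty r : T_ r e @[e --> 0^'+] --> +oo.
  exact: (cutoff_shift_cvgy theta_gt0 w_gt0 w_cvg r).
have M_cvg r : M_ r e @[e --> 0^'+] --> kappa r.
  apply: cutoff_scaling => //.
  exact: (growth_factor_cvg A_cont A_int fE).
have S_cvg r : S_ r e @[e --> 0^'+] --> vs.
  apply: cvgM; first exact: cvg_cst.
  apply: continuous_cvg; first exact: sqrt_continuous.
  apply: (@cvg_comp _ _ _ (T_ r) (fun t => V t / f t ^+ 2) _ _ _ (Ty r)).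
  exact: (variance_ratio_cvg theta_gt0 A_cont A_cvg0 A_int f_gt0 f_d V_d fE).
pose J_ r e := joint_law (X e 0) (X e (T_ r e)).
pose I_ r e := product_law (X e 0) (X e (T_ r e)).
have pairE r : \forall e \near 0^'+, gaussian_pair mu0 sigma0 (e * M_ r e) (e * S_ r e)
    (J_ r e) (I_ r e).
  (* For negative [r] the shifted time need be positive only once [e] is small. *)
  near=> e.
  have e0 : 0 < e by near: e; exact: nbhs_right_gt.
  have T0 : 0 < T_ r e by near: e; move/cvgryPgt : (Ty r); exact.
  have VT := variance_gt0 V0 f_gt0 V_d T0.
  have ce : 0 < e * sigma by rewrite mulr_gt0.
  have [Z XE XZ] := solution_noise ce A_cont f0 V0 f_gt0 f_d V_d B_bm xi_B_indep
    (X_sol e e0) T0.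
  have [_ _ X0 _] := X_sol _ e0.
  have ME : e * M_ r e = (f (T_ r e))^-1 by rewrite /M_ mulrCA divff ?mulr1// gt_eqF.
  have SE : e * S_ r e = (f (T_ r e))^-1 * (e * sigma * Num.sqrt (V (T_ r e))).
    rewrite /S_ sqrtrM ?(ltW VT)// -exprVn sqrtr_sqr gtr0_norm ?invr_gt0//.
    by rewrite !mulrA mulrC !mulrA.
  have XE' u : X e (T_ r e) u = e * M_ r e * xi u + e * S_ r e * Z u.
    by rewrite XE ME SE mulrDr !mulrA.
  have S0 : 0 < e * S_ r e by rewrite SE mulr_gt0 ?invr_gt0// mulr_gt0// sqrtr_gt0.
  split => D mD.
    exact: (joint_gaussian_law sigma0_gt0 xi_normal XZ X0 XE' mD).
  exact: (product_gaussian_law sigma0_gt0 S0 xi_normal XZ X0 XE' mD).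
have ky : kappa r @[r --> +oo] --> 0.
  have : expR (- ((theta * w) * r)) / alpha @[r --> +oo] --> 0.
    by apply: expR_profile_cvg0; rewrite mulr_gt0.
  by under eq_fun do rewrite [theta * w * _]mulrAC.
have kNy : kappa r @[r --> -oo] --> +oo.
  have : expR (- ((theta * w) * r)) / alpha @[r --> -oo] --> +oo.
    by apply: expR_profile_cvgy => //; rewrite mulr_gt0.
  by under eq_fun do rewrite [theta * w * _]mulrAC.
have ty : t_ e @[e --> 0^'+] --> +oo by exact: cutoff_time_cvgy.
have wo : w_ =o_ (0^'+) t_ by exact: (cutoff_window_littleo theta_gt0 w_gt0 w_cvg).
split.
- split=> //.
  + by split => // e _; exact: diameter_kl_div.
  + move=> r; rewrite ou_kl_profile// -kl_profileE//.
    exact: (@kl_div_small_noise R (J_ r) (I_ r) (M_ r) (S_ r)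
      mu0 sigma0 (kappa r) vs sigma0_gt0 vs0 (M_cvg r) (S_cvg r) (pairE r)).
  + under eq_fun do rewrite ou_kl_profile//.
    split; first exact: kl_profile_cvgy.
    exact: kl_profile_cvg0.
- split=> //.
  + split => // e e0; apply: diameter_wasserstein2; by rewrite invr_gt0.
  + move=> r; rewrite ou_wasserstein2_profile//.
    exact: (@wasserstein2_small_noise R (J_ r) (I_ r) (M_ r) (S_ r)
      mu0 sigma0 (kappa r) vs sigma0_gt0 (kappa0 r) vs0 (M_cvg r) (S_cvg r) (pairE r)).
  + under eq_fun do rewrite ou_wasserstein2_profile//.
    split; first exact: wasserstein2_profile_cvgy.
    exact: wasserstein2_profile_cvg0.
have MrE r : Mr r = corr_mx (kappa r * sigma0 /
    Num.sqrt (kappa r ^+ 2 * sigma0 ^+ 2 + vs ^+ 2)).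
  by rewrite /corr_mx -ou_correlation.
have tvE r : tv_dist (centred_gaussian2 (Mr r)) (centred_gaussian2 (1%:M : 'M[R]_2)) =
    (1 - corr_overlap (kappa r * sigma0 /
    Num.sqrt (kappa r ^+ 2 * sigma0 ^+ 2 + vs ^+ 2)))%E.
  by rewrite MrE tv_corr// corr_profile_lt1.
split=> //.
+ by split => // e _; exact: diameter_tv_dist.
+ move=> r; rewrite MrE.
  exact: (@tv_dist_small_noise R (J_ r) (I_ r) (M_ r) (S_ r)
      mu0 sigma0 (kappa r) vs sigma0_gt0 vs0 (M_cvg r) (S_cvg r) (pairE r)).
+ under eq_fun do rewrite tvE.
  split; first exact: tv_profile_cvgy.
  exact: tv_profile_cvg0.
Unshelve. all: by end_near. Qed.
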